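(* Let $U$, $\mu$, $\tilde A$ be pseudodifferential operators on $L^2(\mathbb R)$ (depending on $h\ne0$, $|h|$ small), where $U$ is a unitary $3\times3$ operator with principal symbol $U_0(x,\xi)$, $\mu$ is a selfadjoint scalar operator with principal symbol $0$, $\tilde A$ is a selfadjoint $2\times2$ operator with principal symbol $A(x,\xi)$, and $$U^*\,\mathrm{Op}^W_h(M(x,\xi,h))\,U=\begin{pmatrix} \mu & 0 \\ 0 & \tilde A \end{pmatrix}.$$ Then the Weyl symbol of $\mu$ satisfies $$\sigma^W(\mu)(x,\xi,h)=-h\,\frac{3-p^\triangle(x,\xi)}{4\,(3+p^\triangle(x,\xi))}+\mathcal O(h^2).$$
   Context: Symbols are functions $p(x,\xi,h)$ smooth in $(x,\xi)\in\mathbb R^2$, depending on $h\in[-h_0,h_0]$ ($h_0>0$ small), such that for all $(j,k)\in\mathbb N^2$ there is $C_{j,k}$ with $|\partial_x^j\partial_\xi^kp(x,\xi,h)|\le C_{j,k}$ for all $(x,\xi)$ (and $h$). For matrix-valued symbols this is understood entrywise. For $0<|h|\le h_0$ the Weyl quantization is $$\mathrm{Op}^W_h(p)u(x)=\frac1{2\pi h}\iint e^{i(x-y)\xi/h}\,p\big(\tfrac{x+y}2,\xi,h\big)u(y)\,dy\,d\xi .$$ $\sigma^W(P)$ denotes the Weyl symbol of a pseudodifferential operator $P$. The operators considered have expansions $\sigma^W(P)=\sigma_0^W(P)+h\,\sigma_{-1}^W(P)+\mathcal O(h^2)$, and $\sigma_0^W(P)$ is called the principal symbol. The symbol $M(x,\xi,h)$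 (Hou's operator for $\omega=0$, $\gamma=4\pi+h$) is $$M(x,\xi,h)=\begin{pmatrix} 0 & i e^{ih/8}(e^{-ix}+e^{-i(x-\xi)}) & -ie^{-ih/8}(e^{-ix}+e^{-i\xi}) \\ -ie^{-ih/8}(e^{ix}+e^{i(x-\xi)}) & 0 & ie^{ih/8}(e^{i(x-\xi)}+e^{-i\xi}) \\ i e^{ih/8}(e^{ix}+e^{i\xi}) & -ie^{-ih/8}(e^{-i(x-\xi)}+e^{i\xi}) & 0 \end{pmatrix},$$ and $M_0(x,\xi)=M(x,\xi,0)$. Also $p^\triangle(x,\xi)=\cos x+\cos\xi+\cos(x-\xi)$. $U_0(x,\xi)$ is a family of unitary $3\times3$ matrices, depending smoothly on $(x,\xi)\in\mathbb R^2$ and $2\pi$-periodic in each variable. $A(x,\xi)$ is a family of selfadjoint $2\times2$ matrices with spectrum contained in $[-2\sqrt3,-\sqrt3]\cup[\sqrt3,2\sqrt3]$. They satisfy $$U_0^*(x,\xi)M_0(x,\xi)U_0(x,\xi)=\begin{pmatrix} 0 & 0 \\ 0 & A(x,\xi) \end{pmatrix}$$ (block sizes $1+2$). Such $U_0,A$, and operators $U,\mu,\tilde A$ as in the claim, exist. *)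

(* Defs.v *)
From HB Require Import structures.
From mathcomp Require Import all_boot all_order all_algebra.
From mathcomp Require Import complex.
From mathcomp Require Import all_classical all_reals all_analysis.

Set Implicit Arguments.
Unset Strict Implicit.
Unset Printing Implicit Defensive.

Import Order.TTheory GRing.Theory Num.Theory.
Import numFieldNormedType.Exports.

Local Open Scope classical_set_scope.
Local Open Scope ring_scope.
Local Open Scope complex_scope.

Section Symbols.
Context {R : realType}.
Implicit Types (m n : nat).

Fixpoint classC2 (k : nat) (f : R -> R -> R) : Prop :=
  continuous (fun z : R * R => f z.1 z.2) /\
  if k is k'.+1 then
    [/\ forall x xi, derivable (f^~ xi) x 1,
        forall x xi, derivable (f x) xi 1,
        classC2 k' (fun x xi => derive1 (f^~ xi) x) &
        classC2 k' (fun x xi => derive1 (f x) xi)]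
  else True.

Definition smooth2 (f : R -> R -> R[i]) : Prop :=
  forall k, classC2 k (fun x xi => complex.Re (f x xi)) /\
            classC2 k (fun x xi => complex.Im (f x xi)).

Definition smooth2_mx m n (F : R -> R -> 'M[R[i]]_(m, n)) : Prop :=
  forall a b, smooth2 (fun x xi => F x xi a b).

Definition rpderiv (j k : nat) (f : R -> R -> R) (x xi : R) : R :=
  derive1n j (fun x' => derive1n k (f x') xi) x.

Definition pderiv (j k : nat) (f : R -> R -> R[i]) (x xi : R) : R[i] :=
  rpderiv j k (fun x' xi' => complex.Re (f x' xi')) x xi +i*
  rpderiv j k (fun x' xi' => complex.Im (f x' xi')) x xi.

(* The constants C are uniform in h. *)
Definition symbol (h0 : R) m n (p : R -> R -> R -> 'M[R[i]]_(m, n)) : Prop :=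
  (forall h, `|h| <= h0 -> smooth2_mx (fun x xi => p x xi h)) /\
  forall a b j k, exists C : R, forall x xi h, `|h| <= h0 ->
    `|pderiv j k (fun x' xi' => p x' xi' h a b) x xi| <= C%:C.

(* O(h^2) is meant in the symbol class: all derivatives are O(h^2) uniformly
   in (x, xi). *)
Definition bigO_h2 (h0 : R) m n (r : R -> R -> R -> 'M[R[i]]_(m, n)) : Prop :=
  forall a b j k, exists C : R, forall x xi h, `|h| <= h0 ->
    `|pderiv j k (fun x' xi' => r x' xi' h a b) x xi| <= (C * h ^+ 2)%:C.

(* p = p0 + h p1 + O(h^2), where the symbols p0 and p1 do not depend on h. *)
Definition principal_symbol (h0 : R) m n (p : R -> R -> R -> 'M[R[i]]_(m, n))
    (p0 : R -> R -> 'M[R[i]]_(m, n)) : Prop :=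
  symbol h0 (fun x xi _ => p0 x xi) /\
  exists p1 : R -> R -> 'M[R[i]]_(m, n),
    symbol h0 (fun x xi _ => p1 x xi) /\
    bigO_h2 h0 (fun x xi h => p x xi h - p0 x xi - h%:C *: p1 x xi).

End Symbols.

Section Operators.
Context {R : realType}.
Implicit Types (m n : nat).

Local Notation leb := (@lebesgue_measure R).

Definition cintegral (f : R -> R[i]) : R[i] :=
  (\int[leb]_x complex.Re (f x)) +i* (\int[leb]_x complex.Im (f x)).

Definition vintegral n (f : R -> 'cV[R[i]]_n) : 'cV[R[i]]_n :=
  \col_a cintegral (fun x => f x a 0).

(* Elements of L^2(R; C^n) are represented by functions satisfying [L2],
   up to the equality almost everywhere [eqae]. *)
Definition eqae n (u v : R -> 'cV[R[i]]_n) : Prop :=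
  {ae leb, forall x, u x = v x}.

Definition sqnorm (z : R[i]) : R := complex.Re z ^+ 2 + complex.Im z ^+ 2.

Definition L2 n (u : R -> 'cV[R[i]]_n) : Prop :=
  forall a,
    [/\ measurable_fun setT (fun x => complex.Re (u x a 0)),
        measurable_fun setT (fun x => complex.Im (u x a 0)) &
        (\int[leb]_x (sqnorm (u x a 0))%:E < +oo)%E].

Definition L2norm n (u : R -> 'cV[R[i]]_n) : R :=
  Num.sqrt (\sum_a \int[leb]_x sqnorm (u x a 0)).

Definition L2dot n (u v : R -> 'cV[R[i]]_n) : R[i] :=
  \sum_a cintegral (fun x => u x a 0 * (v x a 0)^*).

Definition operator m n : Type := (R -> 'cV[R[i]]_n) -> (R -> 'cV[R[i]]_m).

(* Bounded linear operators from L^2(R; C^n) to L^2(R; C^m); linearity and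
   boundedness make T compatible with equality almost everywhere. *)
Definition bounded_operator m n (T : operator m n) : Prop :=
  [/\ forall u, L2 u -> L2 (T u),
      forall (c : R[i]) u v, L2 u -> L2 v ->
        eqae (T (fun x => c *: u x + v x)) (fun x => c *: T u x + T v x) &
      exists C : R, forall u, L2 u -> L2norm (T u) <= C * L2norm u].

Definition eqop m n (T S : operator m n) : Prop :=
  forall u, L2 u -> eqae (T u) (S u).

Definition adjoint m n (T : operator m n) (S : operator n m) : Prop :=
  [/\ bounded_operator T, bounded_operator S &
      forall u v, L2 u -> L2 v -> L2dot (T u) v = L2dot u (S v)].

Definition selfadjoint n (T : operator n n) : Prop := adjoint T T.

(* T is unitary and S is its adjoint T^*. *)
Definition unitary_with_adjoint n (T S : operator n n) : Prop :=
  [/\ adjoint T S, eqop (S \o T) id & eqop (T \o S) id].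

Definition diag_operator m n (T : operator m m) (S : operator n n) :
    operator (m + n) (m + n) :=
  fun u x => col_mx (T (fun y => usubmx (u y)) x) (S (fun y => dsubmx (u y)) x).

Definition rschwartz (f : R -> R) : Prop :=
  (forall k x, derivable (derive1n k f) x 1) /\
  forall j k, exists C : R, forall x, `|x ^+ j * derive1n k f x| <= C.

Definition schwartz n (u : R -> 'cV[R[i]]_n) : Prop :=
  forall a, rschwartz (fun x => complex.Re (u x a 0)) /\
            rschwartz (fun x => complex.Im (u x a 0)).

Definition expi (t : R) : R[i] := cos t +i* sin t.

(* The Weyl quantization formula, as an iterated integral (first in y, then in
   xi). For a bounded symbol and a Schwartz function u both integrals converge
   absolutely. For h < 0 the prefactor 1 / (2 pi h) is negative, so that the
   symbol 1 is quantized as - id. *)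
Definition weyl m n (h : R) (p : R -> R -> R -> 'M[R[i]]_(m, n))
    (u : R -> 'cV[R[i]]_n) (x : R) : 'cV[R[i]]_m :=
  ((2 * pi * h)^-1)%:C *:
  vintegral (fun xi => vintegral (fun y =>
    expi ((x - y) * xi / h) *: (p ((x + y) / 2) xi h *m u y))).

(* T is the bounded operator on L^2 which is given on Schwartz functions by the
   Weyl formula; T is determined by p and h since these functions are dense. *)
Definition weyl_quantization m n (h : R) (p : R -> R -> R -> 'M[R[i]]_(m, n))
    (T : operator m n) : Prop :=
  bounded_operator T /\ forall u, schwartz u -> eqae (T u) (weyl h p u).

(* (P h), for 0 < |h| <= h0, is a pseudodifferential operator with Weyl
   symbol p. *)
Definition weyl_symbol_of (h0 : R) m n (P : R -> operator m n)
    (p : R -> R -> R -> 'M[R[i]]_(m, n)) : Prop :=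
  symbol h0 p /\
  forall h, 0 < `|h| <= h0 -> weyl_quantization h p (P h).

End Operators.

Section Hou.
Context {R : realType}.

Definition hou (x xi h : R) : 'M[R[i]]_(1 + 2) :=
  let e := @expi R in
  \matrix_(a, b) nth 0 (nth [::]
    [:: [:: 0;
            'i * e (h / 8) * (e (- x) + e (- (x - xi)));
            - 'i * e (- (h / 8)) * (e (- x) + e (- xi)) ];
        [:: - 'i * e (- (h / 8)) * (e x + e (x - xi));
            0;
            'i * e (h / 8) * (e (x - xi) + e (- xi)) ];
        [:: 'i * e (h / 8) * (e x + e xi);
            - 'i * e (- (h / 8)) * (e (- (x - xi)) + e xi);
            0 ] ] a) b.

Definition hou0 (x xi : R) : 'M[R[i]]_(1 + 2) := hou x xi 0.

Definition ptriangle (x xi : R) : R := cos x + cos xi + cos (x - xi).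

End Hou.

(* Main.v *)
Require Import Defs.
From HB Require Import structures.
From mathcomp Require Import all_boot all_order all_algebra.
From mathcomp Require Import complex.
From mathcomp Require Import all_classical all_reals all_analysis.
From mathcomp Require Import measurable_realfun ring lra.
Import Order.TTheory GRing.Theory Num.Theory.
Import numFieldNormedType.Exports.
Local Open Scope ring_scope.
Local Open Scope complex_scope.
Local Open Scope sesquilinear_scope.

(** Since the principal symbol of mu vanishes, the symbol of mu is
    h p1 + O(h^2) in the symbol class, for a function p1 of (x, xi). All that
    remains is to compute p1 at an arbitrary point (x0, xi0). This is done by
    testing the block diagonalization, for h = e^2 and e -> 0+, against
    functions concentrated at that point of phase space.

    Rescaling. The substitution x = x0 + e X, together with a modulation of
    frequency xi0 / h, is a multiple of a unitary map, and it turns the Weyl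
    quantization of p(x, xi, h) with parameter h into that of
    p(x0 + e X, xi0 + e Xi, h) with parameter 1 ([weyl_wave]). As e -> 0 the
    symbol freezes at (x0, xi0). Hence, acting on a rescaled Gaussian, an
    operator with principal symbol p0 converges in L^2 to multiplication by
    the matrix p0(x0, xi0) ([L2cvg_operator_packet]). This applies to U, with
    limit U0(x0, xi0), and to mu / h, with limit p1(x0, xi0).

    The test function. Let k = [kervec], a smooth section of the kernel of M0,
    let g be the Gaussian, and let c = (d/dx + i d/dxi) k = [kercor]. The
    packet (k + e X c) g is chosen so that its image under the quantization
    of M is of order e^2 = h: its term of order 0 is M0 k g = 0, and its term
    of order e is X g times (d/dx + i d/dxi) (M0 k) = 0. Divided by h the
    image converges to an explicit function q, a Gaussian times an even
    quadratic polynomial ([L2cvg_hou]). The entries of M are sums of plane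
    waves, whose quantizations are exactly translations followed by
    modulations, so this is a Taylor expansion of explicit functions.

    The pairing. Write chi for the rescaled packet, G for the rescaled scalar
    Gaussian and S for the adjoint of U. Since S Op(M) U is block diagonal,
    (U (G, 0), Op(M) chi) = (mu G, (S chi)_1) ([block_pairing]). The first
    column w of U0(x0, xi0) spans the kernel of M0(x0, xi0), so k = kap w
    ([kernel_line]), and as S is an isometry the function S chi is asymptotic
    to (kap G, 0) ([L2cvg_adjoint]). Dividing by h and letting e -> 0 gives
    (w g, q) = p1 conj(kap) |g|^2 ([subprincipal_pairing]). After
    multiplication by kap the left-hand side is (k g, q), which equals
    - |g|^2 (3 - ptriangle) / 2 ([kervec_order2]), and this yields
    p1 |kap|^2 = - (3 - ptriangle) / 2. Since
    |kap|^2 = |k|^2 = 2 (3 + ptriangle) ([sqnorm_kervec]), the value of p1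
    follows. *)

(** * Integrals over the real line *)

Section RealIntegrals.
Local Open Scope classical_set_scope.
Context {R : realType}.
Local Notation leb := (@lebesgue_measure R).
Implicit Types (f g F : R -> R).

Definition summable f : Prop := leb.-integrable setT (EFin \o f).

(** The integrable majorant of all the domination arguments: it bounds
    Gaussians times polynomials, and also an inner oscillatory integral
    after two integrations by parts. *)
Definition lorentz (x : R) : R := (1 + x ^+ 2)^-1.

Lemma lorentz_gt0 x : 0 < lorentz x.
Proof. by rewrite invr_gt0 ltr_pwDl// sqr_ge0. Qed.

Lemma lorentz_ge0 x : 0 <= lorentz x.
Proof. exact/ltW/lorentz_gt0. Qed.

Lemma lorentz_le1 x : lorentz x <= 1.
Proof. by rewrite /lorentz invf_le1 ?ltr_pwDl ?sqr_ge0// lerDl sqr_ge0. Qed.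

(** Spares the users of a majorant C * lorentz the hypothesis 0 <= C. *)
Lemma lorentz_majorant_ge0 (a C x : R) : `|a| <= C * lorentz x -> 0 <= C.
Proof.
by move=> /(le_trans (normr_ge0 _)); rewrite pmulr_lge0// lorentz_gt0.
Qed.

Lemma continuous_lorentz : continuous lorentz.
Proof. exact: continuous_oneDsqrV. Qed.

Lemma summable_lorentz : summable lorentz.
Proof.
have c := continuous_lorentz.
apply/integrableP; split.
  by apply/measurable_EFinP; exact: continuous_measurable_fun.
rewrite [ltLHS](_ : _ = (\int[leb]_x (lorentz x)%:E)%E); last first.
  by apply: eq_integral => x _; rewrite /= ger0_norm// lorentz_ge0.
rewrite ge0_symfun_integralT//.
- rewrite [X in (\int[_]_(x in X) _)%E](_ : _ = `[0, +oo[%classic); last first.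
    by apply/seteqP; split => x/=; rewrite in_itv/= andbT.
  by rewrite integral0y_oneDsqr -EFinM ltry.
- exact: lorentz_ge0.
- by move=> x /=; rewrite /lorentz sqrrN.
Qed.

Lemma summableZ (c : R) f : summable f -> summable (fun x => c * f x).
Proof.
move=> fi; rewrite /summable /comp; under eq_fun do rewrite EFinM.
exact: integrableZl.
Qed.

Lemma summableD f g :
  summable f -> summable g -> summable (fun x => f x + g x).
Proof.
move=> fi gi; rewrite /summable /comp; under eq_fun do rewrite EFinD.
exact: integrableD.
Qed.

Lemma summableB f g :
  summable f -> summable g -> summable (fun x => f x - g x).
Proof.
move=> fi gi; rewrite /summable /comp; under eq_fun do rewrite EFinB.
exact: integrableB.
Qed.

Lemma summable_measurable f : summable f -> measurable_fun setT f.
Proof. by move=> /integrableP[/measurable_EFinP]. Qed.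

Lemma dominated_summable f g : measurable_fun setT f ->
  (forall x, `|f x| <= g x) -> summable g -> summable f.
Proof.
move=> mf fg gi; apply: le_integrable gi => //; first exact/measurable_EFinP.
by move=> x _; rewrite /= lee_fin (le_trans (fg x))// ler_norm.
Qed.

Lemma lorentz_summable f (C : R) : measurable_fun setT f ->
  (forall x, `|f x| <= C * lorentz x) -> summable f.
Proof.
by move=> mf fC; apply: dominated_summable fC _ => //; apply: summableZ;
  exact: summable_lorentz.
Qed.

Lemma le_norm_Rintegral f g : summable f -> summable g ->
  (forall x, `|f x| <= g x) -> `|\int[leb]_x f x| <= \int[leb]_x g x.
Proof.
move=> fi gi fg; apply: (le_trans (le_normr_Rintegral _ fi)) => //.
apply: le_Rintegral => //.
exact: integrable_norm.
Qed.

Lemma norm_Rintegral_lorentz f (C : R) : measurable_fun setT f ->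
  (forall x, `|f x| <= C * lorentz x) ->
  `|\int[leb]_x f x| <= C * \int[leb]_x lorentz x.
Proof.
move=> mf fC; rewrite -RintegralZl//; last exact: summable_lorentz.
by apply: le_norm_Rintegral => //; [exact: lorentz_summable fC|
  apply: summableZ; exact: summable_lorentz].
Qed.

Lemma ae_imply (P Q : R -> Prop) : (forall x, P x -> Q x) ->
  {ae leb, forall x, P x} -> {ae leb, forall x, Q x}.
Proof.
move=> PQ [N [mN N0 sN]]; exists N; split => // x nQ.
by apply: sN => /= p; apply: nQ; exact: PQ.
Qed.

Lemma ae_imply2 (P Q S : R -> Prop) : (forall x, P x -> Q x -> S x) ->
  {ae leb, forall x, P x} -> {ae leb, forall x, Q x} ->
  {ae leb, forall x, S x}.
Proof.
move=> PQS h1 h2; have := negligibleU h1 h2.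
apply: negligibleS => x /= nS; apply: contrapT => /not_orP[/contrapT p].
by move=> /contrapT q; apply: nS; exact: PQS.
Qed.

Lemma cvg_Rintegral (f_ : nat -> R -> R) f g :
  (forall n, measurable_fun setT (f_ n)) -> measurable_fun setT f ->
  {ae leb, forall x, f_ ^~ x @ \oo --> f x} ->
  {ae leb, forall x n, `|f_ n x| <= g x} -> summable g ->
  summable f /\ \int[leb]_x f_ n x @[n --> \oo] --> \int[leb]_x f x.
Proof.
move=> mf_ mf f_f f_g gi.
have [] := @dominated_convergence _ _ _ leb setT measurableT
  (fun n => EFin \o f_ n) (EFin \o f) (EFin \o g).
- by move=> n /=; apply/measurable_EFinP; exact: mf_.
- by apply/measurable_EFinP; exact: mf.
- by apply: ae_imply f_f => x H _; apply: cvg_EFin; [exact: nearW|exact: H].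
- exact: gi.
- apply: ae_imply f_g => x H n _; rewrite /= lee_fin; exact: H.
move=> fi _ cv; split => //.
have fin : (\int[leb]_x (EFin \o f) x)%E \is a fin_num.
  exact: integrable_fin_num.
by apply: fine_cvg; rewrite fineK.
Qed.

(** The primitive tends to 0 at both ends because [lorentz] does. With F a
    product, this is integration by parts without boundary terms. *)
Lemma FTC_line F f (C : R) : (forall x : R, is_derive x 1 F (f x)) ->
  continuous f -> (forall x, `|f x| <= C * lorentz x) ->
  (forall x, `|F x| <= C * lorentz x) -> \int[leb]_x f x = 0.
Proof.
move=> dF cf fC FC.
have mf : measurable_fun setT f by exact: continuous_measurable_fun.
have dF1 x : derivable F x 1 by case: (dF x).
have cF : continuous F.
  by move=> x; exact/differentiable_continuous/derivable1_diffP.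
have fi : summable f by exact: lorentz_summable fC.
pose b (n : nat) : R := n.+1%:R.
pose f_ n := f \_ `[- b n, b n].
have step n : \int[leb]_x f_ n x = F (b n) - F (- b n).
  have bn : - b n < b n by rewrite gtrN// ltr0n.
  rewrite /f_ -Rintegral_mkcond /Rintegral (@continuous_FTC2 _ _ F)//.
  - exact: continuous_subspaceT.
  - split; first by [].
    + exact/cvg_at_right_filter/cF.
    + exact/cvg_at_left_filter/cF.
  - by move=> x _; rewrite derive1E; case: (dF x).
have cvf : \int[leb]_x f_ n x @[n --> \oo] --> \int[leb]_x f x.
  apply: (@cvg_Rintegral _ _ (fun x => `|f x|) _ _ _ _ _).2 => //.
  - by move=> n; apply/measurable_restrict => //; exact: measurable_funTS.
  - apply: aeW => x; apply: cvg_near_cst; near=> n.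
    rewrite /f_ patchE mem_set//= in_itv/= -ler_norml.
    near: n; exists (Num.truncn `|x|) => // n /= xn.
    by rewrite (le_trans (ltW (truncnS_gt _)))// ler_nat ltnS.
  - by apply: aeW => x n; rewrite /f_ patchE; case: ifP => // _; rewrite normr0.
  - exact: integrable_norm.
have cv0 : \int[leb]_x f_ n x @[n --> \oo] --> (0 : R).
  have C0 : 0 <= C.
    exact: lorentz_majorant_ge0 (FC 0).
  have bb n : lorentz (b n) <= (b n)^-1.
    rewrite /lorentz lef_pV2 ?posrE ?ltr_pwDl ?sqr_ge0 ?ltr0n//.
    by rewrite /b expr2; have : 1 <= n.+1%:R :> R; rewrite ?ler1n//; nra.
  apply: norm_cvg0.
  have up : 2 * C * (b n)^-1 @[n --> \oo] --> (0 : R).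
    rewrite -[X in _ --> X](mulr0 (2 * C)); apply: cvgMr.
    exact: cvg_harmonic.
  apply: (squeeze_cvgr _ _ up); last exact: (@cvg_cst _ (0 : R)).
  apply: nearW => n /=; rewrite normr_ge0/= step.
  have h1 := FC (b n); have h2 := FC (- b n).
  have h3 : lorentz (- b n) = lorentz (b n) by rewrite /lorentz sqrrN.
  rewrite h3 in h2; have h4 := ler_wpM2l C0 (bb n).
  apply: (le_trans (ler_normB _ _)); rewrite -mulrA mulr_natl mulr2n.
  by apply: lerD; apply: le_trans h4.
by rewrite -(cvg_lim _ cvf)// (cvg_lim _ cv0).
Unshelve. all: end_near. Qed.

End RealIntegrals.

Section UnderIntegral.
Local Open Scope classical_set_scope.
Context {R : realType}.
Local Notation leb := (@lebesgue_measure R).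

Lemma continuous_is_derive (F f : R -> R) :
  (forall x : R, is_derive x 1 F (f x)) -> continuous F.
Proof.
move=> dF x; apply/differentiable_continuous/derivable1_diffP.
by case: (dF x).
Qed.

Lemma continuous_under (f : R -> R -> R) (C : R) :
  (forall x, measurable_fun setT (f x)) ->
  (forall y, continuous (f ^~ y)) ->
  (forall x y, `|f x y| <= C * lorentz y) ->
  continuous (fun x => \int[leb]_y f x y).
Proof.
move=> mf cf fC x.
have xI : x \in (`]x - 1, x + 1[%classic : set R).
  by rewrite inE /= in_itv /= ltrBlDr !ltrDl ltr01.
apply: (@continuity_under_integral _ _ _ leb f setT measurableT (x - 1) (x + 1)
  _ _ (fun y => C * lorentz y) _ _ x xI).
- by move=> z _; exact: lorentz_summable (fC z).
- by apply: aeW => y _ z _; exact: cf.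
- by apply: summableZ; exact: summable_lorentz.
- by move=> z _; apply: aeW => y _; exact: fC.
Qed.

(** The majorant is independent of the parameter, so differentiation under
    the integral sign applies on a neighbourhood of every x. *)
Lemma is_derive_under (f f' : R -> R -> R) (C : R) :
  (forall x, measurable_fun setT (f x)) ->
  (forall x y : R, is_derive x 1 (f ^~ y) (f' x y)) ->
  (forall x y, `|f x y| <= C * lorentz y) ->
  (forall x y, `|f' x y| <= C * lorentz y) ->
  forall x : R,
  is_derive x 1 (fun x => \int[leb]_y f x y) (\int[leb]_y f' x y).
Proof.
move=> mf df fC f'C x.
have d1 z y : (f ^~ y)^`() z = f' z y.
  by rewrite derive1E; case: (df z y).
have xI : (`]x - 1, x + 1[%classic : set R) x.
  by rewrite /= in_itv /= ltrBlDr !ltrDl ltr01.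
have i1 z : `]x - 1, x + 1[%classic z -> leb.-integrable setT (EFin \o f z).
  by move=> _; exact: lorentz_summable (fC z).
have i2 z y : `]x - 1, x + 1[%classic z -> setT y -> derivable (f ^~ y) z 1.
  by move=> _ _; case: (df z y).
have C0 : 0 <= C := lorentz_majorant_ge0 _ _ _ (fC 0 0).
have G0 y : 0 <= C * lorentz y by rewrite mulr_ge0// lorentz_ge0.
have iG : leb.-integrable setT (EFin \o (fun y => C * lorentz y)).
  by apply: summableZ; exact: summable_lorentz.
have Gub z y : `]x - 1, x + 1[%classic z -> setT y ->
    `|(f ^~ y)^`() z| <= C * lorentz y.
  by move=> _ _; rewrite d1.
have := @derivable_under_integral _ _ _ leb f setT measurableT x _ _ xI i1 i2 _
  G0 iG Gub.
have := @differentiation_under_integral _ _ _ leb f setT measurableT x _ _ xI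
  i1 i2 _ G0 iG Gub.
rewrite derive1E => D1 D2; apply: DeriveDef => //.
by rewrite D1; apply: eq_Rintegral => y _; exact: d1.
Qed.

End UnderIntegral.

Section Affine.
Local Open Scope classical_set_scope.
Context {R : realType}.
Local Notation leb := (@lebesgue_measure R).
Variables (a b : R) (a_gt0 : 0 < a).

Let phi (x : R) : R := b + a * x.

Let mphi : measurable_fun setT (phi : measurableTypeR R -> measurableTypeR R).
Proof.
apply: (@continuous_measurable_fun R phi) => x.
by apply: cvgD; [exact: cvg_cst|apply: cvgMr; exact: cvg_id].
Qed.

Let push : {measure set (measurableTypeR R) -> \bar R} :=
  measure_function_pushforward__canonical__measure_function_Measure leb mphi.

Let nu : {measure set (measurableTypeR R) -> \bar R} :=
  mscale (NngNum (ltW a_gt0)) push.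

Let preimage_phi (u v : R) :
  phi @^-1` `]u, v] = `](u - b) / a, (v - b) / a].
Proof.
apply/seteqP; split=> x; rewrite /phi/= !in_itv/=;
  rewrite ltr_pdivrMr// ler_pdivlMr// ltrBlDl lerBrDl; rewrite (mulrC x);
  by [].
Qed.

Let lebE A : measurable A -> leb A = nu A.
Proof.
apply: lebesgue_measure_unique => _ [[u v] _ <-].
rewrite [RHS](_ : _ = (a%:E * leb (phi @^-1` `]u, v]))%E)// preimage_phi.
rewrite !lebesgue_measure_itv/= !lte_fin ltr_pM2r ?invr_gt0// ltrD2r.
case: ifPn => [uv|_]; last by rewrite mule0.
rewrite -!EFinB -EFinM -mulrBl mulrCA divff ?gt_eqF// mulr1.
by rewrite opprB addrA subrK.
Qed.

(** The image of Lebesgue measure under x -> b + a x, multiplied by a, gives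
    half-open intervals their length; by uniqueness it is Lebesgue measure. *)
Lemma ge0_integral_affine (f : R -> \bar R) :
  measurable_fun setT f -> (forall x, (0 <= f x)%E) ->
  (\int[leb]_x f x = a%:E * \int[leb]_x f (b + a * x)%R)%E.
Proof.
move=> mf f0.
rewrite (eq_measure_integral nu); last by move=> A mA _; exact: lebE.
rewrite ge0_integral_mscale//=; congr (_ * _)%E.
by rewrite ge0_integral_pushforward// preimage_setT.
Qed.

Lemma summable_affine (f : R -> R) :
  summable f -> summable (fun x => f (b + a * x)).
Proof.
move=> fi; have mf := summable_measurable _ fi.
have mg : measurable_fun setT (fun x : R => f (b + a * x)).
  exact: (measurableT_comp mf mphi).
apply/integrableP; split; first exact/measurable_EFinP.
have /integrableP[_] := fi.
rewrite (ge0_integral_affine (fun x => `|(EFin \o f) x|)%E)//; last first.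
  by apply: measurableT_comp => //; exact/measurable_EFinP.
move=> h; rewrite ltNge leye_eq; apply/negP => /eqP E.
by move: h; rewrite /= E gt0_muley ?lte_fin.
Qed.

Lemma Rintegral_affine (f : R -> R) : summable f ->
  \int[leb]_x f x = a * \int[leb]_x f (b + a * x).
Proof.
move=> fi; have mf := summable_measurable _ fi.
have gi := summable_affine _ fi.
have mf' : measurable_fun setT (EFin \o f) by exact/measurable_EFinP.
have [fp fn] := (integrable_funepos measurableT fi,
  integrable_funeneg measurableT fi).
have [gp gn] := (integrable_funepos measurableT gi,
  integrable_funeneg measurableT gi).
have Ep : (\int[leb]_x ((EFin \o f)^\+ x) =
    a%:E * \int[leb]_x ((EFin \o (fun x => f (b + a * x)%R))^\+ x))%E.
  rewrite ge0_integral_affine//; last exact: measurable_funepos.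
  by congr (_ * _)%E; apply: eq_integral => x _; rewrite !funeposE.
have En : (\int[leb]_x ((EFin \o f)^\- x) =
    a%:E * \int[leb]_x ((EFin \o (fun x => f (b + a * x)%R))^\- x))%E.
  rewrite ge0_integral_affine//; last exact: measurable_funeneg.
  by congr (_ * _)%E; apply: eq_integral => x _; rewrite !funenegE.
have hp := integrable_fin_num measurableT gp.
have hn := integrable_fin_num measurableT gn.
rewrite /Rintegral integralE [in RHS]integralE [X in fine (X - _)]Ep.
rewrite [X in fine (_ - X)]En -muleBr//.
  by rewrite fineM// fin_numB; apply/andP; split.
by apply: fin_num_adde_defl; rewrite fin_numN.
Qed.

Lemma ae_affine (P : R -> Prop) :
  {ae leb, forall x, P x} -> {ae leb, forall x, P (b + a * x)}.
Proof.
move=> [N [mN N0 sN]]; exists (phi @^-1` N); split.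
- by rewrite -(setTI (_ @^-1` _)); exact: mphi.
- have : nu N = 0%E by rewrite -lebE.
  rewrite /nu /= /mscale /= /pushforward => /eqP.
  by rewrite mule_eq0 eqe gt_eqF//= => /eqP.
- by move=> x /= nP; apply: sN.
Qed.

End Affine.

(** * Derivatives and continuity of explicit functions *)

Section PointwiseCalculus.
Context {R : realType}.
Implicit Types (f g : R -> R) (x a b : R).

Lemma derc (c : R) x : is_derive x 1 (fun _ : R => c) 0.
Proof. exact: is_derive_cst. Qed.

Lemma deri x : is_derive x 1 (fun y : R => y) 1.
Proof. exact: is_derive_id. Qed.

Lemma derD f g x a b : is_derive x 1 f a -> is_derive x 1 g b ->
  is_derive x 1 (fun y => f y + g y) (a + b).
Proof. by move=> df dg; exact: is_deriveD. Qed.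

Lemma derB f g x a b : is_derive x 1 f a -> is_derive x 1 g b ->
  is_derive x 1 (fun y => f y - g y) (a - b).
Proof. by move=> df dg; exact: is_deriveB. Qed.

Lemma derN f x a : is_derive x 1 f a -> is_derive x 1 (fun y => - f y) (- a).
Proof. by move=> df; exact: is_deriveN. Qed.

Lemma derM f g x a b : is_derive x 1 f a -> is_derive x 1 g b ->
  is_derive x 1 (fun y => f y * g y) (f x * b + g x * a).
Proof. by move=> df dg; exact: is_deriveM. Qed.

Lemma der_comp (F : R -> R) (F' : R) g x b :
  is_derive (g x) 1 F F' -> is_derive x 1 g b ->
  is_derive x 1 (fun y => F (g y)) (F' * b).
Proof. by move=> dF dg; exact: is_derive1_comp. Qed.

Lemma der_cos g x b : is_derive x 1 g b ->
  is_derive x 1 (fun y => cos (g y)) (- sin (g x) * b).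
Proof. by apply: der_comp; exact: is_derive_cos. Qed.

Lemma der_sin g x b : is_derive x 1 g b ->
  is_derive x 1 (fun y => sin (g y)) (cos (g x) * b).
Proof. by apply: der_comp; exact: is_derive_sin. Qed.

Lemma der_expR g x b : is_derive x 1 g b ->
  is_derive x 1 (fun y => expR (g y)) (expR (g x) * b).
Proof. by apply: der_comp; exact: is_derive_expR. Qed.

Lemma der_eq f x a b : is_derive x 1 f a -> a = b -> is_derive x 1 f b.
Proof. by move=> + <-. Qed.

Lemma contc (c : R) : continuous (fun _ : R => c).
Proof. by move=> x; exact: cvg_cst. Qed.

Lemma conti : continuous (fun y : R => y).
Proof. by move=> x; exact: cvg_id. Qed.

Lemma contD f g : continuous f -> continuous g ->
  continuous (fun y => f y + g y).
Proof. by move=> cf cg x; apply: cvgD; [exact: cf|exact: cg]. Qed.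

Lemma contB f g : continuous f -> continuous g ->
  continuous (fun y => f y - g y).
Proof. by move=> cf cg x; apply: cvgB; [exact: cf|exact: cg]. Qed.

Lemma contN f : continuous f -> continuous (fun y => - f y).
Proof. by move=> cf x; apply: cvgN; exact: cf. Qed.

Lemma contM f g : continuous f -> continuous g ->
  continuous (fun y => f y * g y).
Proof. by move=> cf cg x; apply: cvgM; [exact: cf|exact: cg]. Qed.

Lemma cont_comp (F : R -> R) g : continuous F -> continuous g ->
  continuous (fun y => F (g y)).
Proof. by move=> cF cg x; apply: continuous_comp; [exact: cg|exact: cF]. Qed.

Lemma cont_cos g : continuous g -> continuous (fun y => cos (g y)).
Proof. by apply: cont_comp; exact: continuous_cos. Qed.

Lemma cont_sin g : continuous g -> continuous (fun y => sin (g y)).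
Proof. by apply: cont_comp; exact: continuous_sin. Qed.

Lemma cont_expR g : continuous g -> continuous (fun y => expR (g y)).
Proof. by apply: cont_comp; exact: continuous_expR. Qed.

End PointwiseCalculus.

(** The tactics [der] and [cont] recurse on the syntax of the function.
    [notypeclasses refine] leaves the value of the derivative to this
    recursion; its identification with the stated one remains as an
    equation. *)
Ltac der_step := first
  [ eassumption
  | notypeclasses refine (deri _) | notypeclasses refine (derc _ _)
  | notypeclasses refine (derD _ _ _ _ _ _ _)
  | notypeclasses refine (derB _ _ _ _ _ _ _)
  | notypeclasses refine (derN _ _ _ _)
  | notypeclasses refine (derM _ _ _ _ _ _ _)
  | notypeclasses refine (der_cos _ _ _ _)
  | notypeclasses refine (der_sin _ _ _ _)
  | notypeclasses refine (der_expR _ _ _ _) ].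
Ltac der := notypeclasses refine (der_eq _ _ _ _ _ _); [repeat der_step|cbv beta].
Ltac cont := cbv beta; lazymatch goal with
  | |- forall x, continuous_at x (fun y => y) => exact: conti
  | |- forall x, continuous_at x (fun _ => ?c) => exact: contc
  | |- forall x, continuous_at x (fun y => @GRing.add _ (@?f y) (@GRing.opp _ (@?g y))) =>
      refine (contB f g _ _); cont
  | |- forall x, continuous_at x (fun y => @GRing.add _ (@?f y) (@?g y)) =>
      refine (contD f g _ _); cont
  | |- forall x, continuous_at x (fun y => @GRing.opp _ (@?f y)) =>
      refine (contN f _); cont
  | |- forall x, continuous_at x (fun y => @GRing.mul _ (@?f y) (@?g y)) =>
      refine (contM f g _ _); cont
  | |- forall x, continuous_at x (fun y => cos (@?f y)) =>
      refine (cont_cos f _); cont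
  | |- forall x, continuous_at x (fun y => sin (@?f y)) =>
      refine (cont_sin f _); cont
  | |- forall x, continuous_at x (fun y => expR (@?f y)) =>
      refine (cont_expR f _); cont
  | |- _ => try assumption
  end.

(** * The Gaussian and its Fourier transform *)

Section Gaussian.
Local Open Scope classical_set_scope.
Context {R : realType}.
Local Notation leb := (@lebesgue_measure R).

Definition gauss (x : R) : R := expR (- (x * x / 2)).

Lemma gauss_ge0 x : 0 <= gauss x. Proof. exact: expR_ge0. Qed.

Lemma der_gauss (x : R) : is_derive x 1 gauss (- x * gauss x).
Proof. by rewrite /gauss; der; field. Qed.

Lemma continuous_gauss : continuous gauss.
Proof. exact: continuous_is_derive der_gauss. Qed.

(** With t = |x|, the factor 1 + t^2 is at most exp(2 t), and the exponent k
    t + 2 t - t^2 / 2 is at most (k + 2)^2 / 2. *)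
Lemma expR_gauss_le (k x : R) :
  expR (k * `|x|) * gauss x <= expR ((k + 2) ^+ 2 / 2) * lorentz x.
Proof.
rewrite /lorentz ler_pdivlMr ?ltr_pwDl ?sqr_ge0//.
have x0 : 0 <= `|x| by [].
have h1 : 1 + x ^+ 2 <= expR (`|x| * 2).
  have e1 := expR_ge1Dx `|x|.
  rewrite (_ : `|x| * 2 = `|x| + `|x|); last by ring.
  rewrite expRD -real_normK ?num_real//; nra.
apply: (@le_trans _ _ (expR (k * `|x|) * gauss x * expR (`|x| * 2))).
  by rewrite ler_wpM2l// mulr_ge0 ?expR_ge0 ?gauss_ge0.
rewrite /gauss -!expRD ler_expR.
have : x * x = `|x| * `|x| by rewrite -normrM ger0_norm// -expr2 sqr_ge0.
move=> ->; have := sqr_ge0 (k + 2 - `|x|); nra.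
Qed.

Lemma powers_gauss_le (n : nat) (x : R) :
  (1 + `|x|) ^+ n * gauss x <= expR ((n%:R + 2) ^+ 2 / 2) * lorentz x.
Proof.
apply: le_trans (expR_gauss_le _ _); rewrite ler_wpM2r ?gauss_ge0//.
rewrite mulrC expRM_natr lerXn2r ?nnegrE ?expR_ge0//.
exact: expR_ge1Dx.
Qed.

Lemma summable_gauss : summable gauss.
Proof.
apply: (@lorentz_summable _ _ (expR ((0 + 2) ^+ 2 / 2))).
  exact: continuous_measurable_fun continuous_gauss.
move=> x; have := powers_gauss_le 0 x.
by rewrite expr0 mul1r ger0_norm ?gauss_ge0.
Qed.

(** The substitution x -> x / sqrt 2 reduces this to the integral of exp(-
    x^2). *)
Lemma sqr_integral_gauss : (\int[leb]_x gauss x) ^+ 2 = 2 * pi.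
Proof.
pose r : R := (Num.sqrt 2)^-1.
have r0 : 0 < r by rewrite invr_gt0 sqrtr_gt0.
have r2 : r ^+ 2 = 2^-1 by rewrite exprVn sqr_sqrtr.
have := @Rintegral_affine R r 0 r0 (@gauss_fun R) integrableT_gauss.
rewrite [X in X = _ -> _](_ : _ = Num.sqrt pi); last first.
  by rewrite /Rintegral integralT_gauss.
rewrite [X in r * X](_ : _ = \int[leb]_x gauss x); last first.
  apply: eq_Rintegral => x _; rewrite /gauss_fun /gauss add0r exprMn r2.
  by rewrite expr2 mulrC.
move=> /(congr1 (fun z => z ^+ 2)); rewrite exprMn r2 sqr_sqrtr ?pi_ge0//.
by move=> ->; rewrite mulrA divff// mul1r.
Qed.

(** As a function F of t, the integral satisfies F' = - t F: differentiate
    under the integral sign, then integrate by parts. Hence F(t) exp(t^2 /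
    2) is constant. The phase th makes one statement cover the cosine and
    the sine transforms. *)
Lemma integral_cos_gauss (t th : R) :
  \int[leb]_y (cos (t * y + th) * gauss y) =
  cos th * (\int[leb]_y gauss y) * gauss t.
Proof.
set C := expR ((1%:R + 2) ^+ 2 / 2) : R.
have g1 y : `|gauss y| <= C * lorentz y.
  apply: le_trans (powers_gauss_le 1 y); rewrite ger0_norm ?gauss_ge0//.
  by rewrite ler_peMl ?gauss_ge0// expr1 lerDl.
have gy y : `|y * gauss y| <= C * lorentz y.
  apply: le_trans (powers_gauss_le 1 y).
  rewrite normrM [`|gauss _|]ger0_norm ?gauss_ge0// ler_wpM2r ?gauss_ge0//.
  by rewrite expr1 lerDr.
have cg := continuous_gauss.
have dg := der_gauss.
pose F t := \int[leb]_y (cos (t * y + th) * gauss y).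
have mF s : measurable_fun setT (fun y : R => cos (s * y + th) * gauss y).
  by apply: continuous_measurable_fun; cont.
have mF' s : measurable_fun setT (fun y : R => - sin (s * y + th) * (y * gauss y)).
  by apply: continuous_measurable_fun; cont.
have bF s y : `|cos (s * y + th) * gauss y| <= C * lorentz y.
  rewrite normrM; apply: le_trans (g1 y); rewrite ler_piMl//.
  by rewrite ler_norml cos_geN1 cos_le1.
have bF' s y : `|- sin (s * y + th) * (y * gauss y)| <= C * lorentz y.
  rewrite normrM; apply: le_trans (gy y); rewrite ler_piMl//.
  by rewrite normrN ler_norml sin_geN1 sin_le1.
have dF (s : R) : is_derive s 1 F (- s * F s).
  notypeclasses refine (der_eq _ _ _ _ _ _).
    apply: (@is_derive_under _ _ (fun s y => - sin (s * y + th) * (y * gauss y))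
      C mF _ bF bF').
    by move=> z y; der; ring.
  rewrite /F.
  have := @FTC_line _ (fun y => sin (s * y + th) * gauss y)
    (fun y => s * (cos (s * y + th) * gauss y) +
              (- sin (s * y + th) * (y * gauss y))) ((`|s| + 1) * C).
  rewrite RintegralD//; [|apply: summableZ|];
    try by [exact: lorentz_summable (bF _)|exact: lorentz_summable (bF' _)].
  rewrite RintegralZl//; last exact: lorentz_summable (bF s).
  move=> h; apply/eqP; rewrite mulNr -addr_eq0 addrC; apply/eqP.
  apply: h.
  - by move=> y; have dgy := der_gauss y; der; ring.
  - by cont.
  - move=> y; apply: (le_trans (ler_normD _ _)).
    rewrite normrM -mulrA mulrDl mul1r lerD ?bF'//.
    by rewrite ler_wpM2l.
  - move=> y; rewrite normrM; apply: le_trans (_ : C * lorentz y <= _).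
      apply: le_trans (g1 y); rewrite ler_piMl//.
      by rewrite ler_norml sin_geN1 sin_le1.
    rewrite -mulrA ler_peMl ?lerDr// mulr_ge0 ?expR_ge0 ?lorentz_ge0//.
(* The integrating factor of F' = - s F. *)
have dFe (s : R) : is_derive s 1 (fun s => F s * expR (s * s / 2)) 0.
  by have dFs := dF s; der; field.
have := @is_derive_0_is_cst _ _ t 0 dFe.
have -> : F 0 = cos th * \int[leb]_y gauss y.
  rewrite /F -RintegralZl//; last exact: summable_gauss.
  by apply: eq_Rintegral => y _; rewrite mul0r add0r.
rewrite mul0r mul0r expR0 mulr1 => <-.
by rewrite -[RHS]mulrA /gauss -expRD subrr expR0 mulr1.
Qed.

End Gaussian.

(** * Oscillatory double integrals *)

Section Oscillatory.
Local Open Scope classical_set_scope.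
Context {R : realType}.
Local Notation leb := (@lebesgue_measure R).
Implicit Types (A B : R -> R -> R) (M X th : R).

Local Notation L := (\int[leb]_y @lorentz R y).

(** Weyl integrals with a real amplitude, split into real and imaginary
    parts: th = 0 gives the real part, and th = - pi / 2 the imaginary part,
    since cos(z - pi / 2) = sin z. *)
Definition osc A X th (xi : R) : R :=
  \int[leb]_y (cos ((X - y) * xi + th) * A y xi).

Definition osc2 A X th : R := \int[leb]_xi osc A X th xi.

(** Two y-derivatives dominated by [lorentz] are what the two integrations
    by parts of [osc_le] consume. *)
Definition amplitude M A : Prop :=
  (forall y, continuous (A y)) /\
  exists A1 A2 : R -> R -> R,
  [/\ forall xi y : R, is_derive y 1 (A ^~ xi) (A1 y xi),
      forall xi y : R, is_derive y 1 (A1 ^~ xi) (A2 y xi),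
      forall xi, continuous (A2 ^~ xi) &
      forall y xi, [/\ `|A y xi| <= M * lorentz y,
        `|A1 y xi| <= M * lorentz y & `|A2 y xi| <= M * lorentz y]].

Lemma normr_cos_le1 (x : R) : `|cos x| <= 1.
Proof. by rewrite ler_norml cos_geN1 cos_le1. Qed.

Lemma normr_sin_le1 (x : R) : `|sin x| <= 1.
Proof. by rewrite ler_norml sin_geN1 sin_le1. Qed.

Lemma L_ge0 : 0 <= L.
Proof. by apply: Rintegral_ge0 => x _; exact: lorentz_ge0. Qed.

Lemma amplitude_continuous M A xi : amplitude M A -> continuous (A ^~ xi).
Proof. by move=> [_ [A1 [A2 [dA _ _ _]]]]; exact: continuous_is_derive (dA xi). Qed.

Lemma amplitude_le M A y xi : amplitude M A -> `|A y xi| <= M * lorentz y.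
Proof. by move=> [_ [A1 [A2 [_ _ _ /(_ y xi)[]]]]]. Qed.

Lemma amplitude_ge0 M A : amplitude M A -> 0 <= M.
Proof. by move=> /(amplitude_le _ _ 0 0)/lorentz_majorant_ge0. Qed.

Lemma amplitude_mono M M' A : M <= M' -> amplitude M A -> amplitude M' A.
Proof.
move=> MM' [cA [A1 [A2 [d1 d2 c2 b]]]]; split => //.
exists A1, A2; split => // y xi; have [b0 b1 b2] := b y xi.
have h := ler_wpM2r (lorentz_ge0 y) MM'.
by split; apply: le_trans h.
Qed.

Lemma amplitude_scale (c : R) M A :
  amplitude M A -> amplitude (`|c| * M) (fun y xi => c * A y xi).
Proof.
move=> [cA [A1 [A2 [d1 d2 c2 b]]]]; split; first by move=> y; have h := cA y; cont.
exists (fun y xi => c * A1 y xi), (fun y xi => c * A2 y xi); split.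
- by move=> xi y; have h := d1 xi y; der; ring.
- by move=> xi y; have h := d2 xi y; der; ring.
- by move=> xi; have h := c2 xi; cont.
- move=> y xi; have [b0 b1 b2] := b y xi.
  by split; rewrite normrM -mulrA ler_wpM2l.
Qed.

Lemma osc_integrand_le M A X th xi y : amplitude M A ->
  `|cos ((X - y) * xi + th) * A y xi| <= M * lorentz y.
Proof.
move=> hA; rewrite normrM; apply: le_trans (amplitude_le _ _ y xi hA).
by rewrite ler_piMl// normr_cos_le1.
Qed.

Lemma osc_integrand_measurable M A X th xi : amplitude M A ->
  measurable_fun setT (fun y : R => cos ((X - y) * xi + th) * A y xi).
Proof.
move=> hA; have cA := amplitude_continuous _ _ xi hA.
by apply: continuous_measurable_fun; cont.
Qed.

Lemma osc_integrand_summable M A X th xi : amplitude M A ->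
  summable (fun y : R => cos ((X - y) * xi + th) * A y xi).
Proof.
move=> hA; apply: (lorentz_summable _ M).
  exact: osc_integrand_measurable hA.
by move=> y; exact: osc_integrand_le.
Qed.

Lemma continuous_osc M A X th : amplitude M A -> continuous (osc A X th).
Proof.
move=> hA; apply: (@continuous_under _ _ M).
- by move=> xi; exact: osc_integrand_measurable hA.
- by move=> y; have cA := hA.1 y; cont.
- by move=> xi y; exact: osc_integrand_le.
Qed.

(** Integrating by parts twice in y, xi^2 osc A is minus the same integral
    with the second derivative of A. Adding the trivial bound controls (1 +
    xi^2) osc A, so the outer integral converges absolutely although A does
    not decay in xi. *)
Lemma osc_le M A X th xi : amplitude M A ->
  `|osc A X th xi| <= 2 * M * L * lorentz xi.
Proof.
move=> hA.
have sA := osc_integrand_summable _ _ X th xi hA.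
have [_ [A1 [A2 [dA dA1 cA2 bA]]]] := hA.
have cA := amplitude_continuous _ _ xi hA.
have cA1 := continuous_is_derive _ _ (dA1 xi).
have cA2x := cA2 xi.
have bA2 y : `|cos ((X - y) * xi + th) * A2 y xi| <= M * lorentz y.
  rewrite normrM; have [_ _] := bA y xi; apply: le_trans.
  by rewrite ler_piMl// normr_cos_le1.
have mA2 : measurable_fun setT (fun y : R => cos ((X - y) * xi + th) * A2 y xi).
  by apply: continuous_measurable_fun; cont.
have sA2 := lorentz_summable _ _ mA2 bA2.
have M0 := amplitude_ge0 _ _ hA.
have parts : xi ^+ 2 * osc A X th xi =
    - \int[leb]_y (cos ((X - y) * xi + th) * A2 y xi).
  have := @FTC_line _ (fun y => xi * (sin ((X - y) * xi + th) * A y xi) -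
                           cos ((X - y) * xi + th) * A1 y xi)
     (fun y => - (xi ^+ 2) * (cos ((X - y) * xi + th) * A y xi) -
              cos ((X - y) * xi + th) * A2 y xi) ((xi ^+ 2 + `|xi| + 1) * M).
  rewrite RintegralB//; [|exact: summableZ].
  rewrite RintegralZl// -/(osc A X th xi) mulNr => h.
  set I2 := \int[leb]_y _ in h *.
  suff : - (xi ^+ 2 * osc A X th xi) - I2 = 0 by lra.
  apply: h.
  - move=> y; have dAy := dA xi y; have dA1y := dA1 xi y; der; ring.
  - by cont.
  - move=> y; apply: (le_trans (ler_normB _ _)).
    rewrite normrM normrN [`|xi ^+ 2|]ger0_norm ?sqr_ge0//.
    have h1 := osc_integrand_le _ _ X th xi y hA; have h2 := bA2 y.
    have h3 := ler_wpM2l (sqr_ge0 xi) h1.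
    have h4 : 0 <= `|xi| * (M * lorentz y) by rewrite !mulr_ge0 ?lorentz_ge0.
    lra.
  - move=> y; apply: (le_trans (ler_normB _ _)).
    have [b0 b1 b2] := bA y xi.
    rewrite !normrM.
    have h1 : `|sin ((X - y) * xi + th)| * `|A y xi| <= M * lorentz y.
      by apply: le_trans b0; rewrite ler_piMl// normr_sin_le1.
    have h2 : `|cos ((X - y) * xi + th)| * `|A1 y xi| <= M * lorentz y.
      by apply: le_trans b1; rewrite ler_piMl// normr_cos_le1.
    have h3 := ler_wpM2l (normr_ge0 xi) h1.
    have h4 : 0 <= xi ^+ 2 * (M * lorentz y).
      by apply: mulr_ge0; [exact: sqr_ge0|rewrite mulr_ge0// lorentz_ge0].
    lra.
rewrite {2}/lorentz ler_pdivlMr ?ltr_pwDl ?sqr_ge0//.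
rewrite -[X in _ * X]ger0_norm ?addr_ge0 ?sqr_ge0// -normrM mulrC mulrDl mul1r parts.
apply: (le_trans (ler_normB _ _)).
have i0 := @norm_Rintegral_lorentz _ _ _ (osc_integrand_measurable _ _ X th xi hA)
   (fun y => osc_integrand_le _ _ X th xi y hA).
have i2 := @norm_Rintegral_lorentz _ _ _ mA2 bA2.
by rewrite -/(osc A X th xi) in i0; rewrite -mulrA mulr_natl mulr2n lerD.
Qed.

Lemma summable_osc M A X th : amplitude M A -> summable (osc A X th).
Proof.
move=> hA; apply: (lorentz_summable _ (2 * M * L)).
  by apply: continuous_measurable_fun; exact: continuous_osc hA.
by move=> xi; exact: osc_le.
Qed.

Lemma osc2_le M A X th : amplitude M A -> `|osc2 A X th| <= 2 * M * L * L.
Proof.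
move=> hA; apply: norm_Rintegral_lorentz.
  by apply: continuous_measurable_fun; exact: continuous_osc hA.
by move=> xi; exact: osc_le.
Qed.

(** Up to the phase shift - pi / 2, multiplication of the integrand by X - y
    is differentiation of the cosine in xi; integration by parts in xi moves
    it onto A. *)
Lemma osc2_mulX M A B X th : amplitude M A -> amplitude M B ->
  amplitude M (fun y xi => y * A y xi) ->
  (forall y xi : R, is_derive xi 1 (A y) (B y xi)) ->
  X * osc2 A X th =
  osc2 (fun y xi => y * A y xi) X th - osc2 B X (th - pi / 2).
Proof.
move=> hA hB hP dA.
set P := fun y xi : R => y * A y xi.
set th' := th - pi / 2.
have cosE (z : R) : cos (z + th') = sin (z + th).
  by rewrite addrA cosBpihalf.
pose K := osc A X th'.
pose k xi := X * osc A X th xi - osc P X th xi + osc B X th' xi.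
have M0 := amplitude_ge0 _ _ hA.
have dK (xi : R) : is_derive xi 1 K (k xi).
  notypeclasses refine (der_eq _ _ _ _ _ _).
    apply: (@is_derive_under _ _ (fun xi y =>
       X * (cos ((X - y) * xi + th) * A y xi) - cos ((X - y) * xi + th) * P y xi
       + cos ((X - y) * xi + th') * B y xi) ((`|X| + 2) * M)).
    + by move=> z; exact: osc_integrand_measurable hA.
    + move=> z y; have dAy := dA y z.
      notypeclasses refine (der_eq _ _ _ _ _ _); [repeat der_step|cbv beta].
      have -> : sin ((X - y) * z + th') = - cos ((X - y) * z + th).
        by rewrite addrA sinBpihalf.
      rewrite cosE /P; ring.
    + move=> z y; apply: (le_trans (osc_integrand_le _ _ X th' z y hA)).
      by rewrite ler_wpM2r ?lorentz_ge0// ler_peMl//; have := normr_ge0 X; lra.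
    + move=> z y; apply: (le_trans (ler_normD _ _)).
      have h0 := ler_normB (X * (cos ((X - y) * z + th) * A y z)) 
          (cos ((X - y) * z + th) * P y z).
      have h1 := osc_integrand_le _ _ X th z y hA.
      have h2 := osc_integrand_le _ _ X th z y hP.
      have h3 := osc_integrand_le _ _ X th' z y hB.
      rewrite [X in _ <= X + _]normrM in h0.
      have h4 := ler_wpM2l (normr_ge0 X) h1.
      rewrite -/(P y z) in h2.
      rewrite [leRHS](_ : _ = `|X| * (M * lorentz y) + M * lorentz y +
        M * lorentz y); last by ring.
      by apply: lerD => //; apply: (le_trans h0); exact: lerD.
  rewrite RintegralD//; last 2 first.
  - apply: summableB; last exact: osc_integrand_summable hP.
    by apply: summableZ; exact: osc_integrand_summable hA.
  - exact: osc_integrand_summable hB.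
  rewrite RintegralB//; last 2 first.
  - by apply: summableZ; exact: osc_integrand_summable hA.
  - exact: osc_integrand_summable hP.
  by rewrite RintegralZl//; exact: osc_integrand_summable hA.
have := @FTC_line _ K k (2 * (`|X| + 2) * M * L) dK.
rewrite /k RintegralD//; last 2 first.
- apply: summableB; last exact: summable_osc hP.
  by apply: summableZ; exact: summable_osc hA.
- exact: summable_osc hB.
rewrite RintegralB//; last 2 first.
- by apply: summableZ; exact: summable_osc hA.
- exact: summable_osc hP.
rewrite RintegralZl//; last exact: summable_osc hA.
rewrite -/(osc2 A X th) -/(osc2 P X th) -/(osc2 B X th') => h.
set a1 := osc2 A X th in h *; set a2 := osc2 P X th in h *.
set a3 := osc2 B X th' in h *.
suff : X * a1 - a2 + a3 = 0 by lra.
apply: h.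
- have := continuous_osc _ _ X th hA; have := continuous_osc _ _ X th hP.
  have c3 := continuous_osc _ _ X th' hB; move=> c1 c2. cont.
- move=> z; apply: (le_trans (ler_normD _ _)).
  have h0 := ler_normB (X * osc A X th z) (osc P X th z).
  have h1 := osc_le _ _ X th z hA.
  have h2 := osc_le _ _ X th z hP.
  have h3 := osc_le _ _ X th' z hB.
  rewrite [X in _ <= X + _]normrM in h0.
  have h4 := ler_wpM2l (normr_ge0 X) h1.
  rewrite -/P in h2.
  set b := 2 * M * L * lorentz z in h1 h2 h3 h4.
  rewrite [leRHS](_ : _ = `|X| * b + b + b); last by rewrite /b; ring.
  by apply: lerD => //; apply: (le_trans h0); exact: lerD.
- move=> z; apply: (le_trans (osc_le _ _ X th' z hA)).
  rewrite ler_wpM2r ?lorentz_ge0// ler_wpM2r ?L_ge0// ler_wpM2r//.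
  by have := normr_ge0 X; lra.
Qed.

(** The decay in X that makes images of packets uniformly square-integrable. *)
Lemma osc2_decay M A B X th : amplitude M A -> amplitude M B ->
  amplitude M (fun y xi => y * A y xi) ->
  (forall y xi : R, is_derive xi 1 (A y) (B y xi)) ->
  (1 + `|X|) * `|osc2 A X th| <= 6 * M * L * L.
Proof.
move=> hA hB hP dA; rewrite mulrDl mul1r -normrM (osc2_mulX M A B)//.
have h1 := osc2_le _ _ X th hA; have h2 := osc2_le _ _ X th hP.
have h3 := osc2_le _ _ X (th - pi / 2) hB.
rewrite (_ : 6 * M * L * L = 2 * M * L * L + (2 * M * L * L + 2 * M * L * L)).
  apply: lerD; first exact: h1.
  by apply: (le_trans (ler_normB _ _)); apply: lerD; [exact: h2|exact: h3].
by ring.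
Qed.

Lemma cvg_osc2 M (A_ : nat -> R -> R -> R) A X th :
  (forall n, amplitude M (A_ n)) -> amplitude M A ->
  (forall y xi, A_ ^~ y ^~ xi @ \oo --> A y xi) ->
  osc2 (A_ n) X th @[n --> \oo] --> osc2 A X th.
Proof.
move=> hA_ hA cv.
apply: (@cvg_Rintegral _ _ _ (fun xi => 2 * M * L * lorentz xi) _ _ _ _ _).2.
- by move=> n; apply: continuous_measurable_fun; exact: continuous_osc (hA_ n).
- by apply: continuous_measurable_fun; exact: continuous_osc hA.
- apply: aeW => xi.
  apply: (@cvg_Rintegral _ _ _ (fun y => M * lorentz y) _ _ _ _ _).2.
  + by move=> n; exact: osc_integrand_measurable (hA_ n).
  + exact: osc_integrand_measurable hA.
  + by apply: aeW => y; apply: cvgMr; exact: cv.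
  + by apply: aeW => y n; exact: osc_integrand_le.
  + by apply: summableZ; exact: summable_lorentz.
- by apply: aeW => xi n; exact: osc_le.
- by apply: summableZ; exact: summable_lorentz.
Qed.

(** The six functions are the first two derivatives of the Gaussian and of y
    times the Gaussian, together with these two functions themselves. *)
Lemma gauss_bounds : exists C : R, forall y : R,
  [/\ `|gauss y| <= C * lorentz y, `|- y * gauss y| <= C * lorentz y &
      `|(y * y - 1) * gauss y| <= C * lorentz y] /\
  [/\ `|y * gauss y| <= C * lorentz y, `|(1 - y * y) * gauss y| <= C * lorentz y &
      `|(y * y * y - 3 * y) * gauss y| <= C * lorentz y].
Proof.
pose C : R := 4 * expR ((3%:R + 2) ^+ 2 / 2); exists C => y.
have bnd (c : R) : `|c| <= 4 * (1 + `|y|) ^+ 3 ->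
    `|c * gauss y| <= C * lorentz y.
  move=> hc; rewrite normrM [`|gauss _|]ger0_norm ?gauss_ge0//.
  apply: (@le_trans _ _ (4 * (1 + `|y|) ^+ 3 * gauss y)).
    by rewrite ler_wpM2r// gauss_ge0.
  rewrite /C -[leLHS]mulrA -[leRHS]mulrA ler_wpM2l//.
  exact: (powers_gauss_le 3 y).
have [t [tE t0 t1 t2 E]] : exists t, [/\ t = `|y|, 0 <= t, 0 <= t * t,
    0 <= t * t * t &
    4 * (1 + t) ^+ 3 = 4 + 12 * t + 12 * (t * t) + 4 * (t * t * t)].
  by exists `|y|; split => //; ring.
have bndt (c b : R) : `|c| <= b ->
    b <= 4 + 12 * t + 12 * (t * t) + 4 * (t * t * t) ->
    `|c * gauss y| <= C * lorentz y.
  by move=> h1 h2; apply: bnd; rewrite -tE E; exact: le_trans h2.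
split; split.
- by rewrite -[X in `|X|]mul1r; apply: (bndt _ 1); [rewrite normr1|lra].
- by apply: (bndt _ t); [rewrite normrN tE|lra].
- apply: (bndt _ (t * t + 1)); last by lra.
  by apply: (le_trans (ler_normB _ _)); rewrite normrM normr1 -tE.
- by apply: (bndt _ t); [rewrite tE|lra].
- apply: (bndt _ (1 + t * t)); last by lra.
  by apply: (le_trans (ler_normB _ _)); rewrite normrM normr1 -tE.
- apply: (bndt _ (t * t * t + 3 * t)); last by lra.
  by apply: (le_trans (ler_normB _ _)); rewrite !normrM [`|3|]ger0_norm// -tE.
Qed.

Lemma der_gauss1 (y : R) :
  is_derive y 1 (fun y => - y * gauss y) ((y * y - 1) * gauss y).
Proof. by have dg := der_gauss y; der; ring. Qed.

Lemma der_mul_gauss (y : R) :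
  is_derive y 1 (fun y => y * gauss y) ((1 - y * y) * gauss y).
Proof. by have dg := der_gauss y; der; ring. Qed.

Lemma der_mul_gauss1 (y : R) :
  is_derive y 1 (fun y => (1 - y * y) * gauss y)
    ((y * y * y - 3 * y) * gauss y).
Proof. by have dg := der_gauss y; der; ring. Qed.

Lemma amplitude_gauss : exists M, amplitude M (fun y _ => gauss y) /\
  amplitude M (fun y _ => y * gauss y).
Proof.
have [C hC] := gauss_bounds; exists C.
have cg := @continuous_gauss R.
split; (split; first by move=> y; exact: contc).
- exists (fun y _ => - y * gauss y), (fun y _ => (y * y - 1) * gauss y); split.
  + by move=> _; exact: der_gauss.
  + by move=> _; exact: der_gauss1.
  + by move=> _; cont.
  + by move=> y _; exact: (hC y).1.
- exists (fun y _ => (1 - y * y) * gauss y),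
    (fun y _ => (y * y * y - 3 * y) * gauss y); split.
  + by move=> _; exact: der_mul_gauss.
  + by move=> _; exact: der_mul_gauss1.
  + by move=> _; cont.
  + by move=> y _; exact: (hC y).2.
Qed.

(** Fourier inversion for the Gaussian. *)
Lemma osc2_gauss X th :
  osc2 (fun y _ => gauss y) X th = 2 * pi * cos th * gauss X.
Proof.
pose I := \int[leb]_y @gauss R y.
have E xi : osc (fun y _ => gauss y) X th xi =
    I * (cos (X * xi + th) * gauss xi).
  rewrite /osc [LHS](_ : _ =
    \int[leb]_y (cos (- xi * y + (X * xi + th)) * gauss y)); last first.
    by apply: eq_Rintegral => y _; congr (cos _ * _); ring.
  rewrite integral_cos_gauss -/I.
  by rewrite /gauss mulrNN; ring.
rewrite /osc2 (_ : osc _ _ _ = fun xi => I * (cos (X * xi + th) * gauss xi));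
  last exact/funext.
rewrite RintegralZl//; last first.
  have [M [h _]] := amplitude_gauss.
  have cg := @continuous_gauss R.
  apply: (lorentz_summable _ M); first by apply: continuous_measurable_fun; cont.
  move=> y; rewrite normrM; apply: le_trans (amplitude_le _ _ y 0 h).
  by rewrite ler_piMl// normr_cos_le1.
rewrite integral_cos_gauss -/I.
have : I ^+ 2 = 2 * pi := sqr_integral_gauss.
by rewrite expr2 => E2; rewrite -E2; ring.
Qed.

Lemma amplitude0 M : 0 <= M -> amplitude M (fun _ _ => 0).
Proof.
move=> M0; split; first by move=> y; exact: contc.
exists (fun _ _ => 0), (fun _ _ => 0); split.
- by move=> _ y; exact: derc.
- by move=> _ y; exact: derc.
- by move=> _; exact: contc.
- by move=> y _; rewrite normr0 mulr_ge0 ?lorentz_ge0.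
Qed.

Lemma osc2_0 X th : osc2 (fun _ _ => 0) X th = 0.
Proof.
rewrite /osc2 (_ : osc _ _ _ = fun=> 0); last first.
  apply/funext => xi; rewrite /osc (_ : (fun y => _) = fun=> 0); last first.
    by apply/funext => y; rewrite mulr0.
  by rewrite /Rintegral integral0.
by rewrite /Rintegral integral0.
Qed.

(** The amplitude does not depend on xi, so that [osc2_mulX] has no second
    term. *)
Lemma osc2_mul_gauss X th :
  osc2 (fun y _ => y * gauss y) X th = X * (2 * pi * cos th * gauss X).
Proof.
have [M [h1 h2]] := amplitude_gauss.
have M0 := amplitude_ge0 _ _ h1.
have := @osc2_mulX M _ (fun _ _ => 0) X th h1 (amplitude0 _ M0) h2.
rewrite osc2_0 subr0 osc2_gauss => ->// y xi; exact: derc.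
Qed.

End Oscillatory.

(** * Complex-valued integrals *)

Section ComplexIntegral.
Local Open Scope classical_set_scope.
Context {R : realType}.
Local Notation C := R[i].
Local Notation Re := complex.Re.
Local Notation Im := complex.Im.
Implicit Types (f g : R -> C) (z w : C) (t : R).

Lemma ReM z w : Re (z * w) = Re z * Re w - Im z * Im w.
Proof. by case: z w => [? ?] [? ?]. Qed.

Lemma ImM z w : Im (z * w) = Re z * Im w + Im z * Re w.
Proof. by case: z w => [a b] [c d] /=. Qed.

Lemma ReD z w : Re (z + w) = Re z + Re w.
Proof. by case: z w => [? ?] [? ?]. Qed.

Lemma ImD z w : Im (z + w) = Im z + Im w.
Proof. by case: z w => [? ?] [? ?]. Qed.

Lemma ReN z : Re (- z) = - Re z. Proof. by case: z. Qed.

Lemma ImN z : Im (- z) = - Im z. Proof. by case: z. Qed.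

Lemma Re_conj z : Re (z^*) = Re z. Proof. by case: z. Qed.

Lemma Im_conj z : Im (z^*) = - Im z. Proof. by case: z. Qed.

Definition ReImE := (ReM, ImM, ReD, ImD, ReN, ImN, Re_conj, Im_conj).

Lemma eqC z w : Re z = Re w -> Im z = Im w -> z = w.
Proof. by case: z w => [? ?] [? ?] /= -> ->. Qed.

Definition csummable f : Prop :=
  summable (fun x => Re (f x)) /\ summable (fun x => Im (f x)).

Lemma csummableZ z f : csummable f -> csummable (fun x => z * f x).
Proof.
move=> [f1 f2]; split.
- under eq_fun do rewrite ReM.
  by apply: summableB; apply: summableZ.
- under eq_fun do rewrite ImM.
  by apply: summableD; apply: summableZ.
Qed.

Lemma csummableD f g :
  csummable f -> csummable g -> csummable (fun x => f x + g x).
Proof.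
move=> [f1 f2] [g1 g2]; split.
- by under eq_fun do rewrite ReD; exact: summableD.
- by under eq_fun do rewrite ImD; exact: summableD.
Qed.

Lemma summable0 : summable (fun _ : R => 0).
Proof. exact: integrable0. Qed.

Lemma csummable0 : csummable (fun _ => 0).
Proof. by split; exact: summable0. Qed.

Lemma cintegralZ z f :
  csummable f -> cintegral (fun x => z * f x) = z * cintegral f.
Proof.
move=> [f1 f2]; apply: eqC; rewrite /cintegral ?ReM ?ImM /=.
- under eq_Rintegral do rewrite ReM.
  rewrite RintegralB//; [|exact: summableZ..].
  by rewrite !RintegralZl.
- under eq_Rintegral do rewrite ImM.
  rewrite RintegralD//; [|exact: summableZ..].
  by rewrite !RintegralZl.
Qed.

Lemma cintegralD f g : csummable f -> csummable g ->
  cintegral (fun x => f x + g x) = cintegral f + cintegral g.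
Proof.
move=> [f1 f2] [g1 g2]; apply: eqC; rewrite /cintegral ?ReD ?ImD /=.
- by under eq_Rintegral do rewrite ReD; rewrite RintegralD.
- by under eq_Rintegral do rewrite ImD; rewrite RintegralD.
Qed.

Lemma cintegral0 : cintegral (fun _ : R => 0) = 0.
Proof. by apply: eqC; rewrite /cintegral /= /Rintegral integral0. Qed.

Lemma cintegral_sum (I : finType) (f : I -> R -> C) :
  (forall i, csummable (f i)) ->
  csummable (fun x => \sum_i f i x) /\
  cintegral (fun x => \sum_i f i x) = \sum_i cintegral (f i).
Proof.
move=> fi.
suff h (s : seq I) : csummable (fun x => \sum_(i <- s) f i x) /\
    cintegral (fun x => \sum_(i <- s) f i x) = \sum_(i <- s) cintegral (f i).
  by have := h (index_enum I).
elim: s => [|i s [IH1 IH2]].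
  have -> : (fun x => \sum_(i <- [::]) f i x) = fun=> 0.
    by apply/funext => x; rewrite big_nil.
  by rewrite big_nil cintegral0; split => //; exact: csummable0.
have -> : (fun x => \sum_(j <- i :: s) f j x) =
    fun x => f i x + \sum_(j <- s) f j x.
  by apply/funext => x; rewrite big_cons.
by split; [exact: csummableD|rewrite big_cons cintegralD// IH2].
Qed.

Lemma cintegral_affine (a b : R) f : 0 < a -> csummable f ->
  csummable (fun x => f (b + a * x)) /\
  cintegral f = a%:C * cintegral (fun x => f (b + a * x)).
Proof.
move=> a0 [f1 f2]; split; first by
  split; [exact: (summable_affine a b a0 _ f1)|exact: (summable_affine a b a0 _ f2)].
apply: eqC; rewrite /cintegral ?ReM ?ImM /= mul0r ?subr0 ?addr0.
- exact: (Rintegral_affine a b a0 _ f1).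
- exact: (Rintegral_affine a b a0 _ f2).
Qed.

(** Convergence of the iterated integral in the order of the Weyl formula:
    first in y, then in xi. *)
Definition csummable2 (F : R -> R -> C) : Prop :=
  (forall xi, csummable (F xi)) /\ csummable (fun xi => cintegral (F xi)).

Definition cintegral2 (F : R -> R -> C) : C :=
  cintegral (fun xi => cintegral (F xi)).

Lemma cintegral2Z z (F : R -> R -> C) : csummable2 F ->
  csummable2 (fun xi y => z * F xi y) /\
  cintegral2 (fun xi y => z * F xi y) = z * cintegral2 F.
Proof.
move=> [F1 F2].
have E : (fun xi => cintegral (fun y => z * F xi y)) =
    fun xi => z * cintegral (F xi).
  by apply/funext => xi; exact: cintegralZ.
rewrite /csummable2 /cintegral2 E; split; last exact: cintegralZ.
by split; [move=> xi|]; exact: csummableZ.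
Qed.

Lemma cintegral2_sum (I : finType) (F : I -> R -> R -> C) :
  (forall i, csummable2 (F i)) ->
  csummable2 (fun xi y => \sum_i F i xi y) /\
  cintegral2 (fun xi y => \sum_i F i xi y) = \sum_i cintegral2 (F i).
Proof.
move=> Fi.
have E : (fun xi => cintegral (fun y => \sum_i F i xi y)) =
    fun xi => \sum_i cintegral (F i xi).
  apply/funext => xi.
  by have [_] := @cintegral_sum _ (fun i => F i xi) (fun i => (Fi i).1 xi).
have [h1 h2] := @cintegral_sum _ (fun i xi => cintegral (F i xi))
  (fun i => (Fi i).2).
rewrite /csummable2 /cintegral2 E; split => //; split => // xi.
by have [] := @cintegral_sum _ (fun i => F i xi) (fun i => (Fi i).1 xi).
Qed.

Lemma cintegral2_affine (a b c d : R) (F : R -> R -> C) : 0 < a -> 0 < c ->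
  csummable2 F ->
  csummable2 (fun xi y => F (b + a * xi) (d + c * y)) /\
  cintegral2 F =
    (a * c)%:C * cintegral2 (fun xi y => F (b + a * xi) (d + c * y)).
Proof.
move=> a0 c0 [F1 F2].
have [h1 h2] := cintegral_affine a b _ a0 F2.
have E xi := cintegral_affine c d _ c0 (F1 xi).
have E2 : (fun xi => cintegral (F (b + a * xi))) =
    fun xi => c%:C * cintegral (fun y => F (b + a * xi) (d + c * y)).
  by apply/funext => xi; exact: (E _).2.
have h3 : csummable
    (fun xi => cintegral (fun y => F (b + a * xi) (d + c * y))).
  have := csummableZ (c^-1)%:C _ h1.
  congr csummable; apply/funext => xi.
  by rewrite (E _).2 mulrA -rmorphM /= mulVf ?gt_eqF// mul1r.
split; first by split => // xi; exact: (E _).1.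
rewrite /cintegral2 h2 E2 (cintegralZ _ _ h3) mulrA; congr (_ * _).
by rewrite -rmorphM.
Qed.

Lemma sqnorm_ge0 z : 0 <= sqnorm z.
Proof. by rewrite addr_ge0 ?sqr_ge0. Qed.

Lemma sqnormM z w : sqnorm (z * w) = sqnorm z * sqnorm w.
Proof. by rewrite /sqnorm ReM ImM; ring. Qed.

Lemma sqnormD_le z w : sqnorm (z + w) <= 2 * sqnorm z + 2 * sqnorm w.
Proof.
rewrite /sqnorm ReD ImD.
have := sqr_ge0 (Re z - Re w); have := sqr_ge0 (Im z - Im w); lra.
Qed.

Lemma mul_conj z : z * z^* = (sqnorm z)%:C.
Proof. by apply: eqC; rewrite !ReImE /sqnorm /=; ring. Qed.

Lemma expiD (a b : R) : expi (a + b) = expi a * expi b.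
Proof. by apply: eqC; rewrite !ReImE /= ?cosD ?sinD; ring. Qed.

Lemma expi0 : expi 0 = 1 :> C.
Proof. by rewrite /expi cos0 sin0. Qed.

Lemma sqnorm_expi (a : R) : sqnorm (expi a) = 1.
Proof. exact: cos2Dsin2. Qed.

Lemma expi_mulN (a : R) : expi (- a) * expi a = 1.
Proof. by rewrite -expiD addNr expi0. Qed.

End ComplexIntegral.

(** * Square-integrable functions *)

Section L2space.
Local Open Scope classical_set_scope.
Context {R : realType}.
Local Notation leb := (@lebesgue_measure R).
Local Notation Re := complex.Re.
Local Notation Im := complex.Im.
Implicit Types (n : nat).

Lemma L2P n (u : R -> 'cV[R[i]]_n) : L2 u <->
  forall a, [/\ measurable_fun setT (fun x => Re (u x a 0)),
    measurable_fun setT (fun x => Im (u x a 0)) &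
    summable (fun x => sqnorm (u x a 0))].
Proof.
split=> h a; have [m1 m2 h3] := h a; split => //.
- apply/integrableP; split.
    apply/measurable_EFinP; apply: measurable_funD;
      exact: (measurable_funX 2).
  rewrite (_ : (\int[leb]_x _)%E = (\int[leb]_x (sqnorm (u x a 0))%:E)%E)//.
  by apply: eq_integral => x _; rewrite /= ger0_norm// sqnorm_ge0.
- have /integrableP[_] := h3.
  rewrite (_ : (\int[leb]_x `|_|)%E = (\int[leb]_x (sqnorm (u x a 0))%:E)%E)//.
  by apply: eq_integral => x _; rewrite /= ger0_norm// sqnorm_ge0.
Qed.

Lemma L2_summable n (u : R -> 'cV[R[i]]_n) a :
  L2 u -> summable (fun x => sqnorm (u x a 0)).
Proof. by move=> /L2P /(_ a) []. Qed.

Lemma L2_le n (u : R -> 'cV[R[i]]_n) (g : R -> R) :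
  (forall a, measurable_fun setT (fun x => Re (u x a 0))) ->
  (forall a, measurable_fun setT (fun x => Im (u x a 0))) ->
  summable g -> (forall a x, sqnorm (u x a 0) <= g x) -> L2 u.
Proof.
move=> m1 m2 sg ug; apply/L2P => a; split => //.
apply: dominated_summable sg.
  by apply: measurable_funD; exact: (measurable_funX 2).
by move=> x; rewrite ger0_norm ?sqnorm_ge0.
Qed.

Lemma L2_lin n (c : R[i]) (u v : R -> 'cV[R[i]]_n) :
  L2 u -> L2 v -> L2 (fun x => c *: u x + v x).
Proof.
move=> /L2P Lu /L2P Lv; apply/L2P => a.
have [mu1 mu2 su] := Lu a; have [mv1 mv2 sv] := Lv a.
have m1 : measurable_fun setT (fun x => Re ((c *: u x + v x) a 0)).
  under eq_fun do rewrite !mxE ReD ReM.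
  by apply: measurable_funD => //; apply: measurable_funB;
    apply: measurable_funM.
have m2 : measurable_fun setT (fun x => Im ((c *: u x + v x) a 0)).
  under eq_fun do rewrite !mxE ImD ImM.
  by apply: measurable_funD => //; apply: measurable_funD;
    apply: measurable_funM.
split => //.
apply: (dominated_summable _
  (fun x => 2 * sqnorm c * sqnorm (u x a 0) + 2 * sqnorm (v x a 0))).
- by apply: measurable_funD; exact: (measurable_funX 2).
- move=> x; rewrite ger0_norm ?sqnorm_ge0// !mxE.
  by apply: (le_trans (sqnormD_le _ _)); rewrite sqnormM mulrA.
- by apply: summableD; exact: summableZ.
Qed.

Lemma L20 n : L2 (fun _ : R => 0 : 'cV[R[i]]_n).
Proof.
apply/L2P => a; under eq_fun do rewrite mxE.
under [X in summable X]eq_fun do rewrite mxE /sqnorm /= expr0n /= addr0.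
by split; [exact: measurable_cst|exact: measurable_cst|exact: summable0].
Qed.

Lemma L2Z n (c : R[i]) (u : R -> 'cV[R[i]]_n) :
  L2 u -> L2 (fun x => c *: u x).
Proof.
move=> Lu; have := L2_lin _ c _ _ Lu (L20 n).
by congr L2; apply/funext => x; rewrite addr0.
Qed.

Lemma L2B n (u v : R -> 'cV[R[i]]_n) :
  L2 u -> L2 v -> L2 (fun x => u x - v x).
Proof.
move=> Lu Lv; have := L2_lin _ (-1) _ _ Lv Lu.
by congr L2; apply/funext => x; rewrite scaleN1r addrC.
Qed.

Lemma csummable_mul_conj n (u v : R -> 'cV[R[i]]_n) a : L2 u -> L2 v ->
  csummable (fun x => u x a 0 * (v x a 0)^*).
Proof.
move=> /L2P/(_ a)[mu1 mu2 su] /L2P/(_ a)[mv1 mv2 sv].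
have dom : summable (fun x => sqnorm (u x a 0) + sqnorm (v x a 0)).
  exact: summableD.
split; apply: dominated_summable dom.
- under eq_fun do rewrite ReM Re_conj Im_conj mulrN opprK.
  by apply: measurable_funD; exact: measurable_funM.
- move=> x; rewrite ReM Re_conj Im_conj /sqnorm ler_norml.
  move: (u x a 0) (v x a 0) => [p q] [r s] /=.
  have := sqr_ge0 (p - r); have := sqr_ge0 (q - s).
  by have := sqr_ge0 (p + r); have := sqr_ge0 (q + s); nra.
- under eq_fun do rewrite ImM Re_conj Im_conj mulrN addrC.
  by apply: measurable_funB; exact: measurable_funM.
- move=> x; rewrite ImM Re_conj Im_conj /sqnorm ler_norml.
  move: (u x a 0) (v x a 0) => [p q] [r s] /=.
  have := sqr_ge0 (p - s); have := sqr_ge0 (q - r).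
  by have := sqr_ge0 (p + s); have := sqr_ge0 (q + r); nra.
Qed.

Lemma L2dot_linl n (c : R[i]) (u v w : R -> 'cV[R[i]]_n) :
  L2 u -> L2 v -> L2 w ->
  L2dot (fun x => c *: u x + v x) w = c * L2dot u w + L2dot v w.
Proof.
move=> Lu Lv Lw; rewrite /L2dot big_distrr -big_split; apply: eq_bigr => a _ /=.
rewrite -cintegralZ; last exact: csummable_mul_conj.
rewrite -cintegralD; last 2 first.
- by apply: csummableZ; exact: csummable_mul_conj.
- exact: csummable_mul_conj.
by congr cintegral; apply/funext => x; rewrite !mxE mulrDl mulrA.
Qed.

Lemma L2dotC n (u v : R -> 'cV[R[i]]_n) : L2 u -> L2 v ->
  L2dot u v = (L2dot v u)^*.
Proof.
move=> Lu Lv; rewrite /L2dot rmorph_sum; apply: eq_bigr => a _.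
apply: eqC; rewrite /cintegral ?Re_conj ?Im_conj /=.
- by apply: eq_Rintegral => x _; rewrite !ReImE; ring.
- rewrite -mulN1r -RintegralZl//; last first.
    exact: (csummable_mul_conj _ v u a Lv Lu).2.
  by apply: eq_Rintegral => x _; rewrite !ReImE; ring.
Qed.

Definition sqL2 n (u : R -> 'cV[R[i]]_n) : R :=
  \sum_a \int[leb]_x sqnorm (u x a 0).
Arguments sqL2 {n} u.

Lemma sqL2_ge0 n (u : R -> 'cV[R[i]]_n) : 0 <= sqL2 u.
Proof.
by apply: sumr_ge0 => a _; apply: Rintegral_ge0 => x _; exact: sqnorm_ge0.
Qed.

Lemma L2normE n (u : R -> 'cV[R[i]]_n) : L2norm u = Num.sqrt (sqL2 u).
Proof. by []. Qed.

Lemma L2dot_sqL2 n (u : R -> 'cV[R[i]]_n) : L2dot u u = (sqL2 u)%:C.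
Proof.
rewrite /L2dot /sqL2 rmorph_sum; apply: eq_bigr => a _.
rewrite (_ : (fun x => _) = fun x => (sqnorm (u x a 0))%:C); last first.
  by apply/funext => x; exact: mul_conj.
by apply: eqC; rewrite /cintegral /= /Rintegral ?integral0.
Qed.

Lemma sqL2B_le n (u v : R -> 'cV[R[i]]_n) : L2 u -> L2 v ->
  sqL2 (fun x => u x - v x) <= 2 * sqL2 u + 2 * sqL2 v.
Proof.
move=> Lu Lv; rewrite /sqL2 !mulr_sumr -big_split; apply: ler_sum => a _ /=.
have su := L2_summable _ _ a Lu; have sv := L2_summable _ _ a Lv.
rewrite -!RintegralZl// -RintegralD//; [|exact: summableZ..].
apply: le_Rintegral => //.
- exact: L2_summable (L2B _ _ _ Lu Lv).
- by apply: summableD; exact: summableZ.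
- move=> x _; rewrite !mxE; apply: (le_trans (sqnormD_le _ _)).
  by rewrite lerD2l /sqnorm ReN ImN !sqrrN.
Qed.

(** Cauchy-Schwarz in additive form, from t (p - q / t)^2 >= 0 under the
    integral. The weight t is left free for [cvg0_weighted]. *)
Lemma L2dot_le n (u v : R -> 'cV[R[i]]_n) (t : R) : 0 < t -> L2 u -> L2 v ->
  `|Re (L2dot u v)| <= t * sqL2 u + t^-1 * sqL2 v /\
  `|Im (L2dot u v)| <= t * sqL2 u + t^-1 * sqL2 v.
Proof.
move=> t0 Lu Lv.
have step (F : R[i] -> R) : (forall z w, F (z + w) = F z + F w) -> F 0 = 0 ->
    (forall a, `|F (cintegral (fun x => u x a 0 * (v x a 0)^*))| <=
      t * (\int[leb]_x sqnorm (u x a 0)) +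
      t^-1 * (\int[leb]_x sqnorm (v x a 0))) ->
    `|F (L2dot u v)| <= t * sqL2 u + t^-1 * sqL2 v.
  move=> FD F0 Fa; rewrite /L2dot (big_morph F FD F0).
  apply: (le_trans (ler_norm_sum _ _ _)).
  by rewrite /sqL2 !mulr_sumr -big_split; apply: ler_sum => a _ /=.
have pt (z w : R[i]) : `|Re (z * w^*)| <= t * sqnorm z + t^-1 * sqnorm w /\
    `|Im (z * w^*)| <= t * sqnorm z + t^-1 * sqnorm w.
  have tt : t * t^-1 = 1 by rewrite divff// gt_eqF.
  have ti : 0 < t^-1 by rewrite invr_gt0.
  have am (p q : R) : `|p * q| <= (t * p ^+ 2 + t^-1 * q ^+ 2) / 2.
    rewrite ler_norml.
    have h1 : 0 <= t^-1 * (t * p - q) ^+ 2 by rewrite mulr_ge0 ?sqr_ge0 ?ltW.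
    have h2 : 0 <= t^-1 * (t * p + q) ^+ 2 by rewrite mulr_ge0 ?sqr_ge0 ?ltW.
    have e1 : t^-1 * (t * p - q) ^+ 2 = t * p ^+ 2 - 2 * (p * q) + t^-1 * q ^+ 2.
      by field; rewrite gt_eqF.
    have e2 : t^-1 * (t * p + q) ^+ 2 = t * p ^+ 2 + 2 * (p * q) + t^-1 * q ^+ 2.
      by field; rewrite gt_eqF.
    by apply/andP; split; lra.
  have sq (p : R) : 0 <= t * p ^+ 2 /\ 0 <= t^-1 * p ^+ 2.
    by split; rewrite mulr_ge0 ?sqr_ge0 ?ltW.
  rewrite !ReImE /sqnorm; move: z w => [p q] [r s] /=.
  have := sq p; have := sq q; have := sq r; have := sq s.
  move=> [? ?] [? ?] [? ?] [? ?]; split.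
  - rewrite mulrN opprK; apply: (le_trans (ler_normD _ _)).
    by have := am p r; have := am q s; lra.
  - rewrite mulrN; apply: (le_trans (ler_normD _ _)); rewrite normrN.
    by have := am p s; have := am q r; lra.
have suv a := csummable_mul_conj _ _ _ a Lu Lv.
have su a := L2_summable _ _ a Lu; have sv a := L2_summable _ _ a Lv.
have bd a : \int[leb]_x (t * sqnorm (u x a 0) + t^-1 * sqnorm (v x a 0)) =
    t * (\int[leb]_x sqnorm (u x a 0)) + t^-1 * (\int[leb]_x sqnorm (v x a 0)).
  rewrite RintegralD//; last 2 first.
  - by apply: summableZ; exact: su.
  - by apply: summableZ; exact: sv.
  rewrite RintegralZl//; last exact: su.
  by rewrite RintegralZl//; exact: sv.
split; (apply: step => //; first by [exact: ReD|exact: ImD]) => a;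
  rewrite -bd; apply: le_norm_Rintegral; first [exact: (suv a).1 |
   exact: (suv a).2 | by apply: summableD; exact: summableZ |
   by move=> x; have [] := pt (u x a 0) (v x a 0)].
Qed.

End L2space.
Arguments sqL2 {R n} u.

Section Twist.
Local Open Scope classical_set_scope.
Context {R : realType}.
Local Notation Re := complex.Re.
Local Notation Im := complex.Im.

(** An affine substitution followed by a modulation: up to the constant
    factor sqrt a, a unitary map of L^2. *)
Definition twist n (phi : R -> R) (a b : R) (u : R -> 'cV[R[i]]_n) :
  R -> 'cV[R[i]]_n := fun x => expi (phi x) *: u (b + a * x).
Arguments twist {n}.

Variables (phi : R -> R) (cphi : continuous phi) (a b : R) (a_gt0 : 0 < a).

Lemma L2_twist n (u : R -> 'cV[R[i]]_n) : L2 u -> L2 (twist phi a b u).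
Proof.
move=> /L2P Lu; apply/L2P => i; have [m1 m2 su] := Lu i.
have maff : measurable_fun setT (fun x : R => b + a * x).
  by apply: continuous_measurable_fun; cont.
have r1 : measurable_fun setT (fun x : R => Re (u (b + a * x) i 0)).
  exact: measurableT_comp m1 maff.
have r2 : measurable_fun setT (fun x : R => Im (u (b + a * x) i 0)).
  exact: measurableT_comp m2 maff.
have mc : measurable_fun setT (fun x : R => cos (phi x)).
  by apply: continuous_measurable_fun; cont.
have ms : measurable_fun setT (fun x : R => sin (phi x)).
  by apply: continuous_measurable_fun; cont.
split.
- under eq_fun do rewrite mxE ReM /=.
  by apply: measurable_funB; exact: measurable_funM.
- under eq_fun do rewrite mxE ImM /=.
  by apply: measurable_funD; exact: measurable_funM.
- under [X in summable X]eq_fun do rewrite mxE sqnormM sqnorm_expi mul1r.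
  exact: (summable_affine a b a_gt0 _ su).
Qed.

Lemma L2dot_twist n (u v : R -> 'cV[R[i]]_n) : L2 u -> L2 v ->
  L2dot u v = a%:C * L2dot (twist phi a b u) (twist phi a b v).
Proof.
move=> Lu Lv; rewrite /L2dot big_distrr; apply: eq_bigr => i _ /=.
rewrite (cintegral_affine a b _ a_gt0 (csummable_mul_conj _ _ _ i Lu Lv)).2.
congr (_ * cintegral _); apply/funext => x; rewrite !mxE rmorphM /=.
by rewrite mulrACA mul_conj sqnorm_expi mul1r.
Qed.

Lemma sqL2_twist n (u : R -> 'cV[R[i]]_n) : L2 u ->
  sqL2 u = a * sqL2 (twist phi a b u).
Proof.
move=> Lu; have := L2dot_twist _ _ _ Lu Lu; rewrite !L2dot_sqL2 -rmorphM.
by move=> [].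
Qed.

Lemma eqae_twist n (u v : R -> 'cV[R[i]]_n) :
  eqae u v -> eqae (twist phi a b u) (twist phi a b v).
Proof.
move=> uv; apply: (ae_imply _ _ _ (ae_affine a b a_gt0 _ uv)) => x.
by rewrite /twist => ->.
Qed.

End Twist.
Arguments twist {R n}.

Section L2convergence.
Local Open Scope classical_set_scope.
Context {R : realType}.
Local Notation Re := complex.Re.
Local Notation Im := complex.Im.

Definition L2cvg n (u_ : nat -> R -> 'cV[R[i]]_n) (u : R -> 'cV[R[i]]_n) :=
  [/\ forall k, L2 (u_ k), L2 u &
      sqL2 (fun x => u_ k x - u x) @[k --> \oo] --> (0 : R)].
Arguments L2cvg {n}.

(** Given a tolerance, t is first taken so large that v / t is small, and
    then k so large that t p k is small. *)
Lemma cvg0_weighted (z p : nat -> R) (v : R) :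
  (forall t, 0 < t -> forall k, `|z k| <= t * p k + t^-1 * v) ->
  (forall k, 0 <= p k) -> 0 <= v ->
  p @ \oo --> (0 : R) -> z @ \oo --> (0 : R).
Proof.
move=> zp p0 v0 cp; apply/cvgr0Pnorm_le => e e0.
pose t := 2 * (v + 1) / e.
have t0 : 0 < t by rewrite divr_gt0// mulr_gt0// ltr_wpDl.
have et : 0 < e / (2 * t) by rewrite divr_gt0// mulr_gt0.
have /cvgr0Pnorm_le/(_ _ et) small := cp.
near=> k.
have pk : p k <= e / (2 * t).
  by rewrite -[p k]ger0_norm//; near: k; exact: small.
apply: (le_trans (zp t t0 k)).
have h1 : t * p k <= e / 2.
  apply: le_trans (ler_wpM2l (ltW t0) pk) _; rewrite le_eqVlt; apply/orP; left.
  by apply/eqP; field; rewrite gt_eqF.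
have h2 : t^-1 * v <= e / 2.
  have tE : t * (e / 2) = v + 1 by rewrite /t; field; rewrite gt_eqF.
  by rewrite ler_pdivrMl// tE lerDl.
lra.
Unshelve. all: end_near. Qed.

Lemma cvg_L2dot n (u_ v_ : nat -> R -> 'cV[R[i]]_n) u v :
  L2cvg u_ u -> L2cvg v_ v ->
  Re (L2dot (u_ k) (v_ k)) @[k --> \oo] --> Re (L2dot u v) /\
  Im (L2dot (u_ k) (v_ k)) @[k --> \oo] --> Im (L2dot u v).
Proof.
move=> [Lu_ Lu cu] [Lv_ Lv cv].
pose d k x := u_ k x - u x; pose e k x := v_ k x - v x.
have Ld k : L2 (d k) by exact: L2B.
have Le k : L2 (e k) by exact: L2B.
have E k : L2dot (u_ k) (v_ k) = L2dot (d k) v + L2dot u (e k) +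
    L2dot (d k) (e k) + L2dot u v.
  have e1 : u_ k = fun x => 1 *: d k x + u x.
    by apply/funext => x; rewrite scale1r subrK.
  have e2 : v_ k = fun x => 1 *: e k x + v x.
    by apply/funext => x; rewrite scale1r subrK.
  have Lv' := Lv_ k.
  rewrite {1}e1 (L2dot_linl _ _ _ _ _ (Ld k) Lu Lv') mul1r.
  have H w : L2 w -> L2dot w (v_ k) = L2dot w (e k) + L2dot w v.
    move=> Lw; rewrite (L2dotC _ _ _ Lw Lv') e2.
    rewrite (L2dot_linl _ _ _ _ _ (Le k) Lv Lw) mul1r.
    by rewrite (L2dotC _ w (e k) Lw (Le k)) (L2dotC _ w v Lw Lv) rmorphD.
  by rewrite !H//; ring.
have z1 : (forall F : R[i] -> R, F = @complex.Re R \/ F = @complex.Im R ->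
    F (L2dot (d k) v) @[k --> \oo] --> (0 : R)).
  move=> F HF; apply: (cvg0_weighted _ (fun k => sqL2 (d k)) (sqL2 v)).
  - move=> t t0 k; have [h1 h2] := L2dot_le _ _ _ t t0 (Ld k) Lv.
    by case: HF => ->.
  - by move=> k; exact: sqL2_ge0.
  - exact: sqL2_ge0.
  - exact: cu.
have z2 : (forall F : R[i] -> R, F = @complex.Re R \/ F = @complex.Im R ->
    F (L2dot u (e k)) @[k --> \oo] --> (0 : R)).
  move=> F HF; apply: (cvg0_weighted _ (fun k => sqL2 (e k)) (sqL2 u)).
  - move=> t t0 k; have ti : 0 < t^-1 by rewrite invr_gt0.
    have [h1 h2] := L2dot_le _ _ _ t^-1 ti Lu (Le k).
    by rewrite addrC; rewrite invrK in h1 h2; case: HF => ->.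
  - by move=> k; exact: sqL2_ge0.
  - exact: sqL2_ge0.
  - exact: cv.
have z3 : (forall F : R[i] -> R, F = @complex.Re R \/ F = @complex.Im R ->
    F (L2dot (d k) (e k)) @[k --> \oo] --> (0 : R)).
  move=> F HF; apply: norm_cvg0.
  have up : sqL2 (d k) + sqL2 (e k) @[k --> \oo] --> (0 : R).
    rewrite -[X in _ --> X]addr0; apply: cvgD; [exact: cu|exact: cv].
  apply: (squeeze_cvgr _ _ up); last exact: (@cvg_cst _ (0 : R)).
  apply: nearW => k; rewrite normr_ge0 /=.
  have [] := L2dot_le _ _ _ 1 ltr01 (Ld k) (Le k).
  by rewrite invr1 !mul1r; case: HF => ->.
have cF (F : R[i] -> R) : F = @complex.Re R \/ F = @complex.Im R -> {morph F : x y / x + y} ->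
    F (L2dot (u_ k) (v_ k)) @[k --> \oo] --> F (L2dot u v).
  move=> HF FD.
  rewrite [X in X @ \oo --> _](_ : _ = fun k => F (L2dot (d k) v) +
      F (L2dot u (e k)) + F (L2dot (d k) (e k)) + F (L2dot u v)); last first.
    by apply/funext => k; rewrite E !FD.
  rewrite [X in _ --> X](_ : _ = 0 + 0 + 0 + F (L2dot u v)); last first.
    by rewrite !add0r.
  apply: cvgD; last exact: cvg_cst.
  by apply: cvgD; [apply: cvgD; [exact: z1|exact: z2]|exact: z3].
by split; apply: cF; first [by left|by right|exact: ReD|exact: ImD].
Qed.

Lemma L2dot_lim_unique m n (u_ v_ : nat -> R -> 'cV[R[i]]_m) u v
    (u'_ v'_ : nat -> R -> 'cV[R[i]]_n) u' v' :
  L2cvg u_ u -> L2cvg v_ v -> L2cvg u'_ u' -> L2cvg v'_ v' ->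
  (forall k, L2dot (u_ k) (v_ k) = L2dot (u'_ k) (v'_ k)) ->
  L2dot u v = L2dot u' v'.
Proof.
move=> cu cv cu' cv' E.
have [r1 i1] := cvg_L2dot _ _ _ _ _ cu cv.
have [r2 i2] := cvg_L2dot _ _ _ _ _ cu' cv'.
apply: eqC.
- rewrite -(cvg_lim _ r1)//; under eq_fun do rewrite E.
  exact: cvg_lim.
- rewrite -(cvg_lim _ i1)//; under eq_fun do rewrite E.
  exact: cvg_lim.
Qed.

End L2convergence.
Arguments L2cvg {R n}.

(** * Weyl quantization rescaled at a point of phase space *)

Section WaveWeyl.
Local Open Scope classical_set_scope.
Context {R : realType}.
Local Notation Re := complex.Re.
Local Notation Im := complex.Im.

Lemma expi_coord (t : R) (z : R[i]) :
  expi t * z = (cos t * Re z - cos (t - pi / 2) * Im z) +i*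
               (cos t * Im z + cos (t - pi / 2) * Re z).
Proof. by apply: eqC; rewrite ?ReM ?ImM /= cosBpihalf. Qed.

(** The phase expi ((X - y) xi) has cosine and sine parts, each of them
    paired with the real and the imaginary part of the amplitude. *)
Lemma cintegral2_osc (M X : R) (A B : R -> R -> R) :
  amplitude M A -> amplitude M B ->
  csummable2 (fun xi y => expi ((X - y) * xi) * (A y xi +i* B y xi)) /\
  cintegral2 (fun xi y => expi ((X - y) * xi) * (A y xi +i* B y xi)) =
    (osc2 A X 0 - osc2 B X (- (pi / 2))) +i*
    (osc2 B X 0 + osc2 A X (- (pi / 2))).
Proof.
move=> hA hB.
have E xi y : expi ((X - y) * xi) * (A y xi +i* B y xi) =
    (cos ((X - y) * xi + 0) * A y xi - cos ((X - y) * xi + - (pi / 2)) * B y xi)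
    +i* (cos ((X - y) * xi + 0) * B y xi +
         cos ((X - y) * xi + - (pi / 2)) * A y xi).
  by rewrite expi_coord addr0.
have sA th xi := osc_integrand_summable _ _ X th xi hA.
have sB th xi := osc_integrand_summable _ _ X th xi hB.
have E2 : (fun xi => cintegral (fun y =>
      expi ((X - y) * xi) * (A y xi +i* B y xi))) =
    fun xi => (osc A X 0 xi - osc B X (- (pi / 2)) xi) +i*
              (osc B X 0 xi + osc A X (- (pi / 2)) xi).
  apply/funext => xi; under eq_fun do rewrite E.
  apply: eqC; rewrite /cintegral /=.
  - by rewrite RintegralB//; [exact: sA|exact: sB].
  - by rewrite RintegralD//; [exact: sB|exact: sA].
rewrite /csummable2 /cintegral2 E2; split.
  split.
    move=> xi; under eq_fun do rewrite E.
    split.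
      by apply: summableB; [exact: sA|exact: sB].
    by apply: summableD; [exact: sB|exact: sA].
  by split; [apply: summableB|apply: summableD];
    first [exact: summable_osc hA|exact: summable_osc hB].
rewrite /cintegral /= RintegralB//; last 2 first.
- exact: summable_osc hA.
- exact: summable_osc hB.
rewrite RintegralD//; [exact: summable_osc hB|exact: summable_osc hA].
Qed.

Variables (e x0 xi0 : R) (e_gt0 : 0 < e).

(** Coherent rescaling at (x0, xi0) for h = e^2: [wave] localizes at x0 on
    the scale e, with oscillations of frequency xi0 / h, and [unwave]
    inverts it. *)
Definition wave n (F : R -> 'cV[R[i]]_n) : R -> 'cV[R[i]]_n :=
  twist (fun x => x * (xi0 / e ^+ 2)) e^-1 (- (x0 / e)) F.

Definition unwave n (u : R -> 'cV[R[i]]_n) : R -> 'cV[R[i]]_n :=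
  twist (fun X => - ((x0 + e * X) * (xi0 / e ^+ 2))) e x0 u.

Lemma waveK n (F : R -> 'cV[R[i]]_n) : unwave n (wave n F) = F.
Proof.
apply/funext => X; rewrite /unwave /wave /twist scalerA expi_mulN scale1r.
by congr F; field; rewrite gt_eqF.
Qed.

(** The substitutions y -> x0 + e y and xi -> xi0 + e xi turn the phase (x -
    y) xi / e^2 into (X - y) xi, up to modulations that [wave] and [unwave]
    cancel: after rescaling, the parameter of the quantization is 1. *)
Lemma weyl_wave m n (p : R -> R -> R -> 'M[R[i]]_(m, n))
    (F : R -> 'cV[R[i]]_n) (X : R) :
  (forall a b, csummable2 (fun xi y => expi ((X - y) * xi) *
    (p (x0 + e * ((X + y) / 2)) (xi0 + e * xi) (e ^+ 2) a b * F y b 0))) ->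
  unwave m (weyl (e ^+ 2) p (wave n F)) X =
  \col_a (((2 * pi)^-1)%:C * \sum_b cintegral2 (fun xi y =>
    expi ((X - y) * xi) *
    (p (x0 + e * ((X + y) / 2)) (xi0 + e * xi) (e ^+ 2) a b * F y b 0))).
Proof.
move=> sF; apply/matrixP => a k; rewrite (ord1 k) {k} !mxE.
set x := x0 + e * X; set h := e ^+ 2.
have h0 : h != 0 by rewrite expf_neq0// gt_eqF.
have e0 : e != 0 by rewrite gt_eqF.
have ei : 0 < e^-1 by rewrite invr_gt0.
pose G b (xi y : R) : R[i] := expi ((X - y) * xi) *
    (p (x0 + e * ((X + y) / 2)) (xi0 + e * xi) h a b * F y b 0).
have sG b : csummable2 (G b) by exact: sF.
pose H b (xi y : R) := G b (- (xi0 / e) + e^-1 * xi) (- (x0 / e) + e^-1 * y).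
have hH b : csummable2 (H b) /\ cintegral2 (H b) = h%:C * cintegral2 (G b).
  have [h1 h2] := cintegral2_affine e^-1 (- (xi0 / e)) e^-1 (- (x0 / e)) _ ei ei
    (sG b).
  split; first exact: h1.
  rewrite [X in _ = _ * X]h2 mulrA -rmorphM.
  have -> : h * (e^-1 * e^-1) = 1 by rewrite /h; field.
  by rewrite mul1r.
pose K := expi (x * (xi0 / h)) : R[i].
have hK b := cintegral2Z K (H b) (hH b).1.
have [_ S2] := cintegral2_sum _ (fun b xi y => K * H b xi y) (fun b => (hK b).1).
rewrite [X in _ * (_ * X)](_ : _ =
    cintegral2 (fun xi y => \sum_b K * H b xi y)); last first.
  congr cintegral; apply/funext => xi; rewrite mxE; congr cintegral.
  apply/funext => y; rewrite !mxE big_distrr; apply: eq_bigr => b _.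
  rewrite /= /wave /twist mxE.
  rewrite /H /G -/x -/h.
  have -> : x0 + e * ((X + (- (x0 / e) + e^-1 * y)) / 2) = (x + y) / 2.
    by rewrite /x; field.
  have -> : xi0 + e * (- (xi0 / e) + e^-1 * xi) = xi by field.
  rewrite !mulrA -[in RHS]expiD.
  rewrite -[expi _ * _ * expi _]mulrAC -expiD; congr (expi _ * _ * _).
  by rewrite /x /h; field.
rewrite S2 [X in _ * (_ * X)](_ : _ = K * (h%:C * \sum_b cintegral2 (G b))).
  set T := \sum_b _; set r := (2 * pi * h)^-1.
  have KK : expi (- (x * (xi0 / h))) * K = 1 := expi_mulN _.
  rewrite (_ : expi _ * _ = expi (- (x * (xi0 / h))) * K * (r%:C * h%:C * T));
    last by ring.
  rewrite KK mul1r -rmorphM; congr (_%:C * _).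
  have pi0 : pi != 0 :> R by rewrite gt_eqF ?pi_gt0.
  by rewrite /r -/h invfM mulfVK.
rewrite !big_distrr; apply: eq_bigr => b _ /=.
by rewrite (hK b).2 [X in K * X](hH b).2.
Qed.

End WaveWeyl.
Arguments wave {R} e x0 xi0 {n} F.
Arguments unwave {R} e x0 xi0 {n} u.

Section DominatedL2.
Local Open Scope classical_set_scope.
Context {R : realType}.
Local Notation leb := (@lebesgue_measure R).
Local Notation Re := complex.Re.
Local Notation Im := complex.Im.

Lemma cvg_fin_sum (I : finType) (f : I -> nat -> R) (l : I -> R) :
  (forall i, f i @ \oo --> l i) ->
  \sum_i f i k @[k --> \oo] --> \sum_i l i.
Proof. by move=> fl; apply: cvg_big => // x; exact: add_continuous. Qed.

Lemma L2cvg_dominated n (u_ : nat -> R -> 'cV[R[i]]_n) u (g : R -> R) :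
  (forall k, L2 (u_ k)) -> L2 u -> summable g ->
  {ae leb, forall x, forall k a, sqnorm (u_ k x a 0) <= g x} ->
  {ae leb, forall x, forall a,
    Re (u_ k x a 0) @[k --> \oo] --> Re (u x a 0) /\
    Im (u_ k x a 0) @[k --> \oo] --> Im (u x a 0)} ->
  L2cvg u_ u.
Proof.
move=> Lu_ Lu sg dom cv; split => //.
have main a :
    \int[leb]_x sqnorm ((u_ k x - u x) a 0) @[k --> \oo] --> (0 : R).
  have -> : (0 : R) = \int[leb]_x (fun=> 0) x by rewrite /Rintegral integral0.
  apply: (@cvg_Rintegral _ _ _
    (fun x => 2 * g x + 2 * sqnorm (u x a 0)) _ _ _ _ _).2.
  - by move=> k; apply: summable_measurable;
      exact: L2_summable (L2B _ _ _ (Lu_ k) Lu).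
  - exact: measurable_cst.
  - apply: ae_imply cv => x /(_ a)[c1 c2].
    rewrite /sqnorm; rewrite -[X in _ --> X]addr0.
    have z (v_ : nat -> R) (v : R) : v_ @ \oo --> v ->
        (v_ k - v) ^+ 2 @[k --> \oo] --> (0 : R).
      move=> cvv; rewrite -[X in _ --> X](mulr0 0).
      rewrite (_ : (fun k => _) = fun k => (v_ k - v) * (v_ k - v)); last first.
        by apply/funext => k; rewrite expr2.
      by apply: cvgM; apply/subr_cvg0.
    rewrite (_ : (fun k => _) = fun k => (Re (u_ k x a 0) - Re (u x a 0)) ^+ 2 +
       (Im (u_ k x a 0) - Im (u x a 0)) ^+ 2); last first.
      by apply/funext => k; rewrite !mxE !ReImE.
    by apply: cvgD; exact: z.
  - apply: ae_imply dom => x h k; rewrite ger0_norm ?sqnorm_ge0// !mxE.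
    apply: (le_trans (sqnormD_le _ _)).
    rewrite [sqnorm (- _)]/sqnorm ReN ImN !sqrrN lerD2r ler_pM2l//.
  - by apply: summableD; apply: summableZ => //; exact: L2_summable.
rewrite /sqL2 [X in _ --> X](_ : _ = \sum_(a < n) 0); last by rewrite big1.
by apply: cvg_fin_sum => a; exact: main.
Qed.

End DominatedL2.

(** * Symbols as amplitudes of oscillatory integrals *)

Section SymbolAmplitude.
Local Open Scope classical_set_scope.
Context {R : realType}.
Local Notation leb := (@lebesgue_measure R).
Implicit Types (f : R -> R -> R) (B e X th : R).

(** The part of the symbol estimates that controls oscillatory integrals:
    two derivatives in x for the decay in xi, and one more in xi, required
    in [bounded_x2xi1], for the decay in X. *)
Definition bounded_x2 B f : Prop :=
  (forall x, continuous (f x)) /\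
  exists f1 f2 : R -> R -> R,
  [/\ forall xi x : R, is_derive x 1 (f ^~ xi) (f1 x xi),
      forall xi x : R, is_derive x 1 (f1 ^~ xi) (f2 x xi),
      forall xi, continuous (f2 ^~ xi) &
      forall x xi, [/\ `|f x xi| <= B, `|f1 x xi| <= B & `|f2 x xi| <= B]].

Definition bounded_x2xi1 B f : Prop :=
  exists g : R -> R -> R,
  [/\ forall x xi : R, is_derive xi 1 (f x) (g x xi),
      bounded_x2 B f & bounded_x2 B g].

(** Each y-derivative of the symbol costs a factor e / 2 <= 1, so the bound
    is uniform in e; the constant 4 = 1 + 2 + 1 comes from the Leibniz rule
    for the second derivative. *)
Lemma amplitude_symbol B C e (x0 xi0 : R) X f (H H1 H2 : R -> R) :
  0 <= e <= 1 -> bounded_x2 B f ->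
  (forall y : R, is_derive y 1 H (H1 y)) ->
  (forall y : R, is_derive y 1 H1 (H2 y)) -> continuous H2 ->
  (forall y, [/\ `|H y| <= C * lorentz y, `|H1 y| <= C * lorentz y &
                 `|H2 y| <= C * lorentz y]) ->
  amplitude (4 * (B * C))
    (fun y xi => f (x0 + e * ((X + y) / 2)) (xi0 + e * xi) * H y).
Proof.
move=> /andP[e0 e1] [cf [f1 [f2 [df df1 cf2 bf]]]] dH dH1 cH2 bH.
have B0 : 0 <= B by have [b _ _] := bf 0 0; exact: le_trans b.
pose t y : R := x0 + e * ((X + y) / 2); pose s xi : R := xi0 + e * xi.
have dcomp (g g1 : R -> R -> R) : (forall xi x : R, is_derive x 1 (g ^~ xi) (g1 x xi)) ->
    forall xi y : R, is_derive y 1 (fun y => g (t y) (s xi))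
      (g1 (t y) (s xi) * (e / 2)).
  move=> dg xi y.
  have dt : is_derive y 1 t (e / 2) by rewrite /t; der; field.
  exact: (der_comp (g ^~ (s xi)) _ t y _ (dg (s xi) (t y)) dt).
have cs : continuous s by rewrite /s; cont.
have ct : continuous t by rewrite /t; cont.
split.
  move=> y; have cfs : continuous (fun xi => f (t y) (s xi)).
    exact: (cont_comp (f (t y)) s (cf _) cs).
  by rewrite -/(t y); cont.
exists (fun y xi => f1 (t y) (s xi) * (e / 2) * H y + f (t y) (s xi) * H1 y),
  (fun y xi => f2 (t y) (s xi) * (e / 2) * (e / 2) * H y +
     2 * (f1 (t y) (s xi) * (e / 2) * H1 y) + f (t y) (s xi) * H2 y); split.
- move=> xi y; have h1 := dcomp f f1 df xi y; have h2 := dH y.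
  by der; ring.
- move=> xi y; have h1 := dcomp f f1 df xi y; have h2 := dH y.
  have h3 := dH1 y; have h4 := dcomp f1 f2 df1 xi y.
  by der; ring.
- move=> xi.
  have c0 : continuous (fun y => f (t y) (s xi)).
    exact: continuous_is_derive (dcomp f f1 df xi).
  have c1 : continuous (fun y => f1 (t y) (s xi)).
    exact: continuous_is_derive (dcomp f1 f2 df1 xi).
  have c2 : continuous (fun y => f2 (t y) (s xi)).
    exact: (cont_comp (f2 ^~ (s xi)) t (cf2 _) ct).
  have c3 := continuous_is_derive _ _ dH.
  have c4 := continuous_is_derive _ _ dH1.
  by cont.
- move=> y xi; rewrite -/(t y) -/(s xi).
  have [b0 b1 b2] := bf (t y) (s xi); have [k0 k1 k2] := bH y.
  set l := lorentz y in k0 k1 k2 *.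
  have l0 : 0 <= l by exact: lorentz_ge0.
  have pm (u v c : R) : `|u| <= B -> `|v| <= C * l -> 0 <= c <= 1 ->
      `|u * c * v| <= B * C * l.
    move=> hu hv /andP[c0 c1]; rewrite !normrM [`|c|]ger0_norm// -mulrA.
    rewrite -[leRHS]mulrA; apply: ler_pM => //; first by rewrite mulr_ge0.
    by apply: le_trans hv; rewrite ler_piMl.
  have ee : 0 <= e / 2 <= 1 by apply/andP; split; lra.
  have ee2 : 0 <= e / 2 * (e / 2) <= 1.
    by move: ee => /andP[? ?]; rewrite mulr_ge0//= mulr_ile1.
  have p0 v : `|v| <= C * l -> `|f (t y) (s xi) * v| <= B * C * l.
    by move=> hv; have := pm _ _ 1 b0 hv; rewrite mulr1; apply; rewrite ler01 lexx.
  have BCl : 0 <= B * C * l.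
    exact: le_trans (normr_ge0 _) (p0 _ k0).
  rewrite (_ : 4 * (B * C) * l = B * C * l + B * C * l + B * C * l + B * C * l);
    last by ring.
  set b := B * C * l in pm p0 BCl *.
  split.
  + by have := p0 _ k0; lra.
  + apply: (le_trans (ler_normD _ _)).
    have := p0 _ k1; have := pm _ _ _ b1 k0 ee; lra.
  + apply: (le_trans (ler_normD _ _)).
    have q3 := p0 _ k2; have q2 := pm _ _ _ b1 k1 ee.
    have q1 := pm _ _ _ b2 k0 ee2; rewrite mulrA in q1.
    apply: (@le_trans _ _ ((b + 2 * b) + b)); last by lra.
    apply: lerD => //; apply: (le_trans (ler_normD _ _)); apply: lerD => //.
    by rewrite normrM [`|2|]ger0_norm// ler_pM2l.
Qed.

Definition symbol_gauss f e x0 xi0 X (y xi : R) : R :=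
  f (x0 + e * ((X + y) / 2)) (xi0 + e * xi) * gauss y.

(** Uniformity in e and X is the point: the derivative in xi needed for the
    decay in X produces a factor e <= 1. *)
Lemma osc2_symbol_le : exists K : R, 0 <= K /\
  forall B f e (x0 xi0 : R) X th, 0 <= e <= 1 -> bounded_x2xi1 B f ->
  amplitude (4 * (B * K)) (symbol_gauss f e x0 xi0 X) /\
  (1 + `|X|) * `|osc2 (symbol_gauss f e x0 xi0 X) X th| <= K * B.
Proof.
have [C hC] := @gauss_bounds R.
pose L := \int[leb]_y @lorentz R y.
have L0 : 0 <= L := L_ge0.
have C0 : 0 <= C.
  by have [[h _ _] _] := hC 0; exact: lorentz_majorant_ge0 h.
(* 24 = 6 * 4, from [osc2_decay] and [amplitude_symbol]. *)
exists (C + 24 * C * L * L); split.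
  by rewrite addr_ge0// !mulr_ge0.
move=> B f e x0 xi0 X th he [g [dg bf bg]].
have B0 : 0 <= B.
  by move: bf => [_ [f1 [f2 [_ _ _ /(_ 0 0) [b _ _]]]]]; exact: le_trans b.
have cg := @continuous_gauss R.
have hA : amplitude (4 * (B * C)) (symbol_gauss f e x0 xi0 X).
  apply: (amplitude_symbol _ _ _ _ _ _ _ gauss _ _ he bf
    (@der_gauss R) (@der_gauss1 R)); first by cont.
  by move=> y; exact: (hC y).1.
have hP : amplitude (4 * (B * C))
    (fun y xi => y * symbol_gauss f e x0 xi0 X y xi).
  have := amplitude_symbol B C e x0 xi0 X f _ _ _ he bf
    (@der_mul_gauss R) (@der_mul_gauss1 R).
  rewrite (_ : (fun y xi => y * _) = (fun y xi =>
    f (x0 + e * ((X + y) / 2)) (xi0 + e * xi) * (y * gauss y))); last first.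
    by apply/funext => y; apply/funext => xi; rewrite mulrCA.
  by apply; [cont|move=> y; exact: (hC y).2].
have hB : amplitude (4 * (B * C)) (fun y xi =>
     e * symbol_gauss g e x0 xi0 X y xi).
  have h := amplitude_symbol B C e x0 xi0 X g gauss _ _ he bg
    (@der_gauss R) (@der_gauss1 R).
  have hg : amplitude (4 * (B * C)) (symbol_gauss g e x0 xi0 X).
    by apply: h; [cont|move=> y; exact: (hC y).1].
  apply: amplitude_mono (amplitude_scale e _ _ hg); move/andP: he => [e0 e1].
  by rewrite ger0_norm// ler_piMl// !mulr_ge0.
have dA (y xi : R) : is_derive xi 1 (symbol_gauss f e x0 xi0 X y)
    (e * symbol_gauss g e x0 xi0 X y xi).
  have ds : is_derive xi 1 (fun xi => xi0 + e * xi) e by der; ring.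
  have dgs := der_comp (f (x0 + e * ((X + y) / 2))) _ _ xi _
    (dg (x0 + e * ((X + y) / 2)) (xi0 + e * xi)) ds.
  by rewrite /symbol_gauss; der; ring.
split.
  apply: amplitude_mono hA; rewrite ler_wpM2l// ler_wpM2l// lerDl.
  by rewrite !mulr_ge0.
apply: le_trans (osc2_decay _ _ _ X th hA hB hP dA) _.
rewrite -/L (_ : _ * _ = 24 * C * L * L * B); last by ring.
by rewrite ler_wpM2r// lerDr.
Qed.

(** In the limit the symbol is frozen at (x0, xi0), which leaves the Fourier
    inversion of the Gaussian. *)
Lemma cvg_osc2_symbol B (f_ : nat -> R -> R -> R) f (e_ d_ : nat -> R)
    (x0 xi0 : R) X th :
  (forall k, 0 <= e_ k <= 1) -> e_ @ \oo --> (0 : R) ->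
  (forall k, bounded_x2xi1 B (f_ k)) ->
  continuous (fun z : R * R => f z.1 z.2) ->
  (forall k x xi, `|f_ k x xi - f x xi| <= d_ k) -> d_ @ \oo --> (0 : R) ->
  osc2 (symbol_gauss (f_ k) (e_ k) x0 xi0 X) X th @[k --> \oo] -->
    f x0 xi0 * (2 * pi * cos th * gauss X).
Proof.
move=> he ce bf cf fd cd.
have [K [K0 hK]] := osc2_symbol_le.
have [M [hM _]] := @amplitude_gauss R.
set c := f x0 xi0.
have amp0 : amplitude (`|c| * M) (fun y _ => c * gauss y).
  exact: amplitude_scale hM.
have M0 := amplitude_ge0 _ _ hM.
have B0 : 0 <= B.
  by have [g [_ [_ [f1 [f2 [_ _ _ /(_ 0 0) [b0 _ _]]]]] _]] := bf 0%N;
    exact: le_trans b0.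
rewrite -osc2_gauss.
have -> : f x0 xi0 * osc2 (fun y _ => gauss y) X th =
    osc2 (fun y _ => c * gauss y) X th.
  rewrite /osc2 -RintegralZl//; last exact: summable_osc hM.
  apply: eq_Rintegral => xi _; rewrite /osc -RintegralZl//; last first.
    exact: (osc_integrand_summable _ _ X th xi hM).
  by apply: eq_Rintegral => y _; rewrite mulrCA.
apply: (cvg_osc2 (`|c| * M + 4 * (B * K))).
- move=> k; have [h _] := hK B (f_ k) (e_ k) x0 xi0 X th (he k) (bf k).
  by apply: amplitude_mono h; rewrite lerDr mulr_ge0.
- by apply: amplitude_mono amp0; rewrite lerDl !mulr_ge0.
- move=> y xi; rewrite /symbol_gauss; apply: cvgMl.
  pose z k := (x0 + e_ k * ((X + y) / 2), xi0 + e_ k * xi).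
  have aff (a s : R) : a + e_ k * s @[k --> \oo] --> a.
    rewrite -[X in _ --> X]addr0 -[X in _ --> _ + X](mul0r s).
    by apply: cvgD; [exact: cvg_cst|apply: cvgMl; exact: ce].
  have cfz : f (z k).1 (z k).2 @[k --> \oo] --> c.
    exact: (cvg_comp2 (aff _ _) (aff _ _) (cf (x0, xi0))).
  have cdiff : f_ k (z k).1 (z k).2 - f (z k).1 (z k).2 @[k --> \oo] --> (0 : R).
    apply: norm_cvg0; apply: (squeeze_cvgr _ _ cd); last exact: (@cvg_cst _ (0 : R)).
    by apply: nearW => k; rewrite normr_ge0 /=.
  rewrite -[X in _ --> X]add0r.
  rewrite (_ : (fun k => _) = fun k =>
     (f_ k (z k).1 (z k).2 - f (z k).1 (z k).2) + f (z k).1 (z k).2).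
    by apply: cvgD.
  by apply/funext => k; rewrite subrK.
Qed.

End SymbolAmplitude.

Section SymbolClass.
Local Open Scope classical_set_scope.
Context {R : realType}.
Local Notation Re := complex.Re.
Local Notation Im := complex.Im.
Implicit Types (f g : R -> R -> R).

Lemma is_derive_derive1 (F : R -> R) (x : R) :
  derivable F x 1 -> is_derive x 1 F (derive1 F x).
Proof. by move=> dF; rewrite derive1E; exact/derivableP. Qed.

Lemma classC2_continuous k f :
  classC2 k f -> continuous (fun z : R * R => f z.1 z.2).
Proof. by case: k => [[]|k []]. Qed.

Lemma classC2W k f : classC2 k.+1 f -> classC2 k f.
Proof.
elim: k f => [|k IH] f [cf h]; first exact: (conj cf I).
case: h => dx dxi cfx cfxi.
exact: (conj cf (And4 dx dxi (IH _ cfx) (IH _ cfxi))).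
Qed.

Lemma classC2_slices k f : classC2 k f ->
  (forall x, continuous (f x)) /\ (forall xi, continuous (f ^~ xi)).
Proof.
move=> /classC2_continuous cf; split=> [x|xi] y.
- exact: (cvg_comp2 (@cvg_cst _ x _ _ _) cvg_id (cf (x, y))).
- exact: (cvg_comp2 cvg_id (@cvg_cst _ xi _ _ _) (cf (y, xi))).
Qed.

Lemma classC2_bounded_x2 B f : classC2 2 f ->
  (forall j x xi, (j <= 2)%N -> `|rpderiv j 0 f x xi| <= B) ->
  bounded_x2 B f.
Proof.
move=> cf bf; split; first exact: (classC2_slices _ _ cf).1.
have [_ [dx _ cfx _]] := cf; have [_ [dxx _ cfxx _]] := cfx.
have c2 : classC2 0 (fun x xi => derive1 (derive1 (f ^~ xi)) x) by exact: cfxx.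
exists (fun x xi => derive1 (f ^~ xi) x),
  (fun x xi => derive1 (derive1 (f ^~ xi)) x); split.
- by move=> xi x; exact: is_derive_derive1.
- by move=> xi x; apply: is_derive_derive1; exact: dxx.
- exact: (classC2_slices _ _ c2).2.
- by move=> x xi; split; [exact: (bf 0%N)|exact: (bf 1%N)|exact: (bf 2%N)].
Qed.

Lemma classC2_bounded B f : classC2 3 f ->
  (forall j k x xi, (j <= 2)%N -> (k <= 1)%N -> `|rpderiv j k f x xi| <= B) ->
  bounded_x2xi1 B f.
Proof.
move=> cf bf; have [c0 [dx dxi cfx cfxi]] := cf.
exists (fun x xi => derive1 (f x) xi); split.
- by move=> x xi; exact: is_derive_derive1.
- apply: classC2_bounded_x2; last by move=> j x xi j2; exact: bf.
  exact: classC2W cf.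
- apply: classC2_bounded_x2; first exact: cfxi.
  move=> j x xi j2.
  exact: (bf j 1%N).
Qed.

Lemma derive1_sub (c : R) (u v : R -> R) x :
  derivable u x 1 -> derivable v x 1 ->
  derive1 (fun y => u y - c * v y) x = derive1 u x - c * derive1 v x.
Proof.
move=> /is_derive_derive1 du /is_derive_derive1 dv.
have d : is_derive x 1 (fun y => u y - c * v y) (derive1 u x - c * derive1 v x).
  by der; ring.
by rewrite derive1E; exact: derive_val.
Qed.

Lemma derive1n_sub (c : R) (u v : R -> R) j :
  (forall x, derivable u x 1) -> (forall x, derivable v x 1) ->
  (forall x, derivable (derive1 u) x 1) -> (forall x, derivable (derive1 v) x 1) ->
  (j <= 2)%N -> forall x,
  derive1n j (fun y => u y - c * v y) x = derive1n j u x - c * derive1n j v x.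
Proof.
move=> du dv du1 dv1; case: j => [//|[_ x|[_ x|//]]].
- exact: derive1_sub.
- have E : derive1 (fun y => u y - c * v y) =
      fun y => derive1 u y - c * derive1 v y.
    by apply/funext => y; exact: derive1_sub.
  rewrite -[LHS]/(derive1 (derive1 (fun y => u y - c * v y)) x) E.
  exact: (derive1_sub c (derive1 u) (derive1 v) x (du1 x) (dv1 x)).
Qed.

(** Derivatives are computed slicewise, so linearity requires
    differentiability of each intermediate slice; this is why C^3 is assumed
    for at most three derivatives. *)
Lemma rpderiv_sub (c : R) f g j k x xi : classC2 3 f -> classC2 3 g ->
  (j <= 2)%N -> (k <= 1)%N ->
  rpderiv j k (fun x xi => f x xi - c * g x xi) x xi =
  rpderiv j k f x xi - c * rpderiv j k g x xi.
Proof.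
move=> [_ [fx fxi cfx cfxi]] [_ [gx gxi cgx cgxi]] j2.
have [_ [fxx _ _ _]] := cfx; have [_ [gxx _ _ _]] := cgx.
have [_ [fxix _ cfxix _]] := cfxi; have [_ [gxix _ cgxix _]] := cgxi.
have [_ [fxixx _ _ _]] := cfxix; have [_ [gxixx _ _ _]] := cgxix.
case: k => [_|[_|//]].
- by rewrite /rpderiv; apply: (derive1n_sub c (f ^~ xi) (g ^~ xi)).
- have E : (fun x' => derive1 (fun xi => f x' xi - c * g x' xi) xi) =
      fun x' => derive1 (f x') xi - c * derive1 (g x') xi.
    by apply/funext => x'; exact: derive1_sub.
  rewrite -[LHS]/(derive1n j
    (fun x' => derive1 (fun xi => f x' xi - c * g x' xi) xi) x) E.
  by apply: (derive1n_sub c (fun x' => derive1 (f x') xi)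
    (fun x' => derive1 (g x') xi)).
Qed.

Lemma norm_le_coord (z : R[i]) (c : R) :
  `|z| <= c%:C -> `|Re z| <= c /\ `|Im z| <= c.
Proof.
case: z => a b; rewrite lecE /= => /andP[_ h].
have s0 : 0 <= a ^+ 2 + b ^+ 2 by rewrite addr_ge0 ?sqr_ge0.
split; apply: le_trans h; rewrite -sqrtr_sqr ler_wsqrtr//.
- by rewrite lerDl sqr_ge0.
- by rewrite lerDr sqr_ge0.
Qed.

End SymbolClass.

(** * Gaussian packets *)

Section Packets.
Local Open Scope classical_set_scope.
Context {R : realType}.
Local Notation Re := complex.Re.
Local Notation Im := complex.Im.

(** A Gaussian with leading amplitude al and first-order correction be. *)
Definition packet n (al be : 'cV[R[i]]_n) (y : R) : 'cV[R[i]]_n :=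
  (gauss y)%:C *: (al + y%:C *: be).
Arguments packet {n}.

Lemma L2_packet n (al be : 'cV[R[i]]_n) : L2 (packet al be).
Proof.
have [C hC] := @gauss_bounds R.
have cg := @continuous_gauss R.
have ReE (a : 'I_n) y : Re (packet al be y a 0) =
    gauss y * (Re (al a 0) + y * Re (be a 0)).
  by rewrite !mxE !ReImE /=; ring.
have ImE (a : 'I_n) y : Im (packet al be y a 0) =
    gauss y * (Im (al a 0) + y * Im (be a 0)).
  by rewrite !mxE !ReImE /=; ring.
have C0 : 0 <= C.
  by have [[h _ _] _] := hC 0; exact: lorentz_majorant_ge0 h.
have l1 (y : R) : lorentz y <= 1.
  exact: lorentz_le1.
have bnd (p q y : R) : (gauss y * (p + y * q)) ^+ 2 <=
    (C * (`|p| + `|q|)) ^+ 2 * lorentz y.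
  have [[h0 _ _] [h1 _ _]] := hC y.
  have h : `|gauss y * (p + y * q)| <= C * (`|p| + `|q|) * lorentz y.
    rewrite mulrDr (le_trans (ler_normD _ _))// [gauss y * p]mulrC.
    rewrite (mulrCA (gauss y)) [gauss y * q]mulrC mulrCA !normrM.
    rewrite normrM in h1.
    have := ler_wpM2l (normr_ge0 p) h0; have := ler_wpM2l (normr_ge0 q) h1.
    lra.
  rewrite -real_normK ?num_real// (le_trans (_ : _ <=
      (C * (`|p| + `|q|) * lorentz y) ^+ 2))//.
    by rewrite lerXn2r ?nnegrE// (le_trans (normr_ge0 _) h).
  rewrite exprMn ler_wpM2l ?sqr_ge0// expr2 ler_piMl ?lorentz_ge0//.
pose S := \sum_a ((C * (`|Re (al a 0)| + `|Re (be a 0)|)) ^+ 2 +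
    (C * (`|Im (al a 0)| + `|Im (be a 0)|)) ^+ 2).
apply: (@L2_le _ _ _ (fun y => S * lorentz y)).
- move=> a; under eq_fun do rewrite ReE.
  by apply: continuous_measurable_fun; cont.
- move=> a; under eq_fun do rewrite ImE.
  by apply: continuous_measurable_fun; cont.
- by apply: summableZ; exact: summable_lorentz.
- move=> a y; rewrite /sqnorm ReE ImE.
  apply: (le_trans (lerD (bnd _ _ _) (bnd _ _ _))).
  rewrite -mulrDl ler_wpM2r ?lorentz_ge0// /S (bigD1 a)//= lerDl.
  by apply: sumr_ge0 => b _; rewrite addr_ge0 ?sqr_ge0.
Qed.

(** A class of functions that is stable under differentiation and under
    multiplication by polynomials, and that contains the coordinates of the
    waves of packets: whence the Schwartz property of the latter. *)
Definition gauss_trig (w a b : R) (P Q : {poly R}) (x : R) : R :=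
  (P.[x] * cos (w * x) + Q.[x] * sin (w * x)) * gauss (b + a * x).

Lemma der_gauss_trig (w a b : R) (P Q : {poly R}) (x : R) :
  is_derive x 1 (gauss_trig w a b P Q)
    (gauss_trig w a b (P^`() + w *: Q - (a *: (b%:P + a *: 'X)) * P)
       (Q^`() - w *: P - (a *: (b%:P + a *: 'X)) * Q) x).
Proof.
have dP := is_derive_poly P x; have dQ := is_derive_poly Q x.
have da : is_derive x 1 (fun x => b + a * x) a by der; ring.
have dg := der_comp _ _ _ x _ (der_gauss (b + a * x)) da.
rewrite /gauss_trig; der.
by rewrite !(hornerD, hornerN, hornerM, hornerZ, hornerC, hornerX); ring.
Qed.

Lemma derive1n_gauss_trig w a b P Q k : exists P' Q',
  derive1n k (gauss_trig w a b P Q) = gauss_trig w a b P' Q'.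
Proof.
elim: k => [|k [P' [Q' IH]]]; first by exists P, Q.
exists (P'^`() + w *: Q' - (a *: (b%:P + a *: 'X)) * P'),
  (Q'^`() - w *: P' - (a *: (b%:P + a *: 'X)) * Q').
rewrite derive1nS IH; apply/funext => x; rewrite derive1E.
by have d := der_gauss_trig w a b P' Q' x; exact: derive_val.
Qed.

Lemma horner_bound (P : {poly R}) :
  exists C, exists d : nat, 0 <= C /\ forall x, `|P.[x]| <= C * (1 + `|x|) ^+ d.
Proof.
elim/poly_ind: P => [|P c [C [d [C0 h]]]].
  by exists 0, 0%N; split => // x; rewrite horner0 normr0 mul0r.
exists (C + `|c|), d.+1; split; first by rewrite addr_ge0.
move=> x; rewrite hornerMXaddC (le_trans (ler_normD _ _))// mulrDl; apply: lerD.
  rewrite normrM exprS mulrCA mulrC; apply: ler_pM => //.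
  by rewrite lerDr.
by rewrite ler_peMr// exprn_ege1// lerDl.
Qed.

Lemma gauss_trig_bounded w a b P Q : 0 < a ->
  exists C, forall x, `|gauss_trig w a b P Q x| <= C.
Proof.
move=> a0; have [C [d [C0 hP]]] := horner_bound P.
have [C' [d' [C'0 hQ]]] := horner_bound Q.
pose D := maxn d d'.
have ai : 0 < a^-1 by rewrite invr_gt0.
pose c := 1 + a^-1 * (1 + `|b|).
exists ((C + C') * c ^+ D * expR ((D%:R + 2) ^+ 2 / 2)) => x.
set y := b + a * x.
have xy : 1 + `|x| <= c * (1 + `|y|).
  have -> : x = a^-1 * (y - b) by rewrite /y; field; rewrite gt_eqF.
  rewrite normrM [`|a^-1|]gtr0_norm//.
  have h1 := ler_wpM2l (ltW ai) (ler_normB y b).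
  have h2 : 0 <= a^-1 * (`|b| * `|y|) by rewrite !mulr_ge0// ltW.
  have h3 : 0 <= a^-1 by exact: ltW.
  rewrite /c; have := normr_ge0 y; nra.
have x1 : 1 <= 1 + `|x| by rewrite lerDl.
have sum_le : `|P.[x] * cos (w * x) + Q.[x] * sin (w * x)| <=
    (C + C') * (1 + `|x|) ^+ D.
  apply: (le_trans (ler_normD _ _)); rewrite mulrDl !normrM; apply: lerD.
  - apply: (@le_trans _ _ `|P.[x]|); first by rewrite ler_piMr// normr_cos_le1.
    apply: (le_trans (hP x)); rewrite ler_wpM2l// ler_weXn2l// leq_maxl//.
  - apply: (@le_trans _ _ `|Q.[x]|); first by rewrite ler_piMr// normr_sin_le1.
    apply: (le_trans (hQ x)); rewrite ler_wpM2l// ler_weXn2l// leq_maxr//.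
rewrite /gauss_trig normrM [`|gauss _|]ger0_norm ?gauss_ge0// -/y.
have l1 : lorentz y <= 1.
  exact: lorentz_le1.
apply: (@le_trans _ _ ((C + C') * c ^+ D * ((1 + `|y|) ^+ D * gauss y))).
  rewrite mulrA ler_wpM2r ?gauss_ge0//; apply: (le_trans sum_le).
  rewrite -mulrA -exprMn ler_wpM2l ?addr_ge0// lerXn2r// nnegrE.
  - by rewrite (le_trans ler01).
  - by rewrite (le_trans _ xy)// (le_trans ler01).
have c0 : 0 <= c by rewrite addr_ge0// mulr_ge0 ?ltW// addr_ge0.
rewrite ler_wpM2l//; first by rewrite mulr_ge0 ?addr_ge0// exprn_ge0.
by apply: (le_trans (powers_gauss_le _ _)); rewrite ler_piMr// expR_ge0.
Qed.

Lemma rschwartz_gauss_trig w a b P Q : 0 < a ->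
  rschwartz (gauss_trig w a b P Q).
Proof.
move=> a0; split=> [k x|j k].
  have [P' [Q' ->]] := derive1n_gauss_trig w a b P Q k.
  by case: (der_gauss_trig w a b P' Q' x).
have [P' [Q' ->]] := derive1n_gauss_trig w a b P Q k.
have [C hC] := gauss_trig_bounded w a b ('X^j * P') ('X^j * Q') a0.
exists C => x; apply: le_trans (hC x).
rewrite le_eqVlt; apply/orP; left; apply/eqP; congr (`|_|).
by rewrite /gauss_trig !hornerM !hornerXn; ring.
Qed.

Lemma schwartz_wave_packet n (e x0 xi0 : R) (al be : 'cV[R[i]]_n) : 0 < e ->
  schwartz (wave e x0 xi0 (packet al be)).
Proof.
move=> e0 a; have ei : 0 < e^-1 by rewrite invr_gt0.
pose w := xi0 / e ^+ 2.
(* The polynomial p + q y in the rescaled variable y = (x - x0) / e. *)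
pose P (p q : R) : {poly R} := (p - q * (x0 / e))%:P + (q / e) *: 'X.
split.
- rewrite (_ : (fun x => _) = gauss_trig w e^-1 (- (x0 / e))
    (P (Re (al a 0)) (Re (be a 0))) (- P (Im (al a 0)) (Im (be a 0)))).
    exact: rschwartz_gauss_trig.
  apply/funext => x; rewrite !mxE !ReImE /gauss_trig /P !(hornerD, hornerN, hornerM, hornerZ, hornerC, hornerX) /=.
  by rewrite -/w (mulrC x w); ring.
- rewrite (_ : (fun x => _) = gauss_trig w e^-1 (- (x0 / e))
    (P (Im (al a 0)) (Im (be a 0))) (P (Re (al a 0)) (Re (be a 0)))).
    exact: rschwartz_gauss_trig.
  apply/funext => x; rewrite !mxE !ReImE /gauss_trig /P !(hornerD, hornerN, hornerM, hornerZ, hornerC, hornerX) /=.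
  by rewrite -/w (mulrC x w); ring.
Qed.

End Packets.
Arguments packet {R n}.

(** * Pseudodifferential operators on packets *)

Section OperatorsOnPackets.
Local Open Scope classical_set_scope.
Context {R : realType}.
Local Notation leb := (@lebesgue_measure R).
Local Notation Re := complex.Re.
Local Notation Im := complex.Im.

Definition Ccvg (z_ : nat -> R[i]) (z : R[i]) : Prop :=
  Re (z_ k) @[k --> \oo] --> Re z /\ Im (z_ k) @[k --> \oo] --> Im z.

Lemma CcvgZ c z_ z : Ccvg z_ z -> Ccvg (fun k => c * z_ k) (c * z).
Proof.
move=> [h1 h2]; split.
- under eq_fun do rewrite ReM; rewrite ReM.
  by apply: cvgB; apply: cvgMr.
- under eq_fun do rewrite ImM; rewrite ImM.
  by apply: cvgD; apply: cvgMr.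
Qed.

Lemma CcvgD z_ z w_ w :
  Ccvg z_ z -> Ccvg w_ w -> Ccvg (fun k => z_ k + w_ k) (z + w).
Proof.
move=> [h1 h2] [h3 h4]; split.
- by under eq_fun do rewrite ReD; rewrite ReD; apply: cvgD.
- by under eq_fun do rewrite ImD; rewrite ImD; apply: cvgD.
Qed.

Lemma Ccvg_cst z : Ccvg (fun _ => z) z.
Proof. by split; exact: cvg_cst. Qed.

Lemma Ccvg_sum (I : finType) (z_ : I -> nat -> R[i]) (z : I -> R[i]) :
  (forall i, Ccvg (z_ i) (z i)) ->
  Ccvg (fun k => \sum_i z_ i k) (\sum_i z i).
Proof.
move=> h; suff H (s : seq I) :
    Ccvg (fun k => \sum_(i <- s) z_ i k) (\sum_(i <- s) z i).
  by have := H (index_enum I).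
elim: s => [|i s IH].
  rewrite (_ : (fun k => _) = fun=> 0) ?big_nil; first exact: Ccvg_cst.
  by apply/funext => k; rewrite big_nil.
rewrite (_ : (fun k => _) = fun k => z_ i k + \sum_(j <- s) z_ j k).
  by rewrite big_cons; exact: CcvgD.
by apply/funext => k; rewrite big_cons.
Qed.

Lemma sqnorm_lincomb_le (I : finType) (c : I -> R[i]) :
  exists C : R, 0 <= C /\ forall (z : I -> R[i]) t, 0 <= t ->
    (forall i, sqnorm (z i) <= t) -> sqnorm (\sum_i c i * z i) <= C * t.
Proof.
suff H (s : seq I) : exists C : R, 0 <= C /\ forall (z : I -> R[i]) t, 0 <= t ->
    (forall i, sqnorm (z i) <= t) -> sqnorm (\sum_(i <- s) c i * z i) <= C * t.
  by have := H (index_enum I).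
elim: s => [|i s [C [C0 IH]]].
  exists 0; split => // z t t0 _.
  by rewrite big_nil /sqnorm /= expr0n /= addr0 mul0r.
exists (2 * sqnorm (c i) + 2 * C); split.
  by rewrite addr_ge0 ?mulr_ge0 ?sqnorm_ge0.
move=> z t t0 zt; rewrite big_cons (le_trans (sqnormD_le _ _))//.
rewrite [leRHS](_ : _ = 2 * (sqnorm (c i) * t) + 2 * (C * t)); last by ring.
apply: lerD; rewrite ler_pM2l//; last exact: IH.
by rewrite sqnormM ler_wpM2l ?sqnorm_ge0.
Qed.

(** Decay like 1 / (1 + |X|) is enough for square-integrability. *)
Lemma lorentz_sqr_le (X a K : R) :
  (1 + `|X|) * `|a| <= K -> a ^+ 2 <= K ^+ 2 * lorentz X.
Proof.
move=> h; rewrite /lorentz ler_pdivlMr ?ltr_pwDl ?sqr_ge0//.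
have h0 : 0 <= (1 + `|X|) * `|a| by rewrite mulr_ge0// addr_ge0.
have := ler_pM h0 h0 h h; rewrite -expr2 => h2; rewrite [leRHS]expr2.
apply: le_trans h2; rewrite exprMn real_normK ?num_real// mulrC.
rewrite ler_wpM2r ?sqr_ge0// -[X ^+ 2]real_normK ?num_real//.
by have := normr_ge0 X; nra.
Qed.

Section Sequence.
Variables (m n : nat) (p : R -> R -> R -> 'M[R[i]]_(m, n)).
Variables (T : R -> @operator R m n) (e_ r_ d_ : nat -> R) (B : R).
Variables (s : R -> R -> 'M[R[i]]_(m, n)) (x0 xi0 : R).
Hypotheses (e_gt0 : forall k, 0 < e_ k) (e_le1 : forall k, e_ k <= 1)
  (cvg_e : e_ @ \oo --> (0 : R)) (r_neq0 : forall k, r_ k != 0)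
  (cvg_d : d_ @ \oo --> (0 : R)).
Hypothesis T_weyl : forall k, weyl_quantization (e_ k ^+ 2) p (T (e_ k ^+ 2)).
Hypothesis p_bounded : forall k a b,
  bounded_x2xi1 B (fun x xi => Re ((r_ k)%:C * p x xi (e_ k ^+ 2) a b)) /\
  bounded_x2xi1 B (fun x xi => Im ((r_ k)%:C * p x xi (e_ k ^+ 2) a b)).
Hypothesis s_continuous : forall a b,
  continuous (fun z : R * R => Re (s z.1 z.2 a b)) /\
  continuous (fun z : R * R => Im (s z.1 z.2 a b)).
Hypothesis p_near_s : forall k a b x xi,
  `|Re ((r_ k)%:C * p x xi (e_ k ^+ 2) a b) - Re (s x xi a b)| <= d_ k /\
  `|Im ((r_ k)%:C * p x xi (e_ k ^+ 2) a b) - Im (s x xi a b)| <= d_ k.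

(** Each coordinate of the rescaled image is a combination of integrals
    [osc2]; they converge pointwise by [cvg_osc2_symbol], and
    [osc2_symbol_le] dominates them in L^2. The scalars r_ serve to divide
    by h an operator whose principal symbol vanishes. *)
Lemma L2cvg_operator_packet (al : 'cV[R[i]]_n) :
  L2cvg (fun k X => (r_ k)%:C *:
      unwave (e_ k) x0 xi0 (T (e_ k ^+ 2) (wave (e_ k) x0 xi0 (packet al 0))) X)
    (packet (s x0 xi0 *m al) 0).
Proof.
have [K [K0 hK]] := @osc2_symbol_le R.
have he k : 0 <= e_ k <= 1 by rewrite ltW ?e_gt0 ?e_le1.
pose fr k a b x xi := Re ((r_ k)%:C * p x xi (e_ k ^+ 2) a b).
pose fi k a b x xi := Im ((r_ k)%:C * p x xi (e_ k ^+ 2) a b).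
pose A k a b X := symbol_gauss (fr k a b) (e_ k) x0 xi0 X.
pose A' k a b X := symbol_gauss (fi k a b) (e_ k) x0 xi0 X.
pose Z k a b X := (osc2 (A k a b X) X 0 - osc2 (A' k a b X) X (- (pi / 2))) +i*
                  (osc2 (A' k a b X) X 0 + osc2 (A k a b X) X (- (pi / 2))).
have hA k a b X th := hK B (fr k a b) (e_ k) x0 xi0 X th (he k) (p_bounded k a b).1.
have hA' k a b X th := hK B (fi k a b) (e_ k) x0 xi0 X th (he k) (p_bounded k a b).2.
have step k a X b : let F xi y := expi ((X - y) * xi) *
    (p (x0 + e_ k * ((X + y) / 2)) (xi0 + e_ k * xi) (e_ k ^+ 2) a b *
     packet al 0 y b 0) in
    csummable2 F /\ (r_ k)%:C * cintegral2 F = al b 0 * Z k a b X.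
  have [c1 c2] := cintegral2_osc _ X _ _ (hA k a b X 0).1 (hA' k a b X 0).1.
  have [c3 c4] := cintegral2Z (((r_ k)^-1)%:C * al b 0) _ c1.
  (* The bounds concern r_ k times the symbol, whence the factor (r_ k)^-1. *)
  move=> F; have FE : F = fun xi y => ((r_ k)^-1)%:C * al b 0 *
      (expi ((X - y) * xi) * (A k a b X y xi +i* A' k a b X y xi)).
    apply/funext => xi; apply/funext => y; rewrite /F.
    have -> : A k a b X y xi +i* A' k a b X y xi = (r_ k)%:C *
        (p (x0 + e_ k * ((X + y) / 2)) (xi0 + e_ k * xi) (e_ k ^+ 2) a b) *
        (gauss y)%:C.
      apply: eqC; rewrite [RHS]ReImE /= !mulr0 ?subr0 ?addr0//.
      by rewrite add0r.
    have -> : packet al 0 y b 0 = (gauss y)%:C * al b 0.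
      by rewrite !mxE mulr0 addr0.
    have rr : ((r_ k)^-1)%:C * (r_ k)%:C = 1 :> R[i].
      by rewrite -rmorphM /= mulVf.
    set q := p _ _ _ a b; set g := (gauss y)%:C; set ex := expi _.
    rewrite -[LHS]mul1r -rr; ring.
  rewrite FE; split; first exact: c3.
  by rewrite c4 c2 !mulrA -rmorphM /= divff// mul1r.
have ptE k a X : (r_ k)%:C *
    unwave (e_ k) x0 xi0 (weyl (e_ k ^+ 2) p (wave (e_ k) x0 xi0 (packet al 0))) X a 0 =
    ((2 * pi)^-1)%:C * \sum_b al b 0 * Z k a b X.
  rewrite (weyl_wave (e_ k) x0 xi0 (e_gt0 k)); last first.
    by move=> a' b; exact: (step k a' X b).1.
  rewrite mxE mulrCA; congr (_ * _); rewrite big_distrr; apply: eq_bigr => b _.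
  exact: (step k a X b).2.
have Zcvg a b X : Ccvg (fun k => Z k a b X)
    (s x0 xi0 a b * (2 * pi * gauss X)%:C).
  have [cs1 cs2] := s_continuous a b.
  have c1 th : osc2 (A k a b X) X th @[k --> \oo] -->
      Re (s x0 xi0 a b) * (2 * pi * cos th * gauss X).
    apply: (cvg_osc2_symbol B (fun k => fr k a b)
      (fun x xi => Re (s x xi a b)) e_ d_) => //.
    - by move=> k; exact: (p_bounded k a b).1.
    - by move=> k x xi; exact: (p_near_s k a b x xi).1.
  have c2 th : osc2 (A' k a b X) X th @[k --> \oo] -->
      Im (s x0 xi0 a b) * (2 * pi * cos th * gauss X).
    apply: (cvg_osc2_symbol B (fun k => fi k a b)
      (fun x xi => Im (s x xi a b)) e_ d_) => //.
    - by move=> k; exact: (p_bounded k a b).2.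
    - by move=> k x xi; exact: (p_near_s k a b x xi).2.
  split.
  - rewrite [X in _ --> X](_ : _ = Re (s x0 xi0 a b) * (2 * pi * cos 0 * gauss X) -
      Im (s x0 xi0 a b) * (2 * pi * cos (- (pi / 2)) * gauss X)).
      by apply: cvgB; [exact: c1|exact: c2].
    by rewrite ReM /= cosN cos_pihalf cos0; ring.
  - rewrite [X in _ --> X](_ : _ = Im (s x0 xi0 a b) * (2 * pi * cos 0 * gauss X) +
      Re (s x0 xi0 a b) * (2 * pi * cos (- (pi / 2)) * gauss X)).
      by apply: cvgD; [exact: c2|exact: c1].
    by rewrite ImM /= cosN cos_pihalf cos0; ring.
have Zle k a b X : sqnorm (Z k a b X) <= 8 * (K * B) ^+ 2 * lorentz X.
  have z1 th := lorentz_sqr_le _ _ _ (hA k a b X th).2.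
  have z2 th := lorentz_sqr_le _ _ _ (hA' k a b X th).2.
  rewrite /sqnorm /=.
  have q1 := z1 0; have q2 := z1 (- (pi / 2)).
  have q3 := z2 0; have q4 := z2 (- (pi / 2)).
  rewrite -/(A k a b X) in q1 q2; rewrite -/(A' k a b X) in q3 q4.
  move: q1 q2 q3 q4.
  move: (osc2 (A k a b X) X 0) (osc2 (A k a b X) X (- (pi / 2)))
    (osc2 (A' k a b X) X 0) (osc2 (A' k a b X) X (- (pi / 2))).
  move=> u v w t q1 q2 q3 q4; set bb := (K * B) ^+ 2 * lorentz X in q1 q2 q3 q4.
  rewrite -mulrA -/bb.
  by have := sqr_ge0 (u + t); have := sqr_ge0 (w - v); lra.
have [C [C0 hC]] := sqnorm_lincomb_le _ (fun b => ((2 * pi)^-1)%:C * al b 0).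
have Lw k : L2 (wave (e_ k) x0 xi0 (packet al 0)).
  apply: L2_twist; last exact: L2_packet.
  - by cont.
  - by rewrite invr_gt0.
have aeE : {ae leb, forall X, forall k a,
    ((r_ k)%:C *: unwave (e_ k) x0 xi0
       (T (e_ k ^+ 2) (wave (e_ k) x0 xi0 (packet al 0))) X) a 0 =
    ((2 * pi)^-1)%:C * \sum_b al b 0 * Z k a b X}.
  apply: ae_foralln => k.
  have [_ /(_ _ (schwartz_wave_packet n (e_ k) x0 xi0 al 0 (e_gt0 k))) h] :=
    T_weyl k.
  apply: (ae_imply _ _ _ (eqae_twist
    (fun X => - ((x0 + e_ k * X) * (xi0 / e_ k ^+ 2))) (e_ k) x0 (e_gt0 k) _ _ _ h)).
  by move=> X hX a; rewrite mxE -ptE -[RHS]/((r_ k)%:C * _); congr (_ * _);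
    exact: (congr1 (fun M : 'cV_m => M a 0) hX).
have sumE k a X : ((2 * pi)^-1)%:C * (\sum_b al b 0 * Z k a b X) =
    \sum_b (((2 * pi)^-1)%:C * al b 0) * Z k a b X.
  by rewrite big_distrr; apply: eq_bigr => b _ /=; rewrite mulrA.
apply: (L2cvg_dominated _ _ _ (fun X => C * (8 * (K * B) ^+ 2 * lorentz X))).
- move=> k; apply: L2Z; apply: L2_twist => //; first by cont.
  by have [[h _ _] _] := T_weyl k; exact: h.
- exact: L2_packet.
- by do 2 apply: summableZ; exact: summable_lorentz.
- apply: ae_imply aeE => X hX k a; rewrite hX sumE; apply: hC => //.
  by rewrite mulr_ge0 ?lorentz_ge0// mulr_ge0// sqr_ge0.
- apply: ae_imply aeE => X hX a.
  rewrite -[_ /\ _]/(Ccvg (fun k => _) _).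
  rewrite (_ : (fun k => _) = fun k =>
      \sum_b (((2 * pi)^-1)%:C * al b 0) * Z k a b X); last first.
    by apply/funext => k; rewrite hX sumE.
  rewrite (_ : packet _ _ X a 0 = \sum_b (((2 * pi)^-1)%:C * al b 0) *
      (s x0 xi0 a b * (2 * pi * gauss X)%:C)).
    by apply: Ccvg_sum => b; apply: CcvgZ.
  rewrite !mxE mulr0 addr0 big_distrr; apply: eq_bigr => b _ /=.
  have pp : ((2 * pi)^-1)%:C * (2 * pi)%:C = 1 :> R[i].
    by rewrite -rmorphM /= mulVf// mulf_neq0// gt_eqF ?pi_gt0.
  rewrite [(2 * pi * _)%:C]rmorphM -[LHS]mul1r -pp /=; ring.
Qed.

End Sequence.
End OperatorsOnPackets.

(** * Second-order expansions in the scale *)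

Section Expansions.
Local Open Scope classical_set_scope.
Context {R : realType}.
Local Notation Re := complex.Re.
Local Notation Im := complex.Im.
Implicit Types (z : R).

(** Applied repeatedly to Taylor remainders, each of which is the derivative
    of the next one up to sign, this gives all the elementary bounds below. *)
Lemma MVT0_bound (f f' : R -> R) (M z : R) :
  (forall y : R, is_derive y 1 f (f' y)) -> f 0 = 0 ->
  (forall y, `|y| <= `|z| -> `|f' y| <= M) -> `|f z| <= M * `|z|.
Proof.
move=> df f0 bf'.
have cf a b : {within `[a, b], continuous f}.
  by apply: continuous_subspaceT; exact: continuous_is_derive df.
have [z0|z0|<-] := ltgtP 0 z; last by rewrite f0 !normr0 mulr0.
- have [c /[!in_itv]/= /andP[c0 cz]] := MVT z0 (fun y _ => df y) (cf 0 z).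
  rewrite f0 !subr0 => ->; rewrite normrM ler_wpM2r// bf'//.
  by rewrite !gtr0_norm// ltW.
- have [c /[!in_itv]/= /andP[c0 cz]] := MVT z0 (fun y _ => df y) (cf z 0).
  rewrite f0 !sub0r => /eqP; rewrite eqr_oppLR => /eqP ->.
  rewrite normrN normrM normrN ler_wpM2r// bf'//.
  by rewrite !ltr0_norm// lerN2 ltW.
Qed.

Lemma sin_bound z : `|sin z| <= `|z|.
Proof.
rewrite -[leRHS]mul1r.
exact: (MVT0_bound sin cos 1 z (@is_derive_sin R) (@sin0 R)
  (fun y _ => normr_cos_le1 y)).
Qed.

Lemma cos1_bound z : `|cos z - 1| <= `|z| ^+ 2.
Proof.
have d (y : R) : is_derive y 1 (fun z => cos z - 1) (- sin y) by der; ring.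
rewrite expr2; apply: (MVT0_bound _ _ _ _ d).
- by rewrite cos0 subrr.
- by move=> y yz; rewrite normrN (le_trans (sin_bound y)).
Qed.

Lemma sin1_bound z : `|sin z - z| <= `|z| ^+ 3.
Proof.
have d (y : R) : is_derive y 1 (fun z => sin z - z) (cos y - 1) by der; ring.
rewrite [leRHS]exprSr; apply: (MVT0_bound _ _ _ _ d).
- by rewrite sin0 subr0.
- by move=> y yz; rewrite (le_trans (cos1_bound y))// lerXn2r.
Qed.

Lemma cos2_bound z : `|cos z - 1 + z ^+ 2 / 2| <= `|z| ^+ 4.
Proof.
have d (y : R) : is_derive y 1 (fun z => cos z - 1 + z ^+ 2 / 2)
    (- (sin y - y)).
  rewrite (_ : (fun z => _) = (fun z => cos z - 1 + z * z / 2)).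
    by der; field.
  by apply/funext => w; rewrite expr2.
rewrite [leRHS]exprSr; apply: (MVT0_bound _ _ _ _ d).
- by rewrite cos0 subrr expr0n /= mul0r addr0.
- by move=> y yz; rewrite normrN (le_trans (sin1_bound y))// lerXn2r.
Qed.

Lemma expR2_bound z : `|expR z - 1 - z - z ^+ 2 / 2| <= `|z| ^+ 3 * expR `|z|.
Proof.
have e0 y : `|y| <= `|z| -> `|expR y| <= expR `|z|.
  move=> yz; rewrite ger0_norm ?expR_ge0// ler_expR.
  by apply: le_trans yz; exact: ler_norm.
have e1 y : `|y| <= `|z| -> `|expR y - 1| <= expR `|z| * `|z|.
  move=> yz; apply: (@le_trans _ _ (expR `|z| * `|y|)); last first.
    by rewrite ler_wpM2l ?expR_ge0.
  have d (w : R) : is_derive w 1 (fun y => expR y - 1) (expR w) by der; ring.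
  apply: (MVT0_bound _ _ _ _ d).
  - by rewrite expR0 subrr.
  - by move=> w wy; apply: e0; exact: le_trans yz.
have e2 y : `|y| <= `|z| -> `|expR y - 1 - y| <= expR `|z| * `|z| * `|z|.
  move=> yz; apply: (@le_trans _ _ (expR `|z| * `|z| * `|y|)); last first.
    by rewrite ler_wpM2l// mulr_ge0 ?expR_ge0.
  have d (w : R) : is_derive w 1 (fun y => expR y - 1 - y) (expR w - 1).
    by der; ring.
  apply: (MVT0_bound _ _ _ _ d).
  - by rewrite expR0 subrr subr0.
  - by move=> w wy; apply: e1; exact: le_trans yz.
rewrite (_ : `|z| ^+ 3 * _ = expR `|z| * `|z| * `|z| * `|z|); last by ring.
have d (y : R) : is_derive y 1 (fun z => expR z - 1 - z - z ^+ 2 / 2)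
    (expR y - 1 - y).
  rewrite (_ : (fun z => _) = (fun z => expR z - 1 - z - z * z / 2)).
    by der; field.
  by apply/funext => w; rewrite expr2.
apply: (MVT0_bound _ _ _ _ d).
- by rewrite expR0 subrr expr0n /= mul0r !subr0.
- by move=> y yz; exact: e2.
Qed.

(** What a Gaussian factor turns into a uniform L^2 bound; being uniform in
    e, it also controls remainders. *)
Definition expgrowth (g : R -> R -> R[i]) : Prop :=
  exists (C : R) (n : nat), 0 <= C /\ forall e X, 0 <= e <= 1 ->
  `|Re (g e X)| <= C * expR (n%:R * `|X|) /\
  `|Im (g e X)| <= C * expR (n%:R * `|X|).

Lemma expR_mono (n m : nat) (X : R) :
  (n <= m)%N -> expR (n%:R * `|X|) <= expR (m%:R * `|X|).
Proof. by move=> nm; rewrite ler_expR ler_wpM2r// ler_nat. Qed.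

Lemma expgrowthD f g :
  expgrowth f -> expgrowth g -> expgrowth (fun e X => f e X + g e X).
Proof.
move=> [C [n [C0 hf]]] [D [m [D0 hg]]].
exists (C + D), (maxn n m); split; first exact: addr_ge0.
move=> e X he; have [f1 f2] := hf e X he; have [g1 g2] := hg e X he.
have h1 := ler_wpM2l C0 (expR_mono n (maxn n m) X (leq_maxl _ _)).
have h2 := ler_wpM2l D0 (expR_mono m (maxn n m) X (leq_maxr _ _)).
rewrite ReD ImD mulrDl; split; apply: (le_trans (ler_normD _ _));
  apply: lerD; by [apply: le_trans h1|apply: le_trans h2].
Qed.

Lemma expgrowthM f g :
  expgrowth f -> expgrowth g -> expgrowth (fun e X => f e X * g e X).
Proof.
move=> [C [n [C0 hf]]] [D [m [D0 hg]]].
exists (2 * (C * D)), (n + m)%N; split; first by rewrite !mulr_ge0.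
move=> e X he; have [f1 f2] := hf e X he; have [g1 g2] := hg e X he.
have pm (u v : R) : `|u| <= C * expR (n%:R * `|X|) ->
    `|v| <= D * expR (m%:R * `|X|) ->
    `|u * v| <= C * D * expR ((n + m)%:R * `|X|).
  move=> hu hv; rewrite natrD mulrDl expRD normrM mulrACA; exact: ler_pM.
rewrite ReM ImM -mulrA mulr_natl mulr2n; split.
- by apply: (le_trans (ler_normB _ _)); apply: lerD; exact: pm.
- by apply: (le_trans (ler_normD _ _)); apply: lerD; exact: pm.
Qed.

Lemma expgrowth_cst (c : R[i]) : expgrowth (fun _ _ => c).
Proof.
exists (`|Re c| + `|Im c|), 0%N; split; first exact: addr_ge0.
by move=> e X _; rewrite mul0r expR0 mulr1 lerDl lerDr.
Qed.

Lemma expgrowth_param : expgrowth (fun e _ => e%:C).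
Proof.
exists 1, 0%N; split => // e X /andP[e0 e1].
by rewrite mul0r expR0 mulr1 /= normr0 ger0_norm.
Qed.

Lemma expgrowth_var : expgrowth (fun _ X => X%:C).
Proof.
exists 1, 1%N; split => // e X _; rewrite !mul1r /= normr0 expR_ge0; split => //.
by apply: le_trans (expR_ge1Dx _); rewrite lerDr.
Qed.

(** Taylor expansions in e to second order. Exponential growth, rather than
    a polynomial one, accommodates the factors exp(e X t) and is stable
    under products. *)
Definition expansion2 (f : R -> R -> R[i]) (f0 f1 f2 : R -> R[i]) : Prop :=
  [/\ expgrowth (fun _ => f0), expgrowth (fun _ => f1), expgrowth (fun _ => f2) &
   exists r, expgrowth r /\ forall e X, 0 <= e <= 1 ->
     f e X = f0 X + e%:C * f1 X + e%:C ^+ 2 * f2 X + e%:C ^+ 3 * r e X].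

Lemma expansion2D f f0 f1 f2 g g0 g1 g2 :
  expansion2 f f0 f1 f2 -> expansion2 g g0 g1 g2 ->
  expansion2 (fun e X => f e X + g e X) (fun X => f0 X + g0 X)
    (fun X => f1 X + g1 X) (fun X => f2 X + g2 X).
Proof.
move=> [F0 F1 F2 [r [hr Ef]]] [G0 G1 G2 [s [hs Eg]]].
split; try exact: expgrowthD.
exists (fun e X => r e X + s e X); split; first exact: expgrowthD.
by move=> e X he; rewrite Ef// Eg//; ring.
Qed.

Lemma expansion2M f f0 f1 f2 g g0 g1 g2 :
  expansion2 f f0 f1 f2 -> expansion2 g g0 g1 g2 ->
  expansion2 (fun e X => f e X * g e X) (fun X => f0 X * g0 X)
    (fun X => f0 X * g1 X + f1 X * g0 X)
    (fun X => f0 X * g2 X + f1 X * g1 X + f2 X * g0 X).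
Proof.
move=> [F0 F1 F2 [r [hr Ef]]] [G0 G1 G2 [s [hs Eg]]].
have he := expgrowth_param.
split; try by repeat first [assumption | apply: expgrowthD | apply: expgrowthM].
exists (fun e X => f0 X * s e X + f1 X * g2 X + e%:C * (f1 X * s e X) +
   f2 X * g1 X + e%:C * (f2 X * g2 X) + e%:C * e%:C * (f2 X * s e X) +
   r e X * (g0 X + e%:C * g1 X + e%:C * e%:C * g2 X + e%:C * e%:C * e%:C * s e X)).
split; first by repeat first [assumption | apply: expgrowthD | apply: expgrowthM].
by move=> e X h; rewrite Ef// Eg//; ring.
Qed.

Lemma expansion2_cst c : expansion2 (fun _ _ => c) (fun _ => c) (fun _ => 0) (fun _ => 0).
Proof.
have h0 := expgrowth_cst 0.
split=> //; first exact: expgrowth_cst.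
by exists (fun _ _ => 0); split => // e X _; ring.
Qed.

(** For e > 0 the remainder is the difference divided by e^3; at e = 0 the
    estimate forces the difference to vanish. *)
Lemma expansion2_intro f f0 f1 f2 (C : R) (n : nat) : 0 <= C ->
  expgrowth (fun _ => f0) -> expgrowth (fun _ => f1) -> expgrowth (fun _ => f2) ->
  (forall e X, 0 <= e <= 1 ->
    `|Re (f e X - (f0 X + e%:C * f1 X + e%:C ^+ 2 * f2 X))| <=
      e ^+ 3 * (C * expR (n%:R * `|X|)) /\
    `|Im (f e X - (f0 X + e%:C * f1 X + e%:C ^+ 2 * f2 X))| <=
      e ^+ 3 * (C * expR (n%:R * `|X|))) ->
  expansion2 f f0 f1 f2.
Proof.
move=> C0 F0 F1 F2 h; split => //.
pose d e X := f e X - (f0 X + e%:C * f1 X + e%:C ^+ 2 * f2 X).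
exists (fun e X => ((e ^+ 3)^-1)%:C * d e X); split.
- exists C, n; split => // e X he; have [h1 h2] := h e X he.
  have e0 : 0 <= e by case/andP: he.
  have W0 : 0 <= C * expR (n%:R * `|X|) by rewrite mulr_ge0 ?expR_ge0.
  have [->|en] := eqVneq e 0.
    by rewrite expr0n /= invr0 mul0r /= normr0.
  have e3 : 0 < e ^+ 3 by rewrite exprn_gt0// lt_def en.
  have sc (v w : R) : `|v| <= e ^+ 3 * w -> `|(e ^+ 3)^-1 * v| <= w.
    by move=> vw; rewrite normrM gtr0_norm ?invr_gt0// ler_pdivrMl.
  by rewrite ReM ImM /= !mul0r subr0 addr0; split; exact: sc.
- move=> e X he; have [h1 h2] := h e X he.
  have [e0|en] := eqVneq e 0.
    have z3 (w : R) : e ^+ 3 * w <= 0 by rewrite e0 expr0n mul0r.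
    have d0 : d e X = 0.
      by apply: eqC; apply/eqP; rewrite -normr_le0 /d;
        [apply: le_trans h1 _|apply: le_trans h2 _].
    by move/eqP: d0; rewrite subr_eq0 => /eqP ->; rewrite e0; ring.
  have e3 : e ^+ 3 != 0 by rewrite expf_neq0.
  rewrite mulrA -[e%:C ^+ 3]rmorphXn -rmorphM /= mulfV// mul1r /d; ring.
Qed.

End Expansions.

Section TranslatedPackets.
Local Open Scope classical_set_scope.
Context {R : realType}.
Local Notation Re := complex.Re.
Local Notation Im := complex.Im.

Lemma ler_norm_expR (X : R) (n : nat) : `|X| ^+ n <= expR (n%:R * `|X|).
Proof.
rewrite mulrC expRM_natr lerXn2r ?nnegrE ?expR_ge0//.
by apply: le_trans (expR_ge1Dx _); rewrite lerDr.
Qed.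

Lemma expgrowth_powers (c0 c1 c2 : R[i]) :
  expgrowth (fun _ X => c0 + c1 * X%:C + c2 * (X%:C * X%:C)).
Proof.
have hc c := @expgrowth_cst R c; have hX := @expgrowth_var R.
by repeat first [apply: hc | apply: hX | apply: expgrowthD | apply: expgrowthM].
Qed.

Lemma expgrowth_eq (f g : R -> R -> R[i]) :
  (forall e X, f e X = g e X) -> expgrowth f -> expgrowth g.
Proof.
move=> fg [C [n [C0 h]]]; exists C, n; split => // e X he.
by rewrite -fg; exact: h.
Qed.

Lemma expgrowth_poly (c0 c1 c2 : R[i]) (f : R -> R[i]) :
  (forall X, f X = c0 + c1 * X%:C + c2 * (X%:C * X%:C)) ->
  expgrowth (fun _ => f).
Proof.
by move=> fE; apply: (expgrowth_eq _ _ _ (expgrowth_powers c0 c1 c2)) => _ X.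
Qed.

Lemma exp3_le1 (e : R) (n : nat) : 0 <= e <= 1 -> (3 <= n)%N -> e ^+ n <= e ^+ 3.
Proof. by move=> /andP[e0 e1] n3; exact: ler_wiXn2l. Qed.

Lemma expansion2_expi_linear (t : R) :
  expansion2 (fun e X => expi (e * (t * X))) (fun _ => 1)
    (fun X => 'i * t%:C * X%:C)
    (fun X => - (t ^+ 2 / 2)%:C * (X%:C * X%:C)).
Proof.
apply: (expansion2_intro _ _ _ _ (`|t| ^+ 3 + `|t| ^+ 4) 4%N).
- by rewrite addr_ge0// exprn_ge0.
- by apply: (expgrowth_poly 1 0 0) => X; ring.
- by apply: (expgrowth_poly 0 ('i * t%:C) 0) => X; ring.
- by apply: (expgrowth_poly 0 0 (- (t ^+ 2 / 2)%:C)) => X; ring.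
move=> e X he; have e0 : 0 <= e by case/andP: he.
have W3 := ler_norm_expR X 3.
have W34 : expR (3%:R * `|X|) <= expR (4%:R * `|X|) by apply: expR_mono.
have W4 := ler_norm_expR X 4.
set W := expR (4%:R * `|X|) in W34 W4 *.
have e43 := exp3_le1 e 4 he isT.
have bnd (n : nat) : (3 <= n)%N -> `|X| ^+ n <= W ->
    `|e * (t * X)| ^+ n <= e ^+ 3 * (`|t| ^+ n * W).
  move=> n3 hW; rewrite !normrM (ger0_norm e0) !exprMn.
  apply: ler_pM; rewrite ?exprn_ge0 ?mulr_ge0 ?exprn_ge0//.
    exact: exp3_le1.
  by apply: ler_wpM2l => //; rewrite exprn_ge0.
have b3 := bnd 3%N isT (le_trans W3 W34); have b4 := bnd 4%N isT W4.
have p3 : 0 <= e ^+ 3 * (`|t| ^+ 3 * W).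
  by apply: le_trans b3; rewrite exprn_ge0.
have p4 : 0 <= e ^+ 3 * (`|t| ^+ 4 * W).
  by apply: le_trans b4; rewrite exprn_ge0.
rewrite mulrDl mulrDr; split.
- rewrite (_ : Re _ = cos (e * (t * X)) - 1 + (e * (t * X)) ^+ 2 / 2); last first.
    by rewrite !expr2 !ReImE /=; field.
  by apply: (le_trans (cos2_bound _)); apply: (le_trans b4); rewrite lerDr.
- rewrite (_ : Im _ = sin (e * (t * X)) - e * (t * X)); last first.
    by rewrite !expr2 !ReImE /=; ring.
  by apply: (le_trans (sin1_bound _)); apply: (le_trans b3); rewrite lerDl.
Qed.

Lemma expansion2_expi_square (t : R) :
  expansion2 (fun e X => expi (e ^+ 2 * t)) (fun _ => 1) (fun _ => 0)
    (fun _ => 'i * t%:C).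
Proof.
apply: (expansion2_intro _ _ _ _ (`|t| ^+ 2 + `|t| ^+ 3) 0%N).
- by rewrite addr_ge0// exprn_ge0.
- by apply: (expgrowth_poly 1 0 0) => X; ring.
- by apply: (expgrowth_poly 0 0 0) => X; ring.
- by apply: (expgrowth_poly ('i * t%:C) 0 0) => X; ring.
move=> e X he; have e0 : 0 <= e by case/andP: he.
rewrite mul0r expR0 mulr1 mulrDr.
have bnd (n : nat) : (2 <= n)%N ->
    `|e ^+ 2 * t| ^+ n <= e ^+ 3 * `|t| ^+ n.
  move=> n2; rewrite normrM ger0_norm ?exprn_ge0// exprMn -exprM.
  rewrite ler_wpM2r ?exprn_ge0//; apply: exp3_le1 => //.
  by case: n n2 => [|[|n]]// _; rewrite mulnC !mulSn.
have b2 := bnd 2%N isT; have b3 := bnd 3%N isT.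
split.
- rewrite (_ : Re _ = cos (e ^+ 2 * t) - 1); last first.
    by rewrite !expr2 !ReImE /=; ring.
  apply: (le_trans (cos1_bound _)); apply: (le_trans b2); rewrite lerDl.
  by rewrite mulr_ge0// exprn_ge0.
- rewrite (_ : Im _ = sin (e ^+ 2 * t) - e ^+ 2 * t); last first.
    by rewrite !expr2 !ReImE /=; ring.
  apply: (le_trans (sin1_bound _)); apply: (le_trans b3); rewrite lerDr.
  by rewrite mulr_ge0// exprn_ge0.
Qed.

Lemma expansion2_expR_linear (t : R) :
  expansion2 (fun e X => (expR (e * (t * X)))%:C) (fun _ => 1)
    (fun X => t%:C * X%:C)
    (fun X => (t ^+ 2 / 2)%:C * (X%:C * X%:C)).
Proof.
pose n := (Num.truncn `|t|).+1.
have tn : `|t| <= n%:R by exact: ltW (truncnS_gt _).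
apply: (expansion2_intro _ _ _ _ (`|t| ^+ 3) (3 + n)%N).
- by rewrite exprn_ge0.
- by apply: (expgrowth_poly 1 0 0) => X; ring.
- by apply: (expgrowth_poly 0 t%:C 0) => X; ring.
- by apply: (expgrowth_poly 0 0 (t ^+ 2 / 2)%:C) => X; ring.
move=> e X he; have [e0 e1] := andP he.
have W3 := ler_norm_expR X 3.
split; last first.
  rewrite (_ : Im _ = 0); last by rewrite !expr2 !ReImE /=; ring.
  by rewrite normr0 !mulr_ge0 ?exprn_ge0 ?expR_ge0.
rewrite (_ : Re _ = expR (e * (t * X)) - 1 - e * (t * X) -
    (e * (t * X)) ^+ 2 / 2); last first.
  by rewrite !expr2 !ReImE /=; field.
apply: (le_trans (expR2_bound _)).
rewrite !normrM (ger0_norm e0) !exprMn.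
rewrite [leLHS](_ : _ = e ^+ 3 * (`|t| ^+ 3 *
  (`|X| ^+ 3 * expR (e * (`|t| * `|X|))))); last by ring.
rewrite ler_wpM2l ?exprn_ge0//.
rewrite ler_wpM2l ?exprn_ge0// natrD mulrDl expRD.
apply: ler_pM; [exact: exprn_ge0|exact: expR_ge0|exact: W3|rewrite ler_expR].
by rewrite mulrA; apply: ler_pM; rewrite ?mulr_ge0//; apply: le_trans tn; rewrite ler_piMl.
Qed.

Lemma expansion2_expR_square (t : R) :
  expansion2 (fun e X => (expR (e ^+ 2 * t))%:C) (fun _ => 1) (fun _ => 0)
    (fun _ => t%:C).
Proof.
apply: (expansion2_intro _ _ _ _ (t ^+ 2 / 2 + `|t| ^+ 3 * expR `|t|) 0%N).
- by rewrite addr_ge0 ?divr_ge0 ?sqr_ge0// mulr_ge0 ?exprn_ge0 ?expR_ge0.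
- by apply: (expgrowth_poly 1 0 0) => X; ring.
- by apply: (expgrowth_poly 0 0 0) => X; ring.
- by apply: (expgrowth_poly t%:C 0 0) => X; ring.
move=> e X he; have [e0 e1] := andP he.
rewrite mul0r expR0 mulr1; split; last first.
  rewrite (_ : Im _ = 0); last by rewrite !expr2 !ReImE /=; ring.
  rewrite normr0; apply: mulr_ge0; first exact: exprn_ge0.
  apply: addr_ge0; first by rewrite divr_ge0 ?sqr_ge0.
  by apply: mulr_ge0; [exact: exprn_ge0|exact: expR_ge0].
set z := e ^+ 2 * t.
rewrite (_ : Re _ = (expR z - 1 - z - z ^+ 2 / 2) + z ^+ 2 / 2); last first.
  by rewrite /z !expr2 !ReImE /=; field.
apply: (le_trans (ler_normD _ _)); rewrite addrC mulrDr; apply: lerD.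
  rewrite ger0_norm ?divr_ge0 ?sqr_ge0// mulrA ler_pM2r ?invr_gt0//.
  rewrite /z exprMn -exprM ler_wpM2r ?sqr_ge0//; exact: exp3_le1.
apply: (le_trans (expR2_bound _)); rewrite mulrA.
have zt : `|z| <= `|t|.
  by rewrite /z normrM ger0_norm ?exprn_ge0// ler_piMl// exprn_ile1.
apply: ler_pM; rewrite ?exprn_ge0 ?expR_ge0 ?ler_expR//.
rewrite /z normrM ger0_norm ?exprn_ge0// exprMn -exprM.
by rewrite ler_wpM2r ?exprn_ge0//; exact: exp3_le1.
Qed.

Lemma expansion2_eq (f g : R -> R -> R[i]) f0 f1 f2 g0 g1 g2 :
  (forall e X, f e X = g e X) -> (forall X, f0 X = g0 X) ->
  (forall X, f1 X = g1 X) -> (forall X, f2 X = g2 X) ->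
  expansion2 f f0 f1 f2 -> expansion2 g g0 g1 g2.
Proof.
move=> fg /funext <- /funext <- /funext <- [F0 F1 F2 [r [hr E]]].
by split => //; exists r; split => // e X he; rewrite -fg E.
Qed.

Lemma expansion2_sum (I : finType) (f : I -> R -> R -> R[i])
    (f0 f1 f2 : I -> R -> R[i]) :
  (forall i, expansion2 (f i) (f0 i) (f1 i) (f2 i)) ->
  expansion2 (fun e X => \sum_i f i e X) (fun X => \sum_i f0 i X)
    (fun X => \sum_i f1 i X) (fun X => \sum_i f2 i X).
Proof.
move=> h; suff H (s : seq I) : expansion2 (fun e X => \sum_(i <- s) f i e X)
    (fun X => \sum_(i <- s) f0 i X) (fun X => \sum_(i <- s) f1 i X)
    (fun X => \sum_(i <- s) f2 i X).
  by have := H (index_enum I).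
elim: s => [|i s IH].
  by apply: (expansion2_eq _ _ _ _ _ _ _ _ _ _ _ _ (expansion2_cst 0)) => *;
    rewrite big_nil.
apply: (expansion2_eq _ _ _ _ _ _ _ _ _ _ _ _ (expansion2D _ _ _ _ _ _ _ _ (h i) IH));
  by move=> *; rewrite big_cons.
Qed.

Lemma expansion2_affine (k c d : R[i]) :
  expansion2 (fun e X => k + e%:C * (c * X%:C) + e%:C ^+ 2 * d)
    (fun _ => k) (fun X => c * X%:C) (fun _ => d).
Proof.
split.
- by apply: (expgrowth_poly k 0 0) => X; ring.
- by apply: (expgrowth_poly 0 c 0) => X; ring.
- by apply: (expgrowth_poly d 0 0) => X; ring.
exists (fun _ _ => 0); split; first exact: expgrowth_cst.
by move=> e X _; ring.
Qed.

(** The image of the packet of amplitude k + e c y under the quantization of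
    the plane wave exp(i (a x + b xi)) times exp(i sg h / 8), divided by the
    Gaussian and by the value of the plane wave at (x0, xi0). *)
Definition moved (a b sg : R) (k c : R[i]) (e X : R) : R[i] :=
  expi (e * (a * X)) * expi (e ^+ 2 * (sg / 8 + a * b / 2)) *
  (expR (e * (- b * X)))%:C * (expR (e ^+ 2 * - (b ^+ 2 / 2)))%:C *
  (k + e%:C * (c * X%:C) + e%:C ^+ 2 * (b%:C * c)).

Lemma expansion2_moved a b sg k c :
  expansion2 (moved a b sg k c) (fun _ => k)
    (fun X => (('i * a%:C - b%:C) * k + c) * X%:C)
    (fun X => ('i * (sg / 8 + a * b / 2)%:C - (b ^+ 2 / 2)%:C) * k + b%:C * c +
       (((b ^+ 2 / 2)%:C - (a ^+ 2 / 2)%:C - 'i * (a * b)%:C) * k +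
        ('i * a%:C - b%:C) * c) * (X%:C * X%:C)).
Proof.
have h := expansion2M _ _ _ _ _ _ _ _
  (expansion2M _ _ _ _ _ _ _ _
    (expansion2M _ _ _ _ _ _ _ _
      (expansion2M _ _ _ _ _ _ _ _ (expansion2_expi_linear a)
        (expansion2_expi_square (sg / 8 + a * b / 2)))
      (expansion2_expR_linear (- b)))
    (expansion2_expR_square (- (b ^+ 2 / 2))))
  (expansion2_affine k c (b%:C * c)).
apply: (expansion2_eq _ _ _ _ _ _ _ _ _ _ _ _ h) => // X.
- by ring.
- by rewrite !rmorphN /=; ring.
- by rewrite sqrrN !rmorphN /= !rmorphM /=; ring.
Qed.

End TranslatedPackets.

(** * Hou's operator on packets *)

Section HouOnPackets.
Local Open Scope classical_set_scope.
Context {R : realType}.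

Lemma cintegral2D (F G : R -> R -> R[i]) : csummable2 F -> csummable2 G ->
  csummable2 (fun xi y => F xi y + G xi y) /\
  cintegral2 (fun xi y => F xi y + G xi y) = cintegral2 F + cintegral2 G.
Proof.
move=> hF hG.
have := @cintegral2_sum R bool (fun b => if b then F else G).
case/(_ _)/Wrap; first by case.
rewrite big_bool /= (_ : (fun xi y => \sum_i _) = fun xi y => F xi y + G xi y)//.
by apply/funext => xi; apply/funext => y; rewrite big_bool.
Qed.

(** The quantization of the symbol 1, on a packet. *)
Lemma cintegral2_gauss (al be : R[i]) (X : R) :
  let G xi y := expi ((X - y) * xi) * ((gauss y)%:C * (al + y%:C * be)) in
  csummable2 G /\ cintegral2 G = (2 * pi * gauss X)%:C * (al + X%:C * be).
Proof.
have [M [h0 h1]] := @amplitude_gauss R.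
have M0 := amplitude_ge0 _ _ h0.
have hz := @amplitude0 R M M0.
have [a1 a2] := cintegral2_osc _ X _ _ h0 hz.
have [b1 b2] := cintegral2_osc _ X _ _ h1 hz.
have [c1 c2] := cintegral2Z al _ a1.
have [d1 d2] := cintegral2Z be _ b1.
have [s1 s2] := cintegral2D _ _ c1 d1.
move=> G; have -> : G = fun xi y =>
    al * (expi ((X - y) * xi) * (gauss y +i* 0)) +
    be * (expi ((X - y) * xi) * ((y * gauss y) +i* 0)).
  apply/funext => xi; apply/funext => y; rewrite /G.
  rewrite -[gauss y +i* 0]/((gauss y)%:C) -[(y * gauss y) +i* 0]/((y * gauss y)%:C).
  by rewrite rmorphM; ring.
split; first exact: s1.
rewrite s2 c2 d2 a2 b2 !osc2_0 !osc2_gauss !osc2_mul_gauss cosN cos_pihalf cos0.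
by apply: eqC; rewrite !ReImE /=; ring.
Qed.

(** The quantization of the plane wave exp(i (a x + b xi)) is a translation
    combined with a modulation: collecting the phases, the shifts X -> X + b
    e and xi -> xi + a e / 2 reduce the integral to [cintegral2_gauss]. *)
Lemma cintegral2_translation (al be : R[i]) (a b e x0 xi0 X : R) :
  let F xi y := expi ((X - y) * xi) *
    (expi (a * (x0 + e * ((X + y) / 2)) + b * (xi0 + e * xi)) *
     ((gauss y)%:C * (al + y%:C * be))) in
  csummable2 F /\
  cintegral2 F = (2 * pi)%:C * expi (a * x0 + b * xi0) *
    expi (a * e * X + a * b * e ^+ 2 / 2) *
    ((gauss (X + b * e))%:C * (al + (X + b * e)%:C * be)).
Proof.
pose Z := X + b * e; pose t := a * e / 2.
have [g1 g2] := cintegral2_gauss al be Z.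
set G := (fun xi y : R => _) in g1 g2.
have [c1 c2] := cintegral2_affine 1 (- t) 1 0 G ltr01 ltr01 g1.
pose z := expi (a * x0 + b * xi0) *
  expi (a * e * X + a * b * e ^+ 2 / 2) : R[i].
have [d1 d2] := cintegral2Z z _ c1.
move=> F; have -> : F = fun xi y => z * G (- t + 1 * xi) (0 + 1 * y).
  apply/funext => xi; apply/funext => y; rewrite /F /G /z !mul1r add0r.
  rewrite !mulrA -!expiD; congr (expi _ * _ * _).
  by rewrite /Z /t; field.
split; first exact: d1.
rewrite mulr1 rmorph1 [RHS]mul1r in c2.
rewrite d2 -[X in _ * X]c2 g2 /z /Z [(2 * pi * gauss _)%:C]rmorphM /=; ring.
Qed.

(** Each off-diagonal entry of Hou's matrix is a coefficient times exp(i sg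
    h / 8) times a sum of two plane waves, with frequencies a in x and b in
    xi. The tables list these data, so that computations with the matrix
    become computations with sums over (r, s, j); see [houE]. *)
Definition hou_coef (r s : nat) : R[i] := nth 0 (nth [::]
  [:: [:: 0; 'i; - 'i]; [:: - 'i; 0; 'i]; [:: 'i; - 'i; 0]] r) s.
Definition hou_sg (r s : nat) : R := nth 0 (nth [::]
  [:: [:: 0; 1; - 1]; [:: - 1; 0; 1]; [:: 1; - 1; 0]] r) s.
Definition hou_a (r s : nat) (j : bool) : R := nth 0 (nth [::]
  (if j then [:: [:: 0; - 1; - 1]; [:: 1; 0; 1]; [:: 1; - 1; 0]]
   else [:: [:: 0; - 1; 0]; [:: 1; 0; 0]; [:: 0; 0; 0]]) r) s.
Definition hou_b (r s : nat) (j : bool) : R := nth 0 (nth [::]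
  (if j then [:: [:: 0; 0; 0]; [:: 0; 0; - 1]; [:: 0; 1; 0]]
   else [:: [:: 0; 1; - 1]; [:: - 1; 0; - 1]; [:: 1; 1; 0]]) r) s.

Lemma houE (x xi h : R) (r s : 'I_(1 + 2)) :
  hou x xi h r s = \sum_(j : bool) hou_coef r s * expi (hou_sg r s * (h / 8)) *
    expi (hou_a r s j * x + hou_b r s j * xi).
Proof.
rewrite mxE big_bool /hou_coef /hou_sg /hou_a /hou_b.
case: r => [[|[|[|//]]] ?]; case: s => [[|[|[|//]]] ?] /=;
  rewrite ?mulN1r ?mul1r ?mul0r ?addr0 ?add0r ?opprB ?mulrDr//;
  by congr (_ + _); congr (_ * expi _); ring.
Qed.

Definition hou_term (x0 xi0 : R) (r s : nat) (j : bool) : R[i] :=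
  hou_coef r s * expi (hou_a r s j * x0 + hou_b r s j * xi0).

Lemma gauss_shift (b e X : R) : gauss (X + b * e) =
  gauss X * expR (e * (- b * X)) * expR (e ^+ 2 * - (b ^+ 2 / 2)).
Proof. by rewrite /gauss -!expRD; congr expR; field. Qed.

(** By [houE] the image is a finite sum of the integrals of
    [cintegral2_translation]: it is explicit for every e > 0, without
    remainder. *)
Lemma unwave_weyl_hou (e x0 xi0 : R) (k c : 'cV[R[i]]_(1 + 2)) (X : R)
    (r : 'I_(1 + 2)) : 0 < e ->
  unwave e x0 xi0 (weyl (e ^+ 2) hou (wave e x0 xi0 (packet k (e%:C *: c)))) X r 0 =
  (gauss X)%:C * \sum_(s < 1 + 2) \sum_(j : bool) hou_term x0 xi0 r s j *
    moved (hou_a r s j) (hou_b r s j) (hou_sg r s) (k s 0) (c s 0) e X.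
Proof.
move=> e0.
have step (r' s : 'I_(1 + 2)) : let F xi y := expi ((X - y) * xi) *
    (hou (x0 + e * ((X + y) / 2)) (xi0 + e * xi) (e ^+ 2) r' s *
     packet k (e%:C *: c) y s 0) in
    csummable2 F /\ cintegral2 F = (2 * pi)%:C * ((gauss X)%:C *
      \sum_(j : bool) hou_term x0 xi0 r' s j *
    moved (hou_a r' s j) (hou_b r' s j) (hou_sg r' s) (k s 0) (c s 0) e X).
  have T j := cintegral2_translation (k s 0) (e%:C * c s 0)
    (hou_a r' s j) (hou_b r' s j) e x0 xi0 X.
  pose z := hou_coef r' s * expi (hou_sg r' s * (e ^+ 2 / 8)).
  have Z j := cintegral2Z z _ (T j).1.
  have [S1 S2] := cintegral2_sum _ _ (fun j => (Z j).1).
  move=> F; have -> : F = fun xi y => \sum_(j : bool) z *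
     (expi ((X - y) * xi) * (expi (hou_a r' s j * (x0 + e * ((X + y) / 2)) +
        hou_b r' s j * (xi0 + e * xi)) *
        ((gauss y)%:C * (k s 0 + y%:C * (e%:C * c s 0))))).
    apply/funext => xi; apply/funext => y; rewrite /F houE !mxE !big_bool /= -/z.
    by ring.
  split; first exact: S1.
  rewrite S2 mulrA big_distrr; apply: eq_bigr => j _ /=.
  rewrite (Z j).2 (T j).2 gauss_shift /moved /hou_term /z.
  have -> : e ^+ 2 * (hou_sg r' s / 8 + hou_a r' s j * hou_b r' s j / 2) =
    hou_sg r' s * (e ^+ 2 / 8) + hou_a r' s j * hou_b r' s j * e ^+ 2 / 2.
    by field.
  have -> : e * (hou_a r' s j * X) = hou_a r' s j * e * X by ring.
  rewrite !expiD !rmorphM /= !rmorphD /= !rmorphM /=; ring.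
rewrite (weyl_wave e x0 xi0 e0); last by move=> a b; exact: (step a b).1.
rewrite mxE big_distrr [RHS]big_distrr; apply: eq_bigr => s _ /=.
rewrite (step r s).2 mulrA -rmorphM /= mulVf ?mul1r//.
by rewrite mulf_neq0// gt_eqF ?pi_gt0.
Qed.

End HouOnPackets.

(** * The kernel of Hou's principal symbol *)

Section KernelAlgebra.
Local Open Scope classical_set_scope.
Context {R : realType}.
Variables (x0 xi0 : R).

(** A section of the kernel of the principal symbol without zeros: its
    square norm is 2 (3 + ptriangle), see [sqnorm_kervec]. *)
Definition kervec : 'cV[R[i]]_(1 + 2) := \col_r nth 0
  [:: 1 + expi (- x0); 1 + expi x0 * expi (- xi0); 1 + expi xi0] r.

(** The derivative (d/dx + i d/dxi) of [kervec]. *)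
Definition kercor : 'cV[R[i]]_(1 + 2) := \col_r nth 0
  [:: - ('i * expi (- x0)); (1 + 'i) * (expi x0 * expi (- xi0)); - expi xi0] r.

Let n10 : (-1 == 1 :> R) = false.
Proof. by apply/negbTE; rewrite lt_eqF// (lt_trans _ ltr01)// ltrN10. Qed.
Let n00 : (-1 == 0 :> R) = false.
Proof. by apply/negbTE; rewrite oppr_eq0 oner_eq0. Qed.
Let n01 : (0 == 1 :> R) = false.
Proof. by rewrite eq_sym oner_eq0. Qed.
Let tabE := (eqxx, n10, n00, n01).

Lemma hou_termE (r s : 'I_(1 + 2)) (j : bool) : hou_term x0 xi0 r s j =
  hou_coef r s *
  ((if hou_a r s j == 1 :> R then expi x0 else
    if hou_a r s j == 0 :> R then 1 else expi (- x0)) *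
   (if hou_b r s j == 1 :> R then expi xi0 else
    if hou_b r s j == 0 :> R then 1 else expi (- xi0))).
Proof.
rewrite /hou_term expiD /hou_a /hou_b.
by case: r => [[|[|[|//]]] ?]; case: s => [[|[|[|//]]] ?]; case: j => /=;
  rewrite ?mulN1r ?mul1r ?mul0r ?expi0 ?tabE.
Qed.

Local Notation u := (@expi R x0).
Local Notation u' := (@expi R (- x0)).
Local Notation v := (@expi R xi0).
Local Notation v' := (@expi R (- xi0)).

Lemma expi_neq0 (t : R) : expi t != 0 :> R[i].
Proof.
have h := expi_mulN t.
by apply/eqP => z; move: h; rewrite z mulr0 => /eqP; rewrite eq_sym oner_eq0.
Qed.

Lemma expi_inv (t : R) : @expi R (- t) = (expi t)^-1.
Proof.
by apply: (mulIf (expi_neq0 t)); rewrite mulVf ?expi_neq0// expi_mulN.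
Qed.

(** The relation hou0 kervec = 0, written with the terms of [houE]. *)
Lemma kervec_order0 (r : 'I_(1 + 2)) :
  \sum_(s < 1 + 2) \sum_(j : bool) hou_term x0 xi0 r s j * kervec s 0 = 0.
Proof.
rewrite !big_ord_recl big_ord0 !big_bool !hou_termE /hou_coef /hou_a /hou_b.
rewrite !mxE !expi_inv.
have u0 := expi_neq0 x0; have v0 := expi_neq0 xi0.
by case: r => [[|[|[|//]]] ?] /=; rewrite !tabE ?complexiE; field;
  rewrite ?u0 ?v0.
Qed.

(** The operator d/dx + i d/dxi applied to [kervec_order0]: it multiplies a
    plane wave by i a - b and maps [kervec] to [kercor]. The sum is the
    coefficient of e X in the image of the corrected packet. *)
Lemma kervec_order1 (r : 'I_(1 + 2)) :
  \sum_(s < 1 + 2) \sum_(j : bool) hou_term x0 xi0 r s j *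
    (('i * (hou_a r s j)%:C - (hou_b r s j)%:C) * kervec s 0 + kercor s 0) = 0.
Proof.
rewrite !big_ord_recl big_ord0 !big_bool !hou_termE /hou_coef /hou_a /hou_b.
rewrite !mxE !expi_inv.
have u0 := expi_neq0 x0; have v0 := expi_neq0 xi0.
by case: r => [[|[|[|//]]] ?] /=; rewrite !tabE !(rmorphN, rmorph1, rmorph0) /= ?complexiE;
  field; rewrite ?u0 ?v0.
Qed.

Lemma conj_kervec (r : 'I_(1 + 2)) : (kervec r 0)^* =
  nth 0 [:: 1 + u; 1 + u' * v; 1 + v'] r.
Proof.
rewrite mxE; case: r => [[|[|[|//]]] ?] /=.
- by apply: eqC; rewrite /= ?cosN ?sinN ?opprK //; ring.
- by apply: eqC; rewrite !ReImE /= ?cosN ?sinN; ring.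
- by apply: eqC; rewrite /= ?cosN ?sinN //; ring.
Qed.

Lemma ptriangleE : (2 * ptriangle x0 xi0)%:C =
  u + u' + v + v' + u * v' + u' * v :> R[i].
Proof.
by apply: eqC; rewrite /ptriangle !ReImE /= ?cosN ?sinN ?cosB; ring.
Qed.

Lemma sqnorm_kervec :
  \sum_(r < 1 + 2) sqnorm (kervec r 0) = 2 * (3 + ptriangle x0 xi0).
Proof.
suff : (\sum_(r < 1 + 2) sqnorm (kervec r 0))%:C =
    (2 * (3 + ptriangle x0 xi0))%:C :> R[i] by case.
rewrite rmorph_sum mulrDr rmorphD [X in _ = _ + X]ptriangleE.
rewrite (eq_bigr (fun r : 'I_(1 + 2) => kervec r 0 * nth 0
  [:: 1 + u; 1 + u' * v; 1 + v'] r)); last first.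
  by move=> r _; rewrite -conj_kervec [RHS]mul_conj.
under eq_bigr do rewrite mxE.
rewrite !big_ord_recl big_ord0 /= !expi_inv.
have u0 := expi_neq0 x0; have v0 := expi_neq0 xi0.
rewrite (_ : (2 * 3)%:C = 6); last by apply: eqC => /=; ring.
by field; rewrite ?u0 ?v0.
Qed.

(** The pairing of [kervec] with the term of order e^2 of the image of the
    corrected packet, averaged over X with weight gauss^2, for which X^2 has
    mean 1 / 2. *)
Lemma kervec_order2 :
  \sum_(r < 1 + 2) (kervec r 0)^* *
    \sum_(s < 1 + 2) \sum_(j : bool) hou_term x0 xi0 r s j *
    (('i * (hou_sg r s / 8)%:C -
        ((hou_a r s j ^+ 2 + hou_b r s j ^+ 2) / 4)%:C) * kervec s 0 +
     ((hou_b r s j)%:C + 'i * (hou_a r s j)%:C) / 2 * kercor s 0) =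
  (- ((3 - ptriangle x0 xi0) / 2))%:C.
Proof.
rewrite (eq_bigr (fun r : 'I_(1 + 2) => nth 0 [:: 1 + u; 1 + u' * v; 1 + v'] r *
    \sum_(s < 1 + 2) \sum_(j : bool) hou_term x0 xi0 r s j *
    (('i * (hou_sg r s / 8)%:C -
        ((hou_a r s j ^+ 2 + hou_b r s j ^+ 2) / 4)%:C) * kervec s 0 +
     ((hou_b r s j)%:C + 'i * (hou_a r s j)%:C) / 2 * kercor s 0))); last first.
  by move=> r _; rewrite -conj_kervec.
have -> : (- ((3 - ptriangle x0 xi0) / 2))%:C =
    - (6 - (u + u' + v + v' + u * v' + u' * v)) / 4 :> R[i].
  rewrite -ptriangleE (_ : - ((3 - _) / 2) = - (6 - 2 * ptriangle x0 xi0) / 4);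
    last by field.
  by rewrite rmorphM rmorphN rmorphB fmorphV !rmorph_nat.
rewrite !big_ord_recl !big_ord0 !big_bool !hou_termE.
rewrite /hou_coef /hou_a /hou_b /hou_sg !mxE !expi_inv /= !tabE ?complexiE.
have : 'i%R * 'i%R = -1 :> R[i] by rewrite -complexiE -expr2 sqr_i.
have u0 := expi_neq0 x0; have v0 := expi_neq0 xi0.
(* After this generalization the imaginary unit is a variable I: the part of
   the sum that is odd in I is a multiple of I + I^3, hence vanishes. *)
move: ('i%R) (expi x0) (expi xi0) u0 v0 => I w z w0 z0 I2.
rewrite !(rmorphM, rmorphD, rmorphN, rmorphXn, fmorphV, rmorph1, rmorph0,
  rmorph_nat) /=.
set q := w + w^-1 + z + z^-1 + w / z + w^-1 * z.
transitivity (I * I * ((6 - q) / 4) +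
  (I + I * I * I) * ((1 + z^-1) * (w^-1 * z - w) / 2)).
  by rewrite /q; field; rewrite ?w0 ?z0.
by rewrite I2; ring.
Qed.

End KernelAlgebra.

(** * The second-order limit of Hou's operator *)

Section HouLimit.
Local Open Scope classical_set_scope.
Context {R : realType}.
Local Notation leb := (@lebesgue_measure R).
Local Notation Re := complex.Re.
Local Notation Im := complex.Im.

(** The Gaussian absorbs the exponential growth, by [expR_gauss_le]. *)
Lemma sqnorm_gauss_expgrowth (f : R -> R -> R[i]) : expgrowth f ->
  exists B : R, 0 <= B /\ forall e X, 0 <= e <= 1 ->
    sqnorm ((gauss X)%:C * f e X) <= B * lorentz X.
Proof.
move=> [C [n [C0 h]]]; pose D : R := expR ((n%:R + 2) ^+ 2 / 2).
exists (2 * (C * D) ^+ 2); split; first by rewrite mulr_ge0 ?sqr_ge0.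
move=> e X he; have [h1 h2] := h e X he.
have l0 := @lorentz_ge0 R X.
have l1 : lorentz X <= 1.
  exact: lorentz_le1.
have D0 : 0 <= D := expR_ge0 _.
have gD : expR (n%:R * `|X|) * gauss X <= D * lorentz X := expR_gauss_le _ _.
have sq (t : R) : `|t| <= C * expR (n%:R * `|X|) ->
    (gauss X * t) ^+ 2 <= (C * D) ^+ 2 * lorentz X.
  move=> ht; have g0 := gauss_ge0 X.
  have : `|gauss X * t| <= C * D * lorentz X.
    rewrite normrM ger0_norm// -mulrA (le_trans (ler_wpM2l g0 ht))// mulrC.
    by rewrite -mulrA ler_wpM2l.
  move=> ht2; rewrite -real_normK ?num_real//.
  apply: (@le_trans _ _ ((C * D * lorentz X) ^+ 2)).
    by rewrite lerXn2r// nnegrE !mulr_ge0.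
  by rewrite exprMn ler_wpM2l ?sqr_ge0// expr2 ler_piMl.
rewrite /sqnorm ReM ImM /= !mul0r subr0 addr0.
by have := sq _ h1; have := sq _ h2; lra.
Qed.

Definition quadpacket n (c0 c2 : 'cV[R[i]]_n) (X : R) : 'cV[R[i]]_n :=
  (gauss X)%:C *: (c0 + (X%:C * X%:C) *: c2).
Arguments quadpacket {n}.

(** Finitely many constants are replaced by their sum. *)
Lemma sum_bound (I : finType) (P : I -> R -> Prop) :
  (forall i, exists B, 0 <= B /\ P i B) ->
  (forall i B B', P i B -> B <= B' -> P i B') ->
  exists B, 0 <= B /\ forall i, P i B.
Proof.
move=> /choice[B hB] mono; exists (\sum_i B i); split.
  by apply: sumr_ge0 => i _; exact: (hB i).1.
move=> i; apply: (mono _ (B i)); first exact: (hB i).2.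
by rewrite (bigD1 i)//= lerDl; apply: sumr_ge0 => j _; exact: (hB j).1.
Qed.

Lemma L2_quadpacket n (c0 c2 : 'cV[R[i]]_n) : L2 (quadpacket c0 c2).
Proof.
have [B [B0 hB]] : exists B, 0 <= B /\ forall a X,
    sqnorm (quadpacket c0 c2 X a 0) <= B * lorentz X.
  apply: (@sum_bound _ (fun a B => forall X, _ <= B * lorentz X)).
    move=> a; have := expgrowth_powers (c0 a 0) 0 (c2 a 0).
    move=> /sqnorm_gauss_expgrowth[B [B0 hB]]; exists B; split => // X.
    have := hB 0 X; rewrite lexx ler01 => /(_ isT); apply: le_trans.
    rewrite !mxE mul0r addr0 [c2 a 0 * _]mulrC; exact: lexx.
  move=> a B B' h BB' X; apply: (le_trans (h X)).
  by rewrite ler_wpM2r ?lorentz_ge0.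
have cg := @continuous_gauss R.
apply: (@L2_le _ _ _ (fun X => B * lorentz X)).
- move=> a; rewrite (_ : (fun X => _) = fun X =>
    gauss X * (Re (c0 a 0) + X * X * Re (c2 a 0))).
    by apply: continuous_measurable_fun; cont.
  by apply/funext => X; rewrite !mxE !ReImE /=; ring.
- move=> a; rewrite (_ : (fun X => _) = fun X =>
    gauss X * (Im (c0 a 0) + X * X * Im (c2 a 0))).
    by apply: continuous_measurable_fun; cont.
  by apply/funext => X; rewrite !mxE !ReImE /=; ring.
- by apply: summableZ; exact: summable_lorentz.
- by move=> a X; exact: hB.
Qed.

Variables (x0 xi0 : R).
Local Notation m := (hou_term x0 xi0).
Local Notation k := (kervec x0 xi0).
Local Notation c := (kercor x0 xi0).

(** [houlim0] and [houlim2] are the coefficients of 1 and of X^2 in the term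
    of order e^2 of [expansion2_moved], summed over the plane waves of Hou's
    matrix. *)
Definition houlim0 : 'cV[R[i]]_(1 + 2) :=
  \col_(r < 1 + 2) \sum_(s < 1 + 2) \sum_(j : bool) m r s j *
    (('i * (hou_sg r s / 8 + hou_a r s j * hou_b r s j / 2)%:C -
        (hou_b r s j ^+ 2 / 2)%:C) * k s 0 + (hou_b r s j)%:C * c s 0).

Definition houlim2 : 'cV[R[i]]_(1 + 2) :=
  \col_(r < 1 + 2) \sum_(s < 1 + 2) \sum_(j : bool) m r s j *
    (((hou_b r s j ^+ 2 / 2)%:C - (hou_a r s j ^+ 2 / 2)%:C -
       'i * (hou_a r s j * hou_b r s j)%:C) * k s 0 +
     ('i * (hou_a r s j)%:C - (hou_b r s j)%:C) * c s 0).

(** The terms of order 0 and 1 vanish by the choice of [kervec] and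
    [kercor]. *)
Lemma expansion2_hou (r : 'I_(1 + 2)) :
  expansion2 (fun e X => \sum_(s < 1 + 2) \sum_(j : bool) m r s j *
      moved (hou_a r s j) (hou_b r s j) (hou_sg r s) (k s 0) (c s 0) e X)
    (fun _ => 0) (fun _ => 0)
    (fun X => houlim0 r 0 + (X%:C * X%:C) * houlim2 r 0).
Proof.
have h := expansion2_sum _ _ _ _ _ (fun s : 'I_(1 + 2) =>
  expansion2_sum _ _ _ _ _ (fun j : bool =>
  expansion2M _ _ _ _ _ _ _ _ (expansion2_cst (m r s j))
   (expansion2_moved (hou_a r s j) (hou_b r s j) (hou_sg r s) (k s 0) (c s 0)))).
apply: (expansion2_eq _ _ _ _ _ _ _ _ _ _ _ _ h) => // X.
- exact: kervec_order0.
- transitivity ((\sum_(s < 1 + 2) \sum_(j : bool) m r s j *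
    (('i * (hou_a r s j)%:C - (hou_b r s j)%:C) * k s 0 + c s 0)) * X%:C).
    rewrite big_distrl; apply: eq_bigr => s _; rewrite big_distrl.
    by apply: eq_bigr => j _ /=; ring.
  by rewrite kervec_order1 mul0r.
- rewrite !mxE big_distrr -big_split; apply: eq_bigr => s _ /=.
  rewrite big_distrr -big_split; apply: eq_bigr => j _ /=; ring.
Qed.

Variables (T : R -> @operator R (1 + 2) (1 + 2)) (e_ : nat -> R).
Hypotheses (e_gt0 : forall l, 0 < e_ l) (e_le1 : forall l, e_ l <= 1)
  (cvg_e : e_ @ \oo --> (0 : R)).
Hypothesis T_weyl : forall l, weyl_quantization (e_ l ^+ 2) hou (T (e_ l ^+ 2)).

Lemma L2_wave n (e : R) (F : R -> 'cV[R[i]]_n) : 0 < e -> L2 F ->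
  L2 (wave e x0 xi0 F).
Proof.
by move=> e0 LF; apply: L2_twist => //; [cont|rewrite invr_gt0].
Qed.

Lemma L2_unwave n (e : R) (u : R -> 'cV[R[i]]_n) : 0 < e -> L2 u ->
  L2 (unwave e x0 xi0 u).
Proof. by move=> e0 Lu; apply: L2_twist => //; cont. Qed.

(** The image being O(e^2), division by h = e^2 leaves the second-order
    coefficient and a remainder of order e, dominated because of the
    Gaussian factor. *)
Lemma L2cvg_hou :
  L2cvg (fun l X => ((e_ l ^+ 2)^-1)%:C *: unwave (e_ l) x0 xi0
     (T (e_ l ^+ 2) (wave (e_ l) x0 xi0 (packet k ((e_ l)%:C *: c)))) X)
    (quadpacket houlim0 houlim2).
Proof.
have he l : 0 <= e_ l <= 1 by rewrite ltW ?e_gt0 ?e_le1.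
have /choice[rem hrem] : forall r : 'I_(1 + 2), exists rm : R -> R -> R[i],
    expgrowth rm /\ forall e X, 0 <= e <= 1 ->
    \sum_(s < 1 + 2) \sum_(j : bool) m r s j *
      moved (hou_a r s j) (hou_b r s j) (hou_sg r s) (k s 0) (c s 0) e X =
    e%:C ^+ 2 * (houlim0 r 0 + (X%:C * X%:C) * houlim2 r 0 + e%:C * rm e X).
  move=> r; have [_ _ _ [rm [h1 h2]]] := expansion2_hou r.
  by exists rm; split => // e X h; rewrite h2//; ring.
have aeE : {ae leb, forall X, forall l r,
    (((e_ l ^+ 2)^-1)%:C *: unwave (e_ l) x0 xi0
     (T (e_ l ^+ 2) (wave (e_ l) x0 xi0 (packet k ((e_ l)%:C *: c)))) X) r 0 =
    (gauss X)%:C * (houlim0 r 0 + (X%:C * X%:C) * houlim2 r 0 +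
      (e_ l)%:C * rem r (e_ l) X)}.
  apply: ae_foralln => l.
  have [_ /(_ _ (schwartz_wave_packet _ (e_ l) x0 xi0 k ((e_ l)%:C *: c)
    (e_gt0 l))) h] := T_weyl l.
  apply: (ae_imply _ _ _ (eqae_twist
    (fun X => - ((x0 + e_ l * X) * (xi0 / e_ l ^+ 2))) (e_ l) x0 (e_gt0 l) _ _ _ h)).
  move=> X hX r; rewrite mxE.
  have -> : unwave (e_ l) x0 xi0 (T (e_ l ^+ 2) (wave (e_ l) x0 xi0
      (packet k ((e_ l)%:C *: c)))) X r 0 = _ :=
    congr1 (fun M : 'cV_(1 + 2) => M r 0) hX.
  have := unwave_weyl_hou (e_ l) x0 xi0 k c X r (e_gt0 l).
  rewrite /unwave => ->; rewrite (hrem r).2// mulrCA; congr (_ * _).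
  by rewrite mulrA -rmorphXn -rmorphM /= mulVf ?expf_neq0 ?gt_eqF// rmorph1 mul1r.
have [B [B0 hB]] : exists B, 0 <= B /\ forall r : 'I_(1 + 2), forall e X,
    0 <= e <= 1 -> sqnorm ((gauss X)%:C * (houlim0 r 0 +
      (X%:C * X%:C) * houlim2 r 0 + e%:C * rem r e X)) <= B * lorentz X.
  apply: (@sum_bound _ (fun r B => forall e X, 0 <= e <= 1 -> _ <= B * lorentz X)).
    move=> r; apply: sqnorm_gauss_expgrowth.
    apply: expgrowthD; last first.
      by apply: expgrowthM; [exact: expgrowth_param|exact: (hrem r).1].
    by apply: (expgrowth_poly (houlim0 r 0) 0 (houlim2 r 0)) => X; ring.
  move=> r B B' h BB' e X h01; apply: (le_trans (h e X h01)).
  by rewrite ler_wpM2r ?lorentz_ge0.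
apply: (L2cvg_dominated _ _ _ (fun X => B * lorentz X)).
- move=> l; apply: L2Z; apply: L2_unwave => //.
  have [[h _ _] _] := T_weyl l; apply: h; apply: L2_wave => //.
  exact: L2_packet.
- exact: L2_quadpacket.
- by apply: summableZ; exact: summable_lorentz.
- by apply: ae_imply aeE => X hX l r; rewrite hX; exact: hB.
- apply: ae_imply aeE => X hX r.
  rewrite -[_ /\ _]/(Ccvg (fun l => _) _).
  rewrite (_ : (fun l => _) = fun l => (gauss X)%:C * (houlim0 r 0 +
      (X%:C * X%:C) * houlim2 r 0 + (e_ l)%:C * rem r (e_ l) X)); last first.
    by apply/funext => l; rewrite hX.
  rewrite (_ : quadpacket _ _ X r 0 = (gauss X)%:C * (houlim0 r 0 +
      (X%:C * X%:C) * houlim2 r 0 + 0)); last by rewrite !mxE addr0.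
  apply: CcvgZ; apply: CcvgD; first exact: Ccvg_cst.
  have [[C [n [C0 hC]]] _] := hrem r.
  set W := C * expR (n%:R * `|X|) in hC.
  have small (F : R -> R) : (forall l, `|F (e_ l)| <= W) ->
      e_ l * F (e_ l) @[l --> \oo] --> (0 : R).
    move=> hF; apply: norm_cvg0.
    have up : e_ l * W @[l --> \oo] --> (0 : R).
      by rewrite -[X in _ --> X](mul0r W); apply: cvgMl.
    apply: (squeeze_cvgr _ _ up); last exact: (@cvg_cst _ (0 : R)).
    apply: nearW => l; rewrite normr_ge0 /= normrM (ger0_norm (ltW (e_gt0 l))).
    exact: ler_wpM2l (ltW (e_gt0 l)) _ _ (hF l).
  split.
  + under eq_fun do rewrite ReM /= mul0r subr0.
    by apply: (small (fun e => Re (rem r e X))) => l; have [] := hC _ X (he l).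
  + under eq_fun do rewrite ImM /= mul0r addr0.
    by apply: (small (fun e => Im (rem r e X))) => l; have [] := hC _ X (he l).
Qed.

End HouLimit.
Arguments quadpacket {R n}.

(** * Bounded operators, adjoints and L^2 convergence *)

Section AlmostEverywhere.
Local Open Scope classical_set_scope.
Context {R : realType}.
Local Notation leb := (@lebesgue_measure R).

Lemma eqae_sym n (u v : R -> 'cV[R[i]]_n) : eqae u v -> eqae v u.
Proof. by apply: ae_imply => x ->. Qed.

Lemma eqae_trans n (u v w : R -> 'cV[R[i]]_n) :
  eqae u v -> eqae v w -> eqae u w.
Proof. by apply: ae_imply2 => x -> ->. Qed.

Lemma Rintegral_ae (f g : R -> R) : summable f -> summable g ->
  {ae leb, forall x, f x = g x} -> \int[leb]_x f x = \int[leb]_x g x.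
Proof.
move=> sf sg fg; congr fine; apply: ae_eq_integral => //.
- exact: measurable_int sf.
- exact: measurable_int sg.
- by apply: ae_imply fg => x -> _.
Qed.

Lemma sqL2_eqae n (u v : R -> 'cV[R[i]]_n) :
  L2 u -> L2 v -> eqae u v -> sqL2 u = sqL2 v.
Proof.
move=> Lu Lv uv; apply: eq_bigr => a _; apply: Rintegral_ae.
- exact: L2_summable Lu.
- exact: L2_summable Lv.
- by apply: ae_imply uv => x ->.
Qed.

Lemma L2dot_eqae_r n (u v w : R -> 'cV[R[i]]_n) :
  L2 u -> L2 v -> L2 w -> eqae v w -> L2dot u v = L2dot u w.
Proof.
move=> Lu Lv Lw vw; apply: eq_bigr => a _.
have [s1 s2] := csummable_mul_conj _ _ _ a Lu Lv.
have [s3 s4] := csummable_mul_conj _ _ _ a Lu Lw.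
by apply: eqC; rewrite /cintegral /=; apply: Rintegral_ae => //;
  apply: ae_imply vw => x ->.
Qed.

Lemma sqL2_eq0 n (u : R -> 'cV[R[i]]_n) :
  L2 u -> sqL2 u = 0 -> eqae u (fun _ => 0).
Proof.
move=> Lu /eqP; rewrite psumr_eq0; last first.
  by move=> a _; apply: Rintegral_ge0 => x _; exact: sqnorm_ge0.
move=> /allP u0.
have ae1 a : {ae leb, forall x, u x a 0 = 0}.
  have su := L2_summable _ _ a Lu.
  have /eqP i0 := u0 a (mem_index_enum _).
  have : (\int[leb]_x `|(EFin \o (fun x => sqnorm (u x a 0%R))) x| = 0)%E.
    rewrite (_ : (\int[leb]_x _)%E = (\int[leb]_x (sqnorm (u x a 0%R))%:E)%E).
      by rewrite -[LHS](fineK (integrable_fin_num measurableT su)) [fine _]i0.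
    by apply: eq_integral => x _; rewrite /= ger0_norm// sqnorm_ge0.
  move/(ae_eq_integral_abs _ measurableT (measurable_int _ su)).
  apply: ae_imply => x /(_ I) [] /eqP.
  rewrite paddr_eq0 ?sqr_ge0// !sqrf_eq0 => /andP[/eqP r0 /eqP i0'].
  exact: eqC.
have : {ae leb, forall x, forall i : nat, forall a : 'I_n, val a = i -> u x a 0 = 0}.
  apply: ae_foralln => i.
  have [lin|nin] := ltnP i n.
    apply: ae_imply (ae1 (Ordinal lin)) => x h a ai.
    by rewrite (_ : a = Ordinal lin)//; exact: val_inj.
  by apply: aeW => x a ai; move: (ltn_ord a); rewrite -[nat_of_ord a]/(val a) ai ltnNge nin.
apply: ae_imply => x h; apply/matrixP => a j; rewrite (ord1 j) mxE.
exact: (h (val a) a erefl).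
Qed.

(** Operators are linear only up to null sets. The difference of the
    arguments has norm 0, hence so has its image, by boundedness. *)
Lemma bounded_operator_eqae m n (T : @operator R m n) u v :
  bounded_operator T -> L2 u -> L2 v -> eqae u v -> eqae (T u) (T v).
Proof.
move=> [TL Tlin [C hC]] Lu Lv uv.
have Ld : L2 (fun x => (-1) *: v x + u x) by exact: L2_lin.
have d0 : sqL2 (fun x => (-1) *: v x + u x) = 0.
  rewrite (sqL2_eqae _ _ _ Ld (L20 n)); last first.
    by apply: ae_imply uv => x ->; rewrite scaleN1r addNr.
  rewrite /sqL2 big1// => a _; rewrite /Rintegral (_ : (fun x => _) = fun=> 0%E) ?integral0//.
  by apply/funext => x; rewrite mxE /sqnorm /= expr0n /= addr0.
have := hC _ Ld; rewrite !L2normE d0 sqrtr0 mulr0.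
rewrite le_eqVlt ltNge sqrtr_ge0 orbF sqrtr_eq0 => T0.
have Td0 : sqL2 (T (fun x => (-1) *: v x + u x)) = 0.
  by apply/eqP; rewrite eq_le T0 sqL2_ge0.
have z1 := sqL2_eq0 _ _ (TL _ Ld) Td0.
have z2 := Tlin (-1) v u Lv Lu.
apply: ae_imply2 z1 z2 => x /= -> /eqP.
by rewrite scaleN1r addrC eq_sym subr_eq0 => /eqP.
Qed.

Lemma L2cvg_sub n (u_ v_ : nat -> R -> 'cV[R[i]]_n) u v :
  L2cvg u_ u -> L2cvg v_ v ->
  L2cvg (fun k x => u_ k x - v_ k x) (fun x => u x - v x).
Proof.
move=> [Lu_ Lu cu] [Lv_ Lv cv]; split.
- by move=> k; exact: L2B.
- exact: L2B.
have up : 2 * sqL2 (fun x => u_ k x - u x) + 2 * sqL2 (fun x => v_ k x - v x)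
    @[k --> \oo] --> (0 : R).
  rewrite [X in _ --> X](_ : _ = 2 * 0 + 2 * 0); last by rewrite mulr0 addr0.
  by apply: cvgD; apply: cvgMr.
apply: (squeeze_cvgr _ _ up); last exact: (@cvg_cst _ (0 : R)).
apply: nearW => k; rewrite sqL2_ge0 /=.
rewrite (_ : (fun x => _) = fun x => (u_ k x - u x) - (v_ k x - v x)).
  by apply: sqL2B_le; exact: L2B.
by apply/funext => x; rewrite !opprD !opprK addrACA.
Qed.

Lemma sqL2Z n (c : R[i]) (u : R -> 'cV[R[i]]_n) : L2 u ->
  sqL2 (fun x => c *: u x) = sqnorm c * sqL2 u.
Proof.
move=> Lu; rewrite /sqL2 mulr_sumr; apply: eq_bigr => a _.
rewrite -RintegralZl//; last exact: L2_summable.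
by apply: eq_Rintegral => x _; rewrite mxE sqnormM.
Qed.

Lemma L2cvgZ n (c : R[i]) (u_ : nat -> R -> 'cV[R[i]]_n) u :
  L2cvg u_ u -> L2cvg (fun k x => c *: u_ k x) (fun x => c *: u x).
Proof.
move=> [Lu_ Lu cu]; split.
- by move=> k; exact: L2Z.
- exact: L2Z.
rewrite (_ : (fun k => _) = fun k => sqnorm c * sqL2 (fun x => u_ k x - u x)).
  by rewrite -[X in _ --> X](mulr0 (sqnorm c)); apply: cvgMr.
apply/funext => k; rewrite -sqL2Z; last exact: L2B.
by congr sqL2; apply/funext => x; rewrite scalerBr.
Qed.

Lemma L2cvg_packet n (al be : 'cV[R[i]]_n) (e_ : nat -> R) :
  e_ @ \oo --> (0 : R) ->
  L2cvg (fun k => packet al ((e_ k)%:C *: be)) (packet al 0).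
Proof.
move=> ce; split; [by move=> k; exact: L2_packet|exact: L2_packet|].
rewrite (_ : (fun k => _) = fun k => e_ k * e_ k * sqL2 (packet 0 be)).
  rewrite -[X in _ --> X](mul0r (sqL2 (packet 0 be))); apply: cvgMl.
  by rewrite -[X in _ --> X](mulr0 0); apply: cvgM.
apply/funext => k.
have -> : e_ k * e_ k = sqnorm (e_ k)%:C by rewrite /sqnorm /= expr0n /= addr0 expr2.
rewrite -sqL2Z; last exact: L2_packet.
congr sqL2; apply/funext => x; apply/matrixP => a j; rewrite !mxE; ring.
Qed.

(** With T S = id, the square norm of S u is (T S u, u) = (u, u). *)
Lemma adjoint_isometry n (T S : @operator R n n) u :
  unitary_with_adjoint T S -> L2 u -> sqL2 (S u) = sqL2 u.
Proof.
move=> [[bT bS TS] _ TSid] Lu.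
have [SL _ _] := bS; have [TL _ _] := bT.
have h : L2dot (T (S u)) u = L2dot (S u) (S u).
  by rewrite TS//; exact: SL.
have LS : L2 (S u) := SL u Lu.
have e1 : L2dot u (T (S u)) = L2dot u u.
  by apply: L2dot_eqae_r => //; [exact: TL|exact: TSid].
have e2 : L2dot (T (S u)) u = L2dot u u.
  by rewrite (L2dotC _ _ _ (TL _ LS) Lu) e1 -L2dotC.
by move: h; rewrite e2 !L2dot_sqL2 => -[].
Qed.

Lemma sqL2_usubmx m n (u : R -> 'cV[R[i]]_(m + n)) :
  sqL2 (fun x => usubmx (u x)) <= sqL2 u.
Proof.
rewrite [leRHS]/sqL2 big_split_ord /= -[leLHS]addr0; apply: lerD.
  rewrite le_eqVlt; apply/orP; left; apply/eqP; apply: eq_bigr => a _.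
  by apply: eq_Rintegral => x _; rewrite mxE.
by apply: sumr_ge0 => a _; apply: Rintegral_ge0 => x _; exact: sqnorm_ge0.
Qed.

Lemma L2_usubmx m n (u : R -> 'cV[R[i]]_(m + n)) :
  L2 u -> L2 (fun x => usubmx (u x)).
Proof.
move=> /L2P Lu; apply/L2P => a; have [m1 m2 su] := Lu (lshift n a).
split.
- by under eq_fun do rewrite mxE.
- by under eq_fun do rewrite mxE.
- by under [X in summable X]eq_fun do rewrite mxE.
Qed.

End AlmostEverywhere.

(** * Consequences of symbol expansions *)

Section PrincipalSymbols.
Local Open Scope classical_set_scope.
Context {R : realType}.
Local Notation Re := complex.Re.
Local Notation Im := complex.Im.

Lemma bounded_x2_scale (c B : R) f : 0 <= c -> bounded_x2 B f ->
  bounded_x2 (c * B) (fun x xi => c * f x xi).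
Proof.
move=> c0 [cf [f1 [f2 [d1 d2 c2 b]]]]; split.
  by move=> x; have cfx := cf x; cont.
exists (fun x xi => c * f1 x xi), (fun x xi => c * f2 x xi); split.
- by move=> xi x; have h := d1 xi x; der; ring.
- by move=> xi x; have h := d2 xi x; der; ring.
- by move=> xi; have h := c2 xi; cont.
- move=> x xi; have [b0 b1 b2] := b x xi.
  by split; rewrite normrM ger0_norm// ler_wpM2l.
Qed.

Lemma bounded_x2xi1_scale (c B : R) f : 0 <= c -> bounded_x2xi1 B f ->
  bounded_x2xi1 (c * B) (fun x xi => c * f x xi).
Proof.
move=> c0 [g [dg bf bg]]; exists (fun x xi => c * g x xi); split.
- by move=> x xi; have h := dg x xi; der; ring.
- exact: bounded_x2_scale.
- exact: bounded_x2_scale.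
Qed.

Lemma bounded_x2_mono (B B' : R) f : B <= B' ->
  bounded_x2 B f -> bounded_x2 B' f.
Proof.
move=> BB' [cf [f1 [f2 [d1 d2 c2 b]]]]; split => //.
exists f1, f2; split => // x xi; have [b0 b1 b2] := b x xi.
by split; apply: le_trans BB'.
Qed.

Lemma bounded_x2xi1_mono (B B' : R) f : B <= B' ->
  bounded_x2xi1 B f -> bounded_x2xi1 B' f.
Proof.
move=> BB' [g [dg bf bg]]; exists g; split => //;
  exact: bounded_x2_mono BB' _.
Qed.

(** Finitely many entries and derivatives share one constant. The weight w
    is 1 for symbols and h^2 for remainders. *)
Lemma uniform_bound m n (h0 : R) (w : R -> R)
    (r : R -> R -> R -> 'M[R[i]]_(m, n)) : (forall h, 0 <= w h) ->
  (forall a b j k, exists C : R, forall x xi h, `|h| <= h0 ->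
    `|pderiv j k (fun x' xi' => r x' xi' h a b) x xi| <= (C * w h)%:C) ->
  exists B : R, 0 <= B /\ forall a b (j k : nat) x xi h,
    (j <= 2)%N -> (k <= 1)%N -> `|h| <= h0 ->
    `|rpderiv j k (fun x xi => Re (r x xi h a b)) x xi| <= B * w h /\
    `|rpderiv j k (fun x xi => Im (r x xi h a b)) x xi| <= B * w h.
Proof.
move=> w0 hr.
pose P (t : 'I_m * 'I_n * 'I_3 * 'I_2) B := forall x xi h, `|h| <= h0 ->
  `|rpderiv t.1.2 t.2 (fun x xi => Re (r x xi h t.1.1.1 t.1.1.2)) x xi| <= B * w h /\
  `|rpderiv t.1.2 t.2 (fun x xi => Im (r x xi h t.1.1.1 t.1.1.2)) x xi| <= B * w h.
have [B [B0 hB]] : exists B, 0 <= B /\ forall t, P t B.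
  apply: sum_bound => [[[[a b] j] k]|t B B' hP BB' x xi h hh].
    have [C hC] := hr a b j k; exists `|C|; split => // x xi h hh.
    have [h1 h2] := norm_le_coord _ _ (hC x xi h hh).
    have Cw : C * w h <= `|C| * w h by rewrite ler_wpM2r// ler_norm.
    by split; [exact: le_trans Cw|exact: le_trans Cw].
  have [h1 h2] := hP x xi h hh.
  have Bw : B * w h <= B' * w h by rewrite ler_wpM2r.
  by split; [exact: le_trans Bw|exact: le_trans Bw].
exists B; split => // a b j k x xi h j2 k1 hh.
have := hB (a, b, inord j, inord k) x xi h hh.
by rewrite /= !inordK.
Qed.

Lemma symbol_uniform m n (h0 : R) (p : R -> R -> R -> 'M[R[i]]_(m, n)) :
  symbol h0 p -> exists B : R, 0 <= B /\ forall a b (j k : nat) x xi h,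
    (j <= 2)%N -> (k <= 1)%N -> `|h| <= h0 ->
    `|rpderiv j k (fun x xi => Re (p x xi h a b)) x xi| <= B /\
    `|rpderiv j k (fun x xi => Im (p x xi h a b)) x xi| <= B.
Proof.
move=> [_ hp]; have [||B [B0 hB]] := @uniform_bound _ _ h0 (fun=> 1) p => //.
  move=> a b j k; have [C hC] := hp a b j k; exists C => x xi h hh.
  by rewrite mulr1; exact: hC.
exists B; split => // a b j k x xi h j2 k1 hh.
by have := hB a b j k x xi h j2 k1 hh; rewrite mulr1.
Qed.

Lemma bigO_uniform m n (h0 : R) (p : R -> R -> R -> 'M[R[i]]_(m, n)) :
  bigO_h2 h0 p -> exists B : R, 0 <= B /\ forall a b (j k : nat) x xi h,
    (j <= 2)%N -> (k <= 1)%N -> `|h| <= h0 ->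
    `|rpderiv j k (fun x xi => Re (p x xi h a b)) x xi| <= B * h ^+ 2 /\
    `|rpderiv j k (fun x xi => Im (p x xi h a b)) x xi| <= B * h ^+ 2.
Proof. by apply: uniform_bound => h; exact: sqr_ge0. Qed.

Lemma symbol_bounded m n (h0 : R) (p : R -> R -> R -> 'M[R[i]]_(m, n)) :
  symbol h0 p -> exists B : R, forall h a b, `|h| <= h0 ->
    bounded_x2xi1 B (fun x xi => Re (p x xi h a b)) /\
    bounded_x2xi1 B (fun x xi => Im (p x xi h a b)).
Proof.
move=> hp; have [B [B0 hB]] := symbol_uniform _ _ _ _ hp.
exists B => h a b hh; have [sm _] := hp.
split; apply: classC2_bounded; [exact: (sm h hh a b 3%N).1| |
  exact: (sm h hh a b 3%N).2|] => j k x xi j2 k1;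
  by have [h1 h2] := hB a b j k x xi h j2 k1 hh.
Qed.

Lemma symbol_continuous m n (h0 : R) (p : R -> R -> 'M[R[i]]_(m, n)) a b :
  0 < h0 -> symbol h0 (fun x xi _ => p x xi) ->
  continuous (fun z : R * R => Re (p z.1 z.2 a b)) /\
  continuous (fun z : R * R => Im (p z.1 z.2 a b)).
Proof.
move=> h0_gt0 [sm _].
have h00 : `|0 : R| <= h0 by rewrite normr0 ltW.
by split; [exact: (classC2_continuous _ _ (sm 0 h00 a b 0%N).1)|
  exact: (classC2_continuous _ _ (sm 0 h00 a b 0%N).2)].
Qed.

Section Principal.
Variables (m n : nat) (h0 : R) (h0_gt0 : 0 < h0).
Variables (p : R -> R -> R -> 'M[R[i]]_(m, n)).
Variables (p0 p1 : R -> R -> 'M[R[i]]_(m, n)).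
Hypotheses (p_symbol : symbol h0 p)
  (p1_symbol : symbol h0 (fun x xi _ => p1 x xi))
  (p_exp : bigO_h2 h0 (fun x xi h => p x xi h - p0 x xi - h%:C *: p1 x xi)).

Lemma principal_near : exists B : R, 0 <= B /\ forall a b x xi h, 0 <= h <= h0 ->
  `|Re (p x xi h a b) - Re (p0 x xi a b)| <= B * h /\
  `|Im (p x xi h a b) - Im (p0 x xi a b)| <= B * h.
Proof.
have [B [B0 hB]] := bigO_uniform _ _ _ _ p_exp.
have [D [D0 hD]] := symbol_uniform _ _ _ _ p1_symbol.
exists (B * h0 + D); split; first by rewrite addr_ge0// mulr_ge0// ltW.
move=> a b x xi h /andP[hge0 hle]; have hh : `|h| <= h0 by rewrite ger0_norm.
have [r1 r2] := hB a b 0%N 0%N x xi h isT isT hh.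
have [q1 q2] := hD a b 0%N 0%N x xi h isT isT hh.
rewrite /rpderiv /derive1n /= in r1 r2 q1 q2.
rewrite !mxE !ReImE /= mul0r subr0 in r1; rewrite !mxE !ReImE /= mul0r addr0 in r2.
have Bh : B * h ^+ 2 <= B * h0 * h.
  by rewrite expr2 -mulrA ler_wpM2l// ler_wpM2r.
have tri (t t0 t1 : R) : `|t - t0 - h * t1| <= B * h ^+ 2 -> `|t1| <= D ->
    `|t - t0| <= (B * h0 + D) * h.
  move=> h1 h2; rewrite -[t - t0](subrK (h * t1)) mulrDl.
  apply: (le_trans (ler_normD _ _)); apply: lerD; first exact: le_trans Bh.
  by rewrite normrM (ger0_norm hge0) mulrC ler_wpM2r.
by split; [apply: tri r1 q1|apply: tri r2 q2].
Qed.

(** The remainder of order h^2 becomes O(h) with all its derivatives after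
    division by h, so that p / h inherits the uniform bounds of p1 and
    converges to it. *)
Lemma subprincipal_near : (forall x xi, p0 x xi = 0) ->
  exists B : R, 0 <= B /\ forall a b h, 0 < h <= h0 ->
  [/\ bounded_x2xi1 B (fun x xi => h^-1 * Re (p x xi h a b)),
      bounded_x2xi1 B (fun x xi => h^-1 * Im (p x xi h a b)) &
      forall x xi, `|h^-1 * Re (p x xi h a b) - Re (p1 x xi a b)| <= B * h /\
                   `|h^-1 * Im (p x xi h a b) - Im (p1 x xi a b)| <= B * h].
Proof.
move=> p00; have [B [B0 hB]] := bigO_uniform _ _ _ _ p_exp.
have [D [D0 hD]] := symbol_uniform _ _ _ _ p1_symbol.
exists (B * h0 + D + B); split; first by rewrite !addr_ge0// mulr_ge0// ltW.
move=> a b h /andP[hgt0 hle].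
have hh : `|h| <= h0 by rewrite gtr0_norm.
have h00 : `|0 : R| <= h0 by rewrite normr0 ltW.
have hi : 0 < h^-1 by rewrite invr_gt0.
have hE (F : R[i] -> R) : F = @complex.Re R \/ F = @complex.Im R ->
    (fun x xi => F ((p x xi h - p0 x xi - h%:C *: p1 x xi) a b)) =
    (fun x xi => F (p x xi h a b) - h * F (p1 x xi a b)).
  move=> HF; apply/funext => x; apply/funext => xi; rewrite p00 !mxE oppr0 addr0.
  by case: HF => ->; rewrite !ReImE /= mul0r ?subr0 ?addr0.
have Bh : B * h ^+ 2 <= B * h0 * h.
  by rewrite expr2 -mulrA ler_wpM2l// ler_wpM2r// ltW.
have main (F : R[i] -> R) : F = @complex.Re R \/ F = @complex.Im R ->
    classC2 3 (fun x xi => F (p x xi h a b)) ->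
    classC2 3 (fun x xi => F (p1 x xi a b)) ->
    (forall j k x xi, (j <= 2)%N -> (k <= 1)%N ->
      `|rpderiv j k (fun x xi =>
          F ((p x xi h - p0 x xi - h%:C *: p1 x xi) a b)) x xi| <= B * h ^+ 2) ->
    (forall j k x xi, (j <= 2)%N -> (k <= 1)%N ->
      `|rpderiv j k (fun x xi => F (p1 x xi a b)) x xi| <= D) ->
    bounded_x2xi1 (B * h0 + D + B) (fun x xi => h^-1 * F (p x xi h a b)) /\
    forall x xi, `|h^-1 * F (p x xi h a b) - F (p1 x xi a b)| <=
      (B * h0 + D + B) * h.
  move=> HF s1 s2; rewrite (hE F HF) => b1 b2; split.
    have bp : bounded_x2xi1 ((B * h0 + D) * h) (fun x xi => F (p x xi h a b)).
      apply: classC2_bounded => // j k x xi j2 k1.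
      have := b1 j k x xi j2 k1; rewrite rpderiv_sub// => h1.
      have h2 := b2 j k x xi j2 k1.
      rewrite -[X in `|X|](subrK (h * rpderiv j k (fun x xi => F (p1 x xi a b)) x xi)).
      rewrite mulrDl; apply: (le_trans (ler_normD _ _)); apply: lerD.
        exact: le_trans Bh.
      by rewrite normrM gtr0_norm// mulrC ler_wpM2r// ltW.
    apply: (bounded_x2xi1_mono (h^-1 * ((B * h0 + D) * h))).
      by rewrite mulrC mulfK ?gt_eqF// lerDl.
    by apply: bounded_x2xi1_scale => //; rewrite ltW.
  move=> x xi; have := b1 0%N 0%N x xi isT isT.
  rewrite /rpderiv /derive1n /= => h1.
  have -> : h^-1 * F (p x xi h a b) - F (p1 x xi a b) =
      h^-1 * (F (p x xi h a b) - h * F (p1 x xi a b)).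
    by field; rewrite gt_eqF.
  rewrite normrM gtr0_norm// ler_pdivrMl//; apply: (le_trans h1).
  rewrite expr2 mulrCA; apply: ler_wpM2l; first exact: ltW.
  apply: ler_wpM2r; first exact: ltW.
  rewrite lerDr.
  by rewrite addr_ge0// mulr_ge0// ltW.
have [sm _] := p_symbol; have [sm1 _] := p1_symbol.
have [c1 d1] := main (@complex.Re R) (or_introl erefl) (sm h hh a b 3%N).1 (sm1 0 h00 a b 3%N).1
  (fun j k x xi j2 k1 => (hB a b j k x xi h j2 k1 hh).1)
  (fun j k x xi j2 k1 => (hD a b j k x xi h j2 k1 hh).1).
have [c2 d2] := main (@complex.Im R) (or_intror erefl) (sm h hh a b 3%N).2 (sm1 0 h00 a b 3%N).2
  (fun j k x xi j2 k1 => (hB a b j k x xi h j2 k1 hh).2)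
  (fun j k x xi j2 k1 => (hD a b j k x xi h j2 k1 hh).2).
by split.
Qed.

End Principal.
End PrincipalSymbols.

(** * The first column of the diagonalizing frame *)

Section KernelLine.
Context {R : realType}.
Local Notation k := (@kervec R).

Lemma hou0_kervec (x xi : R) : hou0 x xi *m k x xi = 0.
Proof.
apply/matrixP => r j; rewrite (ord1 j) mxE [RHS]mxE.
rewrite -[RHS](kervec_order0 x xi r); apply: eq_bigr => s _; rewrite /hou0 houE big_distrl; apply: eq_bigr => i _ /=.
by rewrite /hou_term mul0r mulr0 expi0 mulr1.
Qed.

(** In the frame U0 the matrix hou0 is block_mx 0 0 0 A with A invertible,
    and the kernel of the latter is the first coordinate axis. *)
Lemma kernel_line (x xi : R) (U0 : 'M[R[i]]_(1 + 2)) (A : 'M[R[i]]_2) :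
  U0 \is unitarymx -> ~~ eigenvalue A 0 ->
  U0^t* *m hou0 x xi *m U0 = block_mx 0 0 0 A ->
  exists kap : R[i], k x xi = kap *: (U0 *m col_mx 1 0).
Proof.
move=> /eqP U1 A0 D.
have U2 : U0^t* *m U0 = 1%:M by exact: mulmx1C.
pose z := U0^t* *m k x xi.
have z0 : block_mx (0 : 'M[R[i]]_(1, 1)) (0 : 'M[R[i]]_(1, 2)) (0 : 'M[R[i]]_(2, 1)) A *m z = 0.
  by rewrite -D /z -!mulmxA (mulmxA U0) U1 mul1mx hou0_kervec mulmx0.
have zd : dsubmx z = 0.
  move: z0; rewrite -[z]vsubmxK mul_block_col !mul0mx !add0r => /eqP.
  rewrite -col_mx0 => /eqP /eq_col_mx [_ Az].
  have uA : A \in unitmx.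
    rewrite -row_free_unit -kermx_eq0; move: A0.
    by rewrite /eigenvalue /eigenspace raddf0 subr0 negbK.
  by rewrite col_mxKd -[dsubmx z](mulKmx uA) Az mulmx0.
exists (usubmx z 0 0).
have kE : k x xi = U0 *m z by rewrite /z mulmxA U1 mul1mx.
rewrite kE -[in LHS](vsubmxK z) zd scalemxAr; congr (U0 *m _).
by rewrite scale_col_mx scaler0 {1}[usubmx z]mx11_scalar scalemx1.
Qed.

End KernelLine.

(** * Gaussian pairings and the value of the subprincipal symbol *)

Section Pairings.
Local Open Scope classical_set_scope.
Context {R : realType}.
Local Notation leb := (@lebesgue_measure R).

Lemma integral_sqr_gauss : \int[leb]_x (@gauss R x * gauss x) = Num.sqrt pi.
Proof.
rewrite (_ : Num.sqrt pi = fine (Num.sqrt pi)%:E)// -integralT_gauss.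
congr fine; apply: eq_integral => x _; congr EFin.
by rewrite /gauss /gauss_fun -expRD; congr expR; field.
Qed.

(** The derivative of x gauss^2 is gauss^2 - 2 x^2 gauss^2: the second
    moment is half the mass. *)
Lemma gauss_sqr_moments : let g2 := fun x : R => gauss x * gauss x in
  [/\ summable g2, summable (fun x => x * x * g2 x) &
      \int[leb]_x (x * x * g2 x) = Num.sqrt pi / 2].
Proof.
move=> g2; have [C hC] := @gauss_bounds R.
have cg := @continuous_gauss R.
have C0 : 0 <= C.
  by have [[h _ _] _] := hC 0; exact: lorentz_majorant_ge0 h.
have g1 (x : R) : `|gauss x| <= 1.
  rewrite ger0_norm ?gauss_ge0// -expR0 ler_expR oppr_le0 divr_ge0//.
  by rewrite -expr2 sqr_ge0.
have l1 (x : R) : lorentz x <= 1.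
  exact: lorentz_le1.
have b0 x : `|g2 x| <= C * lorentz x.
  have [[h _ _] _] := hC x; apply: le_trans h.
  by rewrite /g2 normrM ler_piMl.
have b1 x : `|x * g2 x| <= C * lorentz x.
  have [_ [h _ _]] := hC x; apply: le_trans h.
  by rewrite /g2 mulrA normrM ler_piMr.
have b2 x : `|x * x * g2 x| <= C * C * lorentz x.
  have [_ [h _ _]] := hC x.
  rewrite (_ : x * x * g2 x = (x * gauss x) * (x * gauss x)); last first.
    by rewrite /g2; ring.
  rewrite normrM (le_trans (ler_pM (normr_ge0 _) (normr_ge0 _) h h))//.
  rewrite mulrACA ler_wpM2l ?mulr_ge0// ler_piMl ?lorentz_ge0//.
have c2 : continuous g2 by rewrite /g2; cont.
have s0 : summable g2.
  by apply: (lorentz_summable _ C) => //; exact: continuous_measurable_fun.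
have s2 : summable (fun x => x * x * g2 x).
  apply: (lorentz_summable _ (C * C)) => //.
  by apply: continuous_measurable_fun; cont.
split => //.
have := @FTC_line _ (fun x => x * g2 x) (fun x => g2 x - 2 * (x * x * g2 x))
  (C + 2 * (C * C)).
rewrite RintegralB//; last exact: summableZ.
rewrite RintegralZl// integral_sqr_gauss => h.
suff : Num.sqrt pi - 2 * \int[leb]_x (x * x * g2 x) = 0.
  by move=> /eqP; rewrite subr_eq0 => /eqP ->; rewrite mulrC mulKf.
apply: h.
- by move=> x; rewrite /g2; have dg := der_gauss x; der; ring.
- by cont.
- move=> x; apply: (le_trans (ler_normB _ _)); rewrite [leRHS]mulrDl.
  apply: lerD; first exact: b0.
  by rewrite normrM [`|2|]ger0_norm// -[leRHS]mulrA ler_wpM2l.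
- move=> x; apply: (le_trans (b1 x)); rewrite ler_wpM2r ?lorentz_ge0// lerDl.
  by rewrite !mulr_ge0.
Qed.

Lemma L2dot_packet_quadpacket n (w c0 c2 : 'cV[R[i]]_n) :
  L2dot (packet w 0) (quadpacket c0 c2) =
  (Num.sqrt pi)%:C * \sum_a w a 0 * (c0 a 0 + c2 a 0 / 2)^*.
Proof.
have [s0 s2 m2] := gauss_sqr_moments.
set g2 := (fun x : R => gauss x * gauss x) in s0 s2 m2.
rewrite /L2dot big_distrr; apply: eq_bigr => a _ /=.
have hr (f : R -> R) : summable f -> csummable (fun x => (f x)%:C) /\
    cintegral (fun x => (f x)%:C) = (\int[leb]_x f x)%:C.
  move=> sf; split; first by split => //; exact: summable0.
  by apply: eqC; rewrite /cintegral /= /Rintegral ?integral0.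
have [q0 r0] := hr _ s0; have [q2 r2] := hr _ s2.
rewrite (_ : (fun x => _) = fun x => w a 0 * (c0 a 0)^* * (g2 x)%:C +
    w a 0 * (c2 a 0)^* * (x * x * g2 x)%:C); last first.
  apply/funext => x; rewrite !mxE mulr0 addr0.
  by apply: eqC; rewrite /g2 !ReImE /=; ring.
rewrite cintegralD; last 2 first.
- exact: csummableZ.
- exact: csummableZ.
rewrite !cintegralZ// r0 r2 m2 integral_sqr_gauss.
rewrite rmorphD rmorphM /= fmorphV rmorph_nat rmorphM fmorphV rmorph_nat /=.
by ring.
Qed.

End Pairings.

Section SubprincipalValue.
Local Open Scope classical_set_scope.
Context {R : realType}.
Variables (x0 xi0 : R).
Local Notation k := (kervec x0 xi0).
Local Notation p := (ptriangle x0 xi0).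

(** The combination houlim0 + houlim2 / 2 is the term summed in
    [kervec_order2]. *)
Lemma kervec_houlim :
  \sum_(r < 1 + 2) k r 0 * (houlim0 x0 xi0 r 0 + houlim2 x0 xi0 r 0 / 2)^* =
  (- ((3 - p) / 2))%:C.
Proof.
rewrite (_ : (- ((3 - p) / 2))%:C = ((- ((3 - p) / 2))%:C)^*); last first.
  by apply: eqC; rewrite /= ?oppr0.
rewrite -kervec_order2 rmorph_sum; apply: eq_bigr => r _.
rewrite [RHS]rmorphM /=; congr (_ * _); first by rewrite conjcK.
congr (_^*); rewrite !mxE big_distrl -big_split; apply: eq_bigr => s _ /=.
rewrite big_distrl -big_split; apply: eq_bigr => j _ /=.
rewrite !(rmorphM, rmorphD, rmorphN, rmorphXn, fmorphV, rmorph_nat) /=.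
by field.
Qed.

Lemma subprincipal_eq (c kap : R[i]) (w : 'cV[R[i]]_(1 + 2)) :
  k = kap *: w ->
  (Num.sqrt pi)%:C * (c * kap^*) = L2dot (packet w 0)
    (quadpacket (houlim0 x0 xi0) (houlim2 x0 xi0)) ->
  c * (sqnorm kap)%:C = (- ((3 - p) / 2))%:C.
Proof.
move=> kw; rewrite L2dot_packet_quadpacket => E.
have spi : (Num.sqrt pi)%:C != 0 :> R[i].
  by rewrite fmorph_eq0 gt_eqF// sqrtr_gt0 pi_gt0.
rewrite -mul_conj mulrCA (mulfI spi E) big_distrr -kervec_houlim.
apply: eq_bigr => r _ /=.
have -> : k r 0 = kap * w r 0 by rewrite kw mxE.
by rewrite mulrA.
Qed.

(** If the norm of [kervec] vanished, then expi (- x0), expi (x0 - xi0) and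
    expi xi0 would all be equal to -1, although their product is 1. *)
Lemma ptriangle_gtN3 : 0 < 3 + p.
Proof.
rewrite -(@pmulr_rgt0 _ 2)// -sqnorm_kervec.
rewrite lt_def sumr_ge0 ?andbT; last by move=> r _; exact: sqnorm_ge0.
rewrite psumr_eq0; last by move=> r _; exact: sqnorm_ge0.
apply/allP => h0; have z (r : 'I_(1 + 2)) : kervec x0 xi0 r 0 = 0.
  have := h0 r (mem_index_enum _); rewrite /= paddr_eq0 ?sqr_ge0// !sqrf_eq0.
  by move=> /andP[/eqP ? /eqP ?]; exact: eqC.
have z0 := z ord0; have z2 := z (@inord 2 2); have z1 := z (@inord 2 1).
rewrite !mxE /= ?inordK//= in z0 z1 z2.
have e0 : expi (- x0) = -1 :> R[i] by apply/eqP; rewrite -addr_eq0 addrC z0.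
have e2 : expi xi0 = -1 :> R[i] by apply/eqP; rewrite -addr_eq0 addrC z2.
have e3 : expi x0 = -1 :> R[i].
  have := expi_mulN x0; rewrite e0 mulN1r => /eqP; rewrite eqr_oppLR => /eqP.
  by [].
have e4 : expi (- xi0) = -1 :> R[i].
  have := expi_mulN xi0; rewrite e2 mulrN1 => /eqP; rewrite eqr_oppLR => /eqP.
  by [].
by move: z1; rewrite e3 e4 mulrNN mulr1 => /eqP; rewrite -[1 + 1]/(2%:R) pnatr_eq0.
Qed.

(** As w is a unit vector, |kap|^2 is the square norm of [kervec]. *)
Lemma subprincipal_solve (c kap : R[i]) (w : 'cV[R[i]]_(1 + 2)) :
  k = kap *: w -> \sum_r sqnorm (w r 0) = 1 ->
  c * (sqnorm kap)%:C = (- ((3 - p) / 2))%:C ->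
  c = (- ((3 - p) / (4 * (3 + p))))%:C.
Proof.
move=> kw w1; have p0 := ptriangle_gtN3.
have -> : sqnorm kap = 2 * (3 + p).
  rewrite -sqnorm_kervec kw; under eq_bigr do rewrite mxE sqnormM.
  by rewrite -mulr_sumr w1 mulr1.
have n0 : (2 * (3 + p))%:C != 0 :> R[i].
  by rewrite fmorph_eq0 mulf_neq0// gt_eqF.
move=> E; apply: (mulIf n0); rewrite E -rmorphM; congr (_%:C).
by rewrite /=; field; rewrite gt_eqF.
Qed.

End SubprincipalValue.

(** * Block diagonalization *)

Section BlockDiagonalization.
Local Open Scope classical_set_scope.
Context {R : realType}.

Lemma L2_col_mx m n (u : R -> 'cV[R[i]]_m) (v : R -> 'cV[R[i]]_n) :
  L2 u -> L2 v -> L2 (fun x => col_mx (u x) (v x)).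
Proof.
move=> Lu Lv a; case: (split_ordP a) => b ->.
- by have [h1 h2 h3] := Lu b; split; under eq_fun do rewrite col_mxEu.
- by have [h1 h2 h3] := Lv b; split; under eq_fun do rewrite col_mxEd.
Qed.

Lemma L2_dsubmx m n (u : R -> 'cV[R[i]]_(m + n)) :
  L2 u -> L2 (fun x => dsubmx (u x)).
Proof.
move=> Lu a; have [h1 h2 h3] := Lu (rshift m a).
by split; under eq_fun do rewrite mxE.
Qed.

Lemma L2dotZl n (c : R[i]) (u v : R -> 'cV[R[i]]_n) : L2 u -> L2 v ->
  L2dot (fun x => c *: u x) v = c * L2dot u v.
Proof.
move=> Lu Lv; rewrite /L2dot big_distrr; apply: eq_bigr => a _ /=.
rewrite -cintegralZ; last exact: csummable_mul_conj.
by congr cintegral; apply/funext => x; rewrite mxE mulrA.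
Qed.

Lemma L2dotZr n (c : R[i]) (u v : R -> 'cV[R[i]]_n) : L2 u -> L2 v ->
  L2dot u (fun x => c *: v x) = c^* * L2dot u v.
Proof.
move=> Lu Lv; rewrite (L2dotC _ _ _ Lu (L2Z _ _ _ Lv)) L2dotZl//.
by rewrite [X in _ = _ * X](L2dotC _ _ _ Lu Lv) rmorphM.
Qed.

Lemma L2dot_col_mx0 m n (g : R -> 'cV[R[i]]_m) (u : R -> 'cV[R[i]]_m)
    (v : R -> 'cV[R[i]]_n) :
  L2dot (fun x => col_mx (g x) 0) (fun x => col_mx (u x) (v x)) = L2dot g u.
Proof.
rewrite /L2dot big_split_ord /= [X in _ + X]big1 ?addr0 => [|a _].
  apply: eq_bigr => a _; congr cintegral; apply/funext => x.
  by rewrite !col_mxEu.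
rewrite (_ : (fun x => _) = fun=> 0).
  by apply: eqC; rewrite /cintegral /= /Rintegral integral0.
by apply/funext => x; rewrite !col_mxEd mxE mul0r.
Qed.

(** Moving U to the right-hand side leaves S M chi = S M U (S chi), which is
    block diagonal on S chi; its second block is orthogonal to (g, 0). *)
Lemma block_pairing m n (M U S : @operator R (m + n) (m + n))
    (mu : @operator R m m) (At : @operator R n n)
    (g : R -> 'cV[R[i]]_m) (chi : R -> 'cV[R[i]]_(m + n)) :
  bounded_operator M -> unitary_with_adjoint U S ->
  selfadjoint mu -> bounded_operator At ->
  eqop (S \o M \o U) (diag_operator mu At) -> L2 g -> L2 chi ->
  L2dot (U (fun x => col_mx (g x) 0)) (M chi) =
  L2dot (mu g) (fun x => usubmx (S chi x)).
Proof.
move=> bM [[bU bS US] _ USid] [bmu _ muS] [AtL _ _] D Lg Lchi.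
have [ML _ _] := bM; have [SL _ _] := bS; have [UL _ _] := bU.
have [muL _ _] := bmu.
have Lg1 : L2 (fun x => col_mx (g x) (0 : 'cV[R[i]]_n)).
  by apply: L2_col_mx => //; exact: L20.
have Leta := SL _ Lchi; have LUeta := UL _ Leta.
have Lu := L2_usubmx _ _ _ Leta; have Ld := L2_dsubmx _ _ _ Leta.
rewrite US//; last exact: ML.
rewrite (L2dot_eqae_r _ _ _ (diag_operator mu At (S chi)) Lg1).
- by rewrite L2dot_col_mx0 muS.
- exact/SL/ML.
- by apply: L2_col_mx; [exact: muL|exact: AtL].
- apply: eqae_trans (D _ Leta); apply: bounded_operator_eqae bS _ _ _.
  + exact: ML.
  + exact: ML.
  + apply: bounded_operator_eqae bM _ _ _ => //.
    exact/eqae_sym/USid.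
Qed.

(** S is an isometry, and it maps U g to g. *)
Lemma adjoint_distance n (U S : @operator R n n) (kap : R[i])
    (g chi : R -> 'cV[R[i]]_n) :
  unitary_with_adjoint U S -> L2 g -> L2 chi ->
  sqL2 (fun x => S chi x - kap *: g x) = sqL2 (fun x => chi x - kap *: U g x).
Proof.
move=> uU Lg Lchi; have [[bU bS _] SUid _] := uU.
have [UL _ _] := bU; have [SL Slin _] := bS.
have LUg := UL _ Lg.
have Ld : L2 (fun x => (- kap) *: U g x + chi x) by exact: L2_lin.
rewrite (_ : (fun x => chi x - _) = fun x => (- kap) *: U g x + chi x); last first.
  by apply/funext => x; rewrite scaleNr addrC.
rewrite -(adjoint_isometry _ _ _ _ uU Ld); apply: sqL2_eqae.
- by apply: L2B; [exact: SL|exact: L2Z].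
- exact: SL.
- apply: eqae_sym; apply: eqae_trans (Slin _ _ _ LUg Lchi) _.
  by apply: ae_imply (SUid _ Lg) => x /= ->; rewrite scaleNr addrC.
Qed.

Lemma L2cvg_usubmx m n (u_ : nat -> R -> 'cV[R[i]]_(m + n)) u :
  L2cvg u_ u ->
  L2cvg (fun k x => usubmx (u_ k x)) (fun x => usubmx (u x)).
Proof.
move=> [Lu_ Lu cu]; split.
- by move=> k; exact: L2_usubmx.
- exact: L2_usubmx.
apply: (squeeze_cvgr _ _ cu); last exact: (@cvg_cst _ (0 : R)).
apply: nearW => k; rewrite sqL2_ge0 /=.
rewrite (_ : (fun x => _) = fun x => usubmx (u_ k x - u x)).
  exact: sqL2_usubmx.
by apply/funext => x; apply/matrixP => a j; rewrite !mxE.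
Qed.

End BlockDiagonalization.

(** * Passage to the limit *)

Section SubprincipalSymbol.
Local Open Scope classical_set_scope.
Context {R : realType}.
Local Notation Re := complex.Re.
Local Notation Im := complex.Im.
Variables (h0 : R) (h0_gt0 : 0 < h0).
Variables (OpM U S : R -> @operator R (1 + 2) (1 + 2)).
Variables (mu : R -> @operator R 1 1) (At : R -> @operator R 2 2).
Variables (sU : R -> R -> R -> 'M[R[i]]_(1 + 2)) (smu : R -> R -> R -> 'M[R[i]]_1).
Variables (U0 : R -> R -> 'M[R[i]]_(1 + 2)) (p1 : R -> R -> 'M[R[i]]_1).
Hypotheses (OpM_weyl : forall h, 0 < `|h| <= h0 ->
    weyl_quantization h hou (OpM h))
  (U_symbol : weyl_symbol_of h0 U sU) (mu_symbol : weyl_symbol_of h0 mu smu)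
  (At_bounded : forall h, 0 < `|h| <= h0 -> bounded_operator (At h))
  (U_unitary : forall h, 0 < `|h| <= h0 -> unitary_with_adjoint (U h) (S h))
  (U_principal : principal_symbol h0 sU U0)
  (mu_selfadjoint : forall h, 0 < `|h| <= h0 -> selfadjoint (mu h))
  (p1_symbol : symbol h0 (fun x xi _ => p1 x xi))
  (mu_exp : bigO_h2 h0 (fun x xi h => smu x xi h - 0 - h%:C *: p1 x xi))
  (U_diag : forall h, 0 < `|h| <= h0 ->
    eqop (S h \o OpM h \o U h) (diag_operator (mu h) (At h))).

(** A sequence of admissible scales: h = scale^2 is positive and at most h0. *)
Definition scale (l : nat) : R := Num.min 1 h0 * harmonic l.

Lemma scale_gt0 l : 0 < scale l.
Proof. by rewrite mulr_gt0 ?lt_min ?ltr01//= invr_gt0 ltr0n. Qed.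

Lemma scale_le l : scale l <= Num.min 1 h0.
Proof.
apply: ler_piMr; first by rewrite ltW// lt_min ltr01.
by rewrite /harmonic /= invf_le1 ?ltr0n// ler1n.
Qed.

Lemma scale_le1 l : scale l <= 1.
Proof. by apply: (le_trans (scale_le l)); rewrite ge_min lexx. Qed.

Lemma scale_sqr_le l : 0 < scale l ^+ 2 <= h0.
Proof.
have h1 := scale_gt0 l; have h2 := scale_le1 l.
rewrite exprn_gt0//= expr2 (le_trans (ler_piMr (ltW h1) h2))//.
by apply: (le_trans (scale_le l)); rewrite ge_min lexx orbT.
Qed.

Lemma scale_sqr_norm l : 0 < `|scale l ^+ 2| <= h0.
Proof. by have /andP[h1 h2] := scale_sqr_le l; rewrite gtr0_norm// h1. Qed.

Lemma cvg_scale : scale @ \oo --> (0 : R).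
Proof.
rewrite -[X in _ --> X](mulr0 (Num.min 1 h0)); apply: cvgMr.
exact: cvg_harmonic.
Qed.

Lemma cvg_scale_sqr (B : R) : (fun l => B * scale l ^+ 2) @ \oo --> (0 : R).
Proof.
rewrite -[X in _ --> X](mulr0 B); apply: cvgMr.
rewrite -[X in _ --> X](mulr0 0); under eq_fun do rewrite expr2.
by apply: cvgM; exact: cvg_scale.
Qed.

Variables (x0 xi0 : R).
Local Notation k := (kervec x0 xi0).
Local Notation W l := (wave (scale l) x0 xi0).
Local Notation unW l := (unwave (scale l) x0 xi0).
Local Notation e1 := (col_mx 1 0 : 'cV[R[i]]_(1 + 2)).

Lemma L2cvg_U :
  L2cvg (fun l => unW l (U (scale l ^+ 2) (W l (packet e1 0))))
    (packet (U0 x0 xi0 *m e1) 0).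
Proof.
have [U0_symbol [q1 [q1_symbol U_exp]]] := U_principal.
have [B1 hB1] := symbol_bounded _ _ _ _ U_symbol.1.
have [B2 [_ hB2]] := principal_near _ _ _ h0_gt0 _ _ _ q1_symbol U_exp.
have E (F : R[i] -> R) h a b : (fun x xi => F (1%:C * sU x xi h a b)) =
    fun x xi => F (sU x xi h a b).
  by apply/funext => x; apply/funext => xi; rewrite mul1r.
have sn l : `|scale l ^+ 2| <= h0 by have /andP[_] := scale_sqr_norm l.
have := @L2cvg_operator_packet R _ _ sU U scale (fun=> 1)
  (fun l => B2 * scale l ^+ 2) B1 U0 x0 xi0 scale_gt0 scale_le1 cvg_scale
  (fun=> oner_neq0 _) (cvg_scale_sqr B2) _ _ _ _ e1.
move=> h; have {h} := h _ _ _ _.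
rewrite (_ : (fun l => _) = fun l =>
    unW l (U (scale l ^+ 2) (W l (packet e1 0)))); last first.
  by apply/funext => l; apply/funext => X; rewrite scale1r.
apply.
- by move=> l; exact: U_symbol.2 _ (scale_sqr_norm l).
- by move=> l a b; rewrite !E; exact: hB1 _ _ _ (sn l).
- by move=> a b; exact: symbol_continuous h0_gt0 U0_symbol.
- move=> l a b x xi; rewrite !mul1r; apply: hB2.
  by have /andP[/ltW -> ->] := scale_sqr_le l.
Qed.

Lemma L2cvg_mu :
  L2cvg (fun l X => ((scale l ^+ 2)^-1)%:C *:
      unW l (mu (scale l ^+ 2) (W l (packet 1 0))) X)
    (packet (p1 x0 xi0) 0).
Proof.
have [B [_ hB]] := subprincipal_near _ _ _ h0_gt0 _ _ _ mu_symbol.1 p1_symbol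
  mu_exp (fun _ _ => erefl).
have reE (r : R) (z : R[i]) : Re (r%:C * z) = r * Re z.
  by rewrite ReM /= mul0r subr0.
have imE (r : R) (z : R[i]) : Im (r%:C * z) = r * Im z.
  by rewrite ImM /= mul0r addr0.
rewrite -[p1 x0 xi0]mulmx1.
apply: (@L2cvg_operator_packet R _ _ smu mu scale (fun l => (scale l ^+ 2)^-1)
  (fun l => B * scale l ^+ 2) B p1 x0 xi0).
- exact: scale_gt0.
- exact: scale_le1.
- exact: cvg_scale.
- by move=> l; rewrite gt_eqF// invr_gt0 exprn_gt0// scale_gt0.
- exact: cvg_scale_sqr.
- by move=> l; exact: mu_symbol.2 _ (scale_sqr_norm l).
- move=> l a b; have [b1 b2 _] := hB a b _ (scale_sqr_le l).
  rewrite (_ : (fun x xi => Re _) = fun x xi =>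
    (scale l ^+ 2)^-1 * Re (smu x xi (scale l ^+ 2) a b)); last first.
    by apply/funext => x; apply/funext => xi; rewrite reE.
  rewrite (_ : (fun x xi => Im _) = fun x xi =>
    (scale l ^+ 2)^-1 * Im (smu x xi (scale l ^+ 2) a b)); last first.
    by apply/funext => x; apply/funext => xi; rewrite imE.
  by [].
- by move=> a b; exact: symbol_continuous h0_gt0 p1_symbol.
- move=> l a b x xi; have [_ _ h] := hB a b _ (scale_sqr_le l).
  by rewrite reE imE; exact: h.
Qed.

Variables (kap : R[i]) (k_line : k = kap *: (U0 x0 xi0 *m e1)).

Lemma wave_col_mx l :
  W l (packet e1 0) = fun x => col_mx (W l (packet 1 0) x) (0 : 'cV[R[i]]_2).
Proof.
apply/funext => x; rewrite /wave /twist /packet !scaler0 !addr0.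
by rewrite !scale_col_mx !scaler0.
Qed.

Lemma unwaveZ n l (c : R[i]) (u : R -> 'cV[R[i]]_n) X :
  unW l (fun x => c *: u x) X = c *: unW l u X.
Proof. by rewrite /unwave /twist !scalerA mulrC. Qed.

Lemma unwave_usubmx m n l (u : R -> 'cV[R[i]]_(m + n)) :
  unW l (fun x => usubmx (u x)) = fun X => usubmx (unW l u X).
Proof.
by apply/funext => X; apply/matrixP => a b; rewrite /unwave /twist !mxE.
Qed.

Lemma L2dot_unwave n l (u v : R -> 'cV[R[i]]_n) : L2 u -> L2 v ->
  L2dot (unW l u) (unW l v) = ((scale l)^-1)%:C * L2dot u v.
Proof.
move=> Lu Lv; have s0 := scale_gt0 l.
rewrite (L2dot_twist (fun X => - ((x0 + scale l * X) * (xi0 / scale l ^+ 2)))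
  (scale l) x0 s0 _ _ _ Lu Lv) mulrA -rmorphM mulVf ?gt_eqF//.
by rewrite rmorph1 mul1r.
Qed.

Lemma sqL2_unwave_sub n l (u v : R -> 'cV[R[i]]_n) : L2 u -> L2 v ->
  sqL2 (fun X => unW l u X - unW l v X) = (scale l)^-1 * sqL2 (fun x => u x - v x).
Proof.
move=> Lu Lv; have s0 := scale_gt0 l.
rewrite (@sqL2_twist _ (fun X => - ((x0 + scale l * X) * (xi0 / scale l ^+ 2))) _
  x0 s0 _ _ (L2B _ _ _ Lu Lv)).
rewrite mulKf ?gt_eqF//; congr sqL2; apply/funext => X.
by rewrite /unwave /twist scalerBr.
Qed.

(** U maps (kap G, 0) asymptotically to kap w G = k G, the limit of the test
    function, with G the rescaled Gaussian and w the first column of U0; by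
    [adjoint_distance] the adjoint S maps the test function back. *)
Lemma L2cvg_adjoint :
  L2cvg (fun l => unW l (S (scale l ^+ 2)
      (W l (packet k ((scale l)%:C *: kercor x0 xi0)))))
    (packet (kap *: e1) 0).
Proof.
pose chi l := W l (packet k ((scale l)%:C *: kercor x0 xi0)).
pose g l := W l (packet e1 0).
have Lchi l : L2 (chi l) by apply: L2_wave (scale_gt0 l) _; exact: L2_packet.
have Lg l : L2 (g l) by apply: L2_wave (scale_gt0 l) _; exact: L2_packet.
have uU l := U_unitary _ (scale_sqr_norm l).
have LS l u : L2 u -> L2 (S (scale l ^+ 2) u).
  by have [[_ [h _ _] _] _ _] := uU l; exact: h.
have LU l u : L2 u -> L2 (U (scale l ^+ 2) u).
  by have [[[h _ _] _ _] _ _] := uU l; exact: h.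
have chiK l : unW l (chi l) = packet k ((scale l)%:C *: kercor x0 xi0).
  by apply: waveK; exact: scale_gt0.
have gK l : unW l (fun x => kap *: g l x) = packet (kap *: e1) 0.
  rewrite (_ : (fun x => _) = W l (packet (kap *: e1) 0)).
    by apply: waveK; exact: scale_gt0.
  apply/funext => x; rewrite /g /wave /twist /packet !scaler0 !addr0 !scalerA.
  by congr (_ *: _); ring.
have [_ _ cv] := L2cvg_sub _ _ _ _ _ (L2cvg_packet _ k (kercor x0 xi0) _ cvg_scale)
  (L2cvgZ _ kap _ _ L2cvg_U).
split; first by move=> l; apply: L2_unwave (scale_gt0 l) _; exact/LS/Lchi.
  exact: L2_packet.
rewrite (_ : (fun l => sqL2 _) = fun l => sqL2 (fun X =>
    packet k ((scale l)%:C *: kercor x0 xi0) X - kap *: unW l (U (scale l ^+ 2) (g l)) X -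
    (packet k 0 X - kap *: packet (U0 x0 xi0 *m e1) 0 X))); first exact: cv.
apply/funext => l.
transitivity (sqL2 (fun X => unW l (S (scale l ^+ 2) (chi l)) X -
    unW l (fun x => kap *: g l x) X)); first by rewrite gK.
rewrite (sqL2_unwave_sub _ _ _ _ (LS l _ (Lchi l)) (L2Z _ kap _ (Lg l))).
rewrite (adjoint_distance _ _ _ _ _ _ (uU l) (Lg l) (Lchi l)).
rewrite -(sqL2_unwave_sub _ _ _ _ (Lchi l) (L2Z _ kap _ (LU l _ (Lg l)))).
congr sqL2; apply/funext => X; rewrite chiK unwaveZ.
have -> : packet k 0 X = kap *: packet (U0 x0 xi0 *m e1) 0 X.
  by rewrite k_line /packet !scaler0 !addr0 !scalerA mulrC.
by rewrite [X in _ = _ - X]subrr [RHS]subr0.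
Qed.

(** The limit of [block_pairing] divided by h. *)
Lemma subprincipal_pairing :
  (Num.sqrt pi)%:C * (p1 x0 xi0 0 0 * kap^*) =
  L2dot (packet (U0 x0 xi0 *m e1) 0)
    (quadpacket (houlim0 x0 xi0) (houlim2 x0 xi0)).
Proof.
have cM := L2cvg_hou x0 xi0 OpM scale scale_gt0 scale_le1 cvg_scale
  (fun l => OpM_weyl _ (scale_sqr_norm l)).
have cE := L2cvg_usubmx _ _ _ _ L2cvg_adjoint.
rewrite (L2dot_lim_unique _ _ _ _ _ _ _ _ _ _ L2cvg_U cM L2cvg_mu cE) => [|l].
  rewrite (_ : (fun X => usubmx _) = quadpacket kap%:M 0); last first.
    apply/funext => X; apply/matrixP => a b; rewrite (ord1 a) (ord1 b).
    rewrite mxE /packet /quadpacket !scaler0 !addr0 [LHS]mxE [RHS]mxE; congr (_ * _).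
    by rewrite [LHS]mxE col_mxEu !mxE eqxx mulr1.
  rewrite L2dot_packet_quadpacket big_ord1; congr (_ * (_ * _)).
  by rewrite !mxE mul0r addr0 eqxx.
have hl := scale_sqr_norm l; have sl := scale_gt0 l.
set h := scale l ^+ 2 in hl *.
pose chi := W l (packet k ((scale l)%:C *: kercor x0 xi0)).
have Lchi : L2 chi by apply: L2_wave sl _; exact: L2_packet.
have Lg1 : L2 (W l (packet e1 0)) by apply: L2_wave sl _; exact: L2_packet.
have Lg : L2 (W l (packet (1 : 'cV[R[i]]_1) 0)).
  by apply: L2_wave sl _; exact: L2_packet.
have [[bU bS _] _ _] := U_unitary _ hl.
have [UL _ _] := bU; have [SL _ _] := bS.
have [bM _] := OpM_weyl _ hl; have [ML _ _] := bM.
have [[muL _ _] _ _] := mu_selfadjoint _ hl.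
have LU := UL _ Lg1; have LS := SL _ Lchi; have LM := ML _ Lchi.
have Lmu := muL _ Lg; have Lu := L2_usubmx _ _ _ LS.
rewrite L2dotZr; [|exact: L2_unwave sl LU|exact: L2_unwave sl LM].
rewrite -unwave_usubmx L2dotZl;
  [|exact: L2_unwave sl Lmu|exact: L2_unwave sl Lu].
have cr (r : R) : (r%:C : R[i])^* = r%:C by apply: eqC; rewrite /= ?oppr0.
congr (_ * _); first exact: cr.
rewrite !L2dot_unwave// wave_col_mx; congr (_ * _).
exact: (block_pairing _ _ (OpM h) (U h) (S h) (mu h) (At h) _ _ bM
  (U_unitary _ hl) (mu_selfadjoint _ hl) (At_bounded _ hl) (U_diag _ hl) Lg Lchi).
Qed.

End SubprincipalSymbol.

Lemma sqnorm_unitary_col (R : realType) m n (V : 'M[R[i]]_(m + n))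
    (a : 'cV[R[i]]_m) : V \is unitarymx ->
  \sum_r sqnorm ((V *m col_mx a 0) r 0) = \sum_r sqnorm (a r 0).
Proof.
move=> /eqP /mulmx1C V1.
have E p (v : 'cV[R[i]]_p) : (\sum_r sqnorm (v r 0))%:C = (v^t* *m v) 0 0.
  rewrite mxE rmorph_sum; apply: eq_bigr => r _ /=.
  by rewrite -mul_conj mulrC !mxE.
have [] // : (\sum_r sqnorm ((V *m col_mx a 0) r 0))%:C =
    (\sum_r sqnorm (a r 0))%:C.
rewrite !E trmx_mul map_mxM -mulmxA (mulmxA _ V) V1 mul1mx -!E.
congr (_%:C); rewrite big_split_ord /= [X in _ + X]big1 ?addr0 => [|r _].
  by apply: eq_bigr => r _; rewrite col_mxEu.
by rewrite col_mxEd mxE /sqnorm /= expr0n /= addr0.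
Qed.

Theorem proposition7p4 (R : realType) (h0 : R) (h0_gt0 : 0 < h0)
  (U0 : R -> R -> 'M[R[i]]_(1 + 2)) (A : R -> R -> 'M[R[i]]_2)
  (U0_smooth : smooth2_mx U0)
  (U0_periodic : forall x xi : R,
     U0 (x + 2 * pi) xi = U0 x xi /\ U0 x (xi + 2 * pi) = U0 x xi)
  (U0_unitary : forall x xi : R, U0 x xi \is unitarymx)
  (A_selfadjoint : forall x xi : R, A x xi \is hermsymmx)
  (A_spectrum : forall (x xi : R) (l : R[i]), eigenvalue (A x xi) l ->
     exists2 r : R, l = r%:C &
       (- (2 * Num.sqrt 3) <= r <= - Num.sqrt 3) \/
       (Num.sqrt 3 <= r <= 2 * Num.sqrt 3))
  (U0_diag : forall x xi : R,
     (U0 x xi)^t* *m hou0 x xi *m U0 x xi = block_mx 0 0 0 (A x xi))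
  (OpM U Ustar : R -> @operator R (1 + 2) (1 + 2))
  (mu : R -> @operator R 1 1) (At : R -> @operator R 2 2)
  (sU : R -> R -> R -> 'M[R[i]]_(1 + 2))
  (smu : R -> R -> R -> 'M[R[i]]_1) (sAt : R -> R -> R -> 'M[R[i]]_2)
  (OpM_weyl : forall h : R, 0 < `|h| <= h0 ->
     weyl_quantization h hou (OpM h))
  (U_symbol : weyl_symbol_of h0 U sU)
  (mu_symbol : weyl_symbol_of h0 mu smu)
  (At_symbol : weyl_symbol_of h0 At sAt)
  (U_unitary : forall h : R, 0 < `|h| <= h0 ->
     unitary_with_adjoint (U h) (Ustar h))
  (U_principal : principal_symbol h0 sU U0)
  (mu_selfadjoint : forall h : R, 0 < `|h| <= h0 -> selfadjoint (mu h))
  (mu_principal : principal_symbol h0 smu (fun _ _ => 0))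
  (At_selfadjoint : forall h : R, 0 < `|h| <= h0 -> selfadjoint (At h))
  (At_principal : principal_symbol h0 sAt A)
  (U_diag : forall h : R, 0 < `|h| <= h0 ->
     eqop (Ustar h \o OpM h \o U h) (diag_operator (mu h) (At h))) :
  bigO_h2 h0 (fun x xi h =>
    smu x xi h -
    (- h * ((3 - ptriangle x xi) / (4 * (3 + ptriangle x xi))))%:C%:M).
Proof.
have [_ [p1 [p1_symbol mu_exp]]] := mu_principal.
have p1E x xi : p1 x xi =
    (- ((3 - ptriangle x xi) / (4 * (3 + ptriangle x xi))))%:C%:M.
  have A0 : ~~ eigenvalue (A x xi) 0.
    apply/negP => /A_spectrum[r [r0] bounds].
    have s3 : 0 < Num.sqrt 3 :> R by rewrite sqrtr_gt0.
    (* 0 lies in the spectral gap between - sqrt 3 and sqrt 3. *)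
    by case: bounds => /andP[b1 b2]; lra.
  have [kap k_line] := kernel_line _ _ _ _ (U0_unitary x xi) A0 (U0_diag x xi).
  have At_bounded h : 0 < `|h| <= h0 -> bounded_operator (At h).
    by move=> /At_selfadjoint[].
  have E := subprincipal_pairing _ h0_gt0 _ _ _ _ _ _ _ _ _ OpM_weyl U_symbol
    mu_symbol At_bounded U_unitary U_principal mu_selfadjoint p1_symbol mu_exp
    U_diag _ _ _ k_line.
  apply/matrixP => a b; rewrite (ord1 a) (ord1 b) mxE eqxx mulr1n.
  apply: (subprincipal_solve _ _ _ _ _ k_line).
    rewrite sqnorm_unitary_col//.
    by rewrite big_ord1 mxE eqxx /sqnorm /= expr1n expr0n /= addr0.
  exact: subprincipal_eq k_line E.
rewrite (_ : (fun x xi h => _) = fun x xi h =>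
    smu x xi h - 0 - h%:C *: p1 x xi); first exact: mu_exp.
apply/funext => x; apply/funext => xi; apply/funext => h.
by rewrite subr0 p1E scale_scalar_mx -rmorphM mulNr mulrN.
Qed.
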